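(* Let $M_p$, $A_p$ be weight sequences satisfying the standing assumptions and let $\mathcal{V}=(v_n)_{n}$ be a decreasing weight system on $\mathbb{R}^d$ satisfying the standing assumptions (see context). Let $(\ast,\dagger)$ be either $((M_p),(A_p))$ (Beurling case) or $(\{M_p\},\{A_p\})$ (Roumieu case). The following three topologies coincide on $\mathcal{B}'^{\ast}_{\mathcal{V}}(\mathbb{R}^d)$: (i) The initial topology with respect to the mapping $\mathcal{B}'^{\ast}_{\mathcal{V}}(\mathbb{R}^d) \rightarrow L_b(\mathcal{S}^\ast_\dagger(\mathbb{R}^d), \mathcal{B}^\ast_{\mathcal{V}^\circ}(\mathbb{R}^d))$, $f \mapsto \ast_f$. (ii) The initial topology with respect to the mapping $\mathcal{B}'^{\ast}_{\mathcal{V}}(\mathbb{R}^d) \rightarrow L_b(\mathcal{S}^\ast_\dagger(\mathbb{R}^d), \mathcal{V}^\circ C(\mathbb{R}^d))$, $f \mapsto \ast_f$. (iii) In the Beurling case, the topology $bs(\mathcal{B}'^{(M_p)}_{\mathcal{V}}(\mathbb{R}^d),\mathcal{B}^{(M_p)}_{\mathcal{V}}(\mathbb{R}^d))$; in the Roumieu case, the strong topology $b(\mathcal{B}'^{\{M_p\}}_{\mathcal{V}}(\mathbb{R}^d),\mathcal{B}^{\{M_p\}}_{\mathcal{V}}(\mathbb{R}^d))$.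
   Context: Weight sequences. For a sequence $(M_p)_{p\in\mathbb{N}}$ of positive reals ($\mathbb N=\{0,1,2,\dots\}$) put $m_p := M_p/M_{p-1}$, $p\ge 1$. It is a weight sequence if $m_p\to\infty$. Write $M_\alpha=M_{|\alpha|}$ for $\alpha\in\mathbb{N}^d$. $(M.1)$: $M_p^2\le M_{p-1}M_{p+1}$, $p\ge1$. $(M.2)$: $M_{p+q}\le C_0H^{p+q}M_pM_q$ for all $p,q$, for some $C_0,H\ge1$. $M_p\prec N_p$ means: for every $h>0$ there is $C>0$ with $M_p\le Ch^pN_p$ for all $p$. The associated function of $A_p$ is $A(t)=\sup_{p}\log(t^pA_0/A_p)$ for $t>0$, $A(0)=0$, and $A(x)=A(|x|)$ for $x\in\mathbb{R}^d$. Gelfand-Shilov spaces. $\mathcal{S}^{M_p,h}_{A_p,\lambda}(\mathbb{R}^d)$ ($h,\lambda>0$) is the Banach space of $\varphi\in C^\infty(\mathbb{R}^d)$ with $\sup_{\alpha}\sup_{x}h^{|\alpha|}|\varphi^{(\alpha)}(x)|e^{A(\lambda x)}/M_\alpha<\infty$; $\mathcal{S}^{(M_p)}_{(A_p)}(\mathbb{R}^d)=\varprojlim_{h\to\infty}\mathcal{S}^{M_p,h}_{A_p,h}(\mathbb{R}^d)$, $\mathcal{S}^{\{M_p\}}_{\{A_p\}}(\mathbb{R}^d)=\varinjlim_{h\to0^+}\mathcal{S}^{M_p,h}_{A_p,h}(\mathbb{R}^d)$; $\mathcal{S}'^\ast_\dagger$ denotes the dual of $\mathcal{S}^\ast_\dagger$.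 Weight systems. An increasing (decreasing) weight system on $\mathbb{R}^d$ is a pointwise increasing (decreasing) sequence of positive continuous functions on $\mathbb R^d$. For a decreasing weight system $\mathcal{V}=(v_n)_n$ the dual weight system is the increasing weight system $\mathcal{V}^\circ=(v_n^{-1})_n$. For a positive continuous $w$ and $h>0$, $\mathcal{B}^{M_p,h}_w(\mathbb{R}^d)$ is the Banach space of $\varphi\in C^\infty(\mathbb{R}^d)$ with $\sup_{\alpha}\sup_{x}h^{|\alpha|}|\varphi^{(\alpha)}(x)|w(x)/M_\alpha<\infty$; $\mathcal{B}^{(M_p)}_w=\varprojlim_{h\to\infty}\mathcal{B}^{M_p,h}_w$, $\mathcal{B}^{\{M_p\}}_w=\varinjlim_{h\to0^+}\mathcal{B}^{M_p,h}_w$. For decreasing $\mathcal{V}=(v_n)_n$: $\mathcal{B}^{\ast}_\mathcal{V}=\varinjlim_n\mathcal{B}^{\ast}_{v_n}$ for $\ast=(M_p)$ or $\{M_p\}$. For increasing $\mathcal{W}=(w_N)_N$: $\mathcal{B}^{M_p,h}_\mathcal{W}=\varprojlim_N\mathcal{B}^{M_p,h}_{w_N}$, $\mathcal{B}^{(M_p)}_\mathcal{W}=\varprojlim_{h\to\infty}\mathcal{B}^{M_p,h}_\mathcal{W}$, $\mathcal{B}^{\{M_p\}}_\mathcal{W}=\varinjlim_{h\to0^+}\mathcal{B}^{M_p,h}_\mathcal{W}$, and $\mathcal{W}C(\mathbb{R}^d)$ is the Fréchet space of $f\in C(\mathbb{R}^d)$ with $\|f\|_{w_N}=\sup_x|f(x)|w_N(x)<\infty$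 for all $N$. Standing assumptions. $M_p$ and $A_p$ satisfy $(M.1)$ and $(M.2)$, $p!\prec M_pA_p$, and $\mathcal{S}^{(M_p)}_{(A_p)}(\mathbb{R}^d)\neq\{0\}$. The decreasing weight system $\mathcal{V}$ satisfies $\forall n\,\exists m>n:\ v_m(x)/v_n(x)=O(|x|^{-(d+1)})$, and is $(A_p)$-admissible in the Beurling case, i.e. $\forall n\,\exists\lambda>0\,\exists m\ge n\,\exists C>0\,\forall x,t\in\mathbb R^d:\ v_m(x+t)\le Cv_n(x)e^{A(\lambda t)}$, respectively $\{A_p\}$-admissible in the Roumieu case, i.e. $\forall n\,\forall\lambda>0\,\exists m\ge n\,\exists C>0\,\forall x,t:\ v_m(x+t)\le Cv_n(x)e^{A(\lambda t)}$. Duals and topologies. $\mathcal{S}^\ast_\dagger(\mathbb{R}^d)$ is densely and continuously included in $\mathcal{B}^\ast_\mathcal{V}(\mathbb{R}^d)$, so the dual $\mathcal{B}'^\ast_\mathcal{V}(\mathbb{R}^d)$ is regarded as a subspace of $\mathcal{S}'^\ast_\dagger(\mathbb{R}^d)$. For $f\in\mathcal{B}'^\ast_\mathcal{V}(\mathbb{R}^d)$, $\ast_f(\varphi)=f\ast\varphi$ with $(f\ast\varphi)(x)=\langle f,\varphi(x-\cdot)\rangle$; it is a continuous linear map from $\mathcal{S}^\ast_\dagger(\mathbb{R}^d)$ to both $\mathcal{V}^\circ C(\mathbb{R}^d)$ and $\mathcal{B}^\ast_{\mathcal{V}^\circ}(\mathbb{R}^d)$. $L_b(E,F)$ is the space of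 continuous linear maps with the topology of uniform convergence on bounded subsets of $E$. For an $(LF)$-space $E=\varinjlim E_n$ (inductive limit of a sequence of Fréchet spaces), $bs(E',E)$ is the topology on $E'$ of uniform convergence on the sets $B\subset E$ that are contained and bounded in $E_n$ for some $n$ (independent of the defining spectrum). *)

(* Defs.v *)
From HB Require Import structures.
From mathcomp Require Import all_boot all_order all_algebra.
From mathcomp Require Import all_classical all_reals all_analysis.
From mathcomp Require Import complex.

Set Implicit Arguments.
Unset Strict Implicit.
Unset Printing Implicit Defensive.

Import Order.TTheory GRing.Theory Num.Theory.
Import numFieldNormedType.Exports.

Local Open Scope classical_set_scope.
Local Open Scope complex_scope.
Local Open Scope ring_scope.

Section LocallyConvexSubspaces.
Context (R : realType) (X : lmodType R[i]).
Implicit Types (D : set X) (q : X -> R).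

Definition cmod (z : R[i]) : R := ComplexField.Normc.normc z.

Let cmod_ge0 (a : R[i]) : 0 <= cmod a.
Proof. by rewrite -ler0c; exact: (normr_ge0 a). Qed.

Definition subspace D :=
  D 0 /\ forall (a : R[i]) x y, D x -> D y -> D (a *: x + y).

(* Only the values of q on D matter. *)
Definition seminorm_on D q :=
  (forall x y, D x -> D y -> q (x + y) <= q x + q y) /\
  (forall (a : R[i]) x, D x -> q (a *: x) = cmod a * q x).

(* A locally convex space whose underlying vector space is a subspace of X,
   with its topology presented by a generating family of seminorms. *)
Record lcs := Lcs {
  lcs_dom : set X;
  lcs_seminorms : set (X -> R);
  lcs_domP : subspace lcs_dom;
  lcs_seminormsP : forall q, lcs_seminorms q -> seminorm_on lcs_dom q }.

Definition lcs_pred (E : lcs) : {pred X} := fun x => x \in lcs_dom E.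

Record lcs_type (E : lcs) := LcsElt {
  lcs_val : X;
  lcs_valP : lcs_val \in lcs_pred E }.

Arguments lcs_val : simpl never.

HB.instance Definition _ (E : lcs) := [isSub for @lcs_val E].
HB.instance Definition _ (E : lcs) := [Choice of lcs_type E by <:].

Fact lcs_pred_submod (E : lcs) : submod_closed (lcs_pred E).
Proof.
have [D0 DL] := lcs_domP E; split; first by rewrite unfold_in; apply/mem_set.
move=> a x y; rewrite !unfold_in => /set_mem Dx /set_mem Dy.
by apply/mem_set; exact: DL.
Qed.
HB.instance Definition _ (E : lcs) := GRing.isSubmodClosed.Build _ X
  (lcs_pred E) (@lcs_pred_submod E).

HB.instance Definition _ (E : lcs) :=
  [SubChoice_isSubLmodule of lcs_type E by <:].

Section LcsTopology.
Variable E : lcs.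
Local Notation T := (lcs_type E).
Implicit Types (x y z : T) (s : seq (X -> R)).

Let vdom x : lcs_dom E (lcs_val x).
Proof. by have := lcs_valP x; rewrite unfold_in => /set_mem. Qed.

Definition sball s (e : R) : set (T * T) :=
  [set xy | forall q, q \in s -> q (lcs_val (xy.1 - xy.2)) < e].

Definition lcs_ent : set_system (T * T) :=
  [set A | exists s (e : R), [/\ 0 < e,
     forall q, q \in s -> lcs_seminorms E q & sball s e `<=` A]].

Let qD q x y : lcs_seminorms E q -> q (lcs_val (x + y)) <= q (lcs_val x) + q (lcs_val y).
Proof. by move=> /lcs_seminormsP[+ _]; apply; exact: vdom. Qed.

Let qZ q a x : lcs_seminorms E q -> q (lcs_val (a *: x)) = cmod a * q (lcs_val x).
Proof. by move=> /lcs_seminormsP[_]; apply; exact: vdom. Qed.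

Let cmodE (a : R[i]) : `|a| = (cmod a)%:C.
Proof. by []. Qed.

Let cmod1 : cmod 1 = 1.
Proof. exact: ComplexField.Normc.normc1. Qed.

Let cmodN a : cmod (- a) = cmod a.
Proof. by apply: (@complexI R); rewrite -!cmodE normrN. Qed.

Let q0 q : lcs_seminorms E q -> q (lcs_val (0 : T)) = 0.
Proof.
move=> Eq; rewrite -(scale0r (0 : T)) qZ// /cmod.
by rewrite ComplexField.Normc.normc0 mul0r.
Qed.

Let qN q x : lcs_seminorms E q -> q (lcs_val (- x)) = q (lcs_val x).
Proof. by move=> Eq; rewrite -scaleN1r qZ// cmodN cmod1 mul1r. Qed.

Let q_ge0 q x : lcs_seminorms E q -> 0 <= q (lcs_val x).
Proof.
move=> Eq; have := qD x (- x) Eq; rewrite subrr q0// qN//.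
by rewrite -mulr2n pmulrn_lge0.
Qed.

Let lcs_ent_filter : Filter lcs_ent.
Proof.
split.
- by exists [::], 1; split.
- move=> A B [s [e [e0 Es sA]]] [t [f [f0 Et tB]]].
  exists (s ++ t), (Num.min e f); split.
  + by rewrite lt_min e0 f0.
  + by move=> q; rewrite mem_cat => /orP[/Es|/Et].
  + move=> xy H; split; [apply: sA|apply: tB] => q qs.
      by have := H q; rewrite mem_cat qs => /(_ isT); rewrite lt_min => /andP[].
    by have := H q; rewrite mem_cat qs orbT => /(_ isT); rewrite lt_min => /andP[].
- move=> A B AB [s [e [e0 Es sA]]]; exists s, e; split => //.
  exact: subset_trans AB.
Qed.

Let lcs_ent_refl A : lcs_ent A -> diagonal `<=` A.
Proof.
move=> [s [e [e0 Es sA]]] [x y] /diagonalP <-; apply: sA => q qs /=.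
by rewrite subrr q0//; exact: Es.
Qed.

Let lcs_ent_inv A : lcs_ent A -> lcs_ent A^-1%relation.
Proof.
move=> [s [e [e0 Es sA]]]; exists s, e; split => // -[x y] H.
apply: sA => q qs; rewrite -opprB (qN _ (Es _ qs)); exact: H.
Qed.

Let lcs_ent_split A : lcs_ent A ->
  exists2 B, lcs_ent B & (B \; B)%relation `<=` A.
Proof.
move=> [s [e [e0 Es sA]]]; exists (sball s (e / 2)).
  by exists s, (e / 2); split => //; rewrite divr_gt0.
move=> [x y] [z /= xz zy]; apply: sA => q qs /=.
rewrite (_ : x - y = (x - z) + (z - y)); last by rewrite addrA subrK.
rewrite (le_lt_trans (qD _ _ (Es _ qs)))// [ltRHS]splitr.
by rewrite ltrD//; [exact: xz|exact: zy].
Qed.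

HB.instance Definition _ := @isUniform.Build (lcs_type E) lcs_ent
  lcs_ent_filter lcs_ent_refl lcs_ent_inv lcs_ent_split.

Lemma lcs_nbhsP x (U : set T) : nbhs x U <-> exists s (e : R), [/\ 0 < e,
  forall q, q \in s -> lcs_seminorms E q &
  [set y | forall q, q \in s -> q (lcs_val (x - y)) < e] `<=` U].
Proof.
split.
- move=> [A [s [e [e0 Es sA]]] AU]; exists s, e; split => // y H.
  by apply: AU; apply/mem_set; exact: sA.
- move=> [s [e [e0 Es sA]]]; exists (sball s e); first by exists s, e; split.
  by move=> y /xsectionP H; exact: sA.
Qed.

Let lcs_add_continuous : continuous (fun xy : T * T => xy.1 + xy.2).
Proof.
move=> [x y] U /= /lcs_nbhsP[s [e [e0 Es sU]]].
have e20 : 0 < e / 2 by rewrite divr_gt0.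
exists ([set z | forall q, q \in s -> q (lcs_val (x - z)) < e / 2],
        [set z | forall q, q \in s -> q (lcs_val (y - z)) < e / 2]) => /=.
  by split; apply/lcs_nbhsP; exists s, (e / 2); split.
move=> [z t] [/= xz yt]; apply: sU => q qs /=.
rewrite opprD addrACA (le_lt_trans (qD _ _ (Es _ qs)))// [ltRHS]splitr.
by rewrite ltrD//; [exact: xz|exact: yt].
Qed.

Let seq_bound s (x : T) : exists2 M : R, 0 < M &
  forall q, q \in s -> q (lcs_val x) <= M.
Proof.
elim: s => [|p s [M M0 IH]]; first by exists 1.
exists (Num.max M (p (lcs_val x))); first by rewrite lt_max M0.
move=> q; rewrite inE => /orP[/eqP->|/IH qM]; first by rewrite le_max lexx orbT.
by rewrite le_max qM.
Qed.

Let lcs_scale_continuous : continuous (fun z : R[i]^o * T => z.1 *: z.2).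
Proof.
move=> [a x] U /= /lcs_nbhsP[s [e [e0 Es sU]]].
have [M M0 HM] := seq_bound s x.
have e20 : 0 < e / 2 by rewrite divr_gt0.
pose r := Num.min 1 (e / 2 / M).
have r0 : 0 < r by rewrite lt_min ltr01 divr_gt0.
pose K := cmod a + 1.
have ca0 : 0 <= cmod a by rewrite -ler0c -cmodE normr_ge0.
have K0 : 0 < K by rewrite ltr_wpDl.
exists ([set b | `|a - b| < r%:C],
        [set z | forall q, q \in s -> q (lcs_val (x - z)) < e / 2 / K]) => /=.
  split.
    rewrite -nbhs_ballE; exists r%:C => /=; first by rewrite ltcR.
    by move=> b; rewrite -ball_normE.
  by apply/lcs_nbhsP; exists s, (e / 2 / K); split => //; rewrite divr_gt0.
move=> [b z] [/= ab xz]; apply: sU => q qs /=.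
move: ab; rewrite cmodE ltcR => ab.
have bK : cmod b <= K.
  rewrite -lecR -cmodE (_ : b = a - (a - b)); last by rewrite opprB addrC subrK.
  rewrite (le_trans (ler_normB _ _))// !cmodE -rmorphD lecR lerD2l.
  by rewrite (le_trans (ltW ab))// ge_min lexx.
rewrite (_ : a *: x - b *: z = (a - b) *: x + b *: (x - z)); last first.
  by rewrite scalerBl scalerBr addrA subrK.
rewrite (le_lt_trans (qD _ _ (Es _ qs)))// !(qZ _ _ (Es _ qs)) [ltRHS]splitr.
rewrite ler_ltD//.
  rewrite (@le_trans _ _ (e / 2 / M * M))//; last by rewrite divfK ?gt_eqF.
  rewrite ler_pM//.
  - exact: q_ge0 (Es _ qs).
  - by rewrite (le_trans (ltW ab))// ge_min lexx orbT.
  - exact: HM.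
rewrite (@le_lt_trans _ _ (K * q (lcs_val (x - z))))//.
  by rewrite ler_wpM2r//; exact: q_ge0 (Es _ qs).
by rewrite mulrC -ltr_pdivlMr//; exact: xz.
Qed.

Let lcs_locally_convex :
  exists2 B : set_system T, (forall b, b \in B -> convex_set b) & basis B.
Proof.
exists [set B | exists s (e : R) x, [/\ 0 < e,
    forall q, q \in s -> lcs_seminorms E q &
    B = [set y | forall q, q \in s -> q (lcs_val (x - y)) < e]]].
  move=> B /set_mem[s [e [x [e0 Es ->]]]] y z l /set_mem yB /set_mem zB.
  apply/mem_set => q qs /=.
  have l0 : 0 <= l%:num :> R[i] by [].
  have l1 : l%:num <= 1 :> R[i] by [].
  set t := l%:num in l0 l1 *.
  rewrite /conv /= -/t /unstable.onem.
  have -> : x - (t *: (y : T) + (1 - t) *: (z : T)) =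
      t *: (x - y) + (1 - t) *: (x - z).
    rewrite !(scalerBr _ x) addrACA -scalerDl [t + _]addrC subrK scale1r.
    by rewrite opprD.
  have t1 : 0 <= 1 - t by rewrite subr_ge0.
  have tE : t = (cmod t)%:C by rewrite -cmodE ger0_norm.
  have t1E : 1 - t = (cmod (1 - t))%:C by rewrite -cmodE ger0_norm.
  have tt : cmod t + cmod (1 - t) = 1.
    apply: (@complexI R); rewrite rmorphD.
    transitivity (t + (1 - t)); last by rewrite addrC subrK.
    by congr (_ + _); symmetry; [exact: tE|exact: t1E].
  rewrite (le_lt_trans (qD _ _ (Es _ qs)))// !(qZ _ _ (Es _ qs)).
  have c0 : 0 <= cmod t by rewrite -ler0c -tE.
  have c10 : 0 <= cmod (1 - t) by rewrite -ler0c -t1E.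
  have h1 := yB q qs; have h2 := zB q qs; rewrite /= in h1 h2.
  rewrite -[e]mul1r -tt mulrDl.
  have [t0|t0] := eqVneq (cmod t) 0.
    by move: tt; rewrite t0 !mul0r !add0r => ->; rewrite !mul1r.
  rewrite ltr_leD//; first by rewrite ltr_pM2l// lt_neqAle eq_sym t0.
  by rewrite ler_wpM2l// ltW.
split.
- move=> B [s [e [x [e0 Es ->]]]]; rewrite openE => y /= xy.
  have [d d0 Hd] : exists2 d : R, 0 < d &
      forall q, q \in s -> q (lcs_val (x - y)) + d <= e.
    have : forall q, q \in s -> q (lcs_val (x - y)) < e by [].
    elim: (s) => [|p t IH] H; first by exists 1.
    have [|d d0 Hd] := IH; first by move=> q qt; apply: H; rewrite inE qt orbT.
    exists (Num.min d (e - p (lcs_val (x - y)))).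
      by rewrite lt_min d0 subr_gt0 H// inE eqxx.
    move=> q; rewrite inE => /orP[/eqP->|/Hd qd].
      by rewrite -lerBrDl ge_min lexx orbT.
    by rewrite (le_trans _ qd)// lerD2l ge_min lexx.
  apply/lcs_nbhsP; exists s, d; split => // z yz q qs /=.
  rewrite (_ : x - z = (x - y) + (y - z)); last by rewrite addrA subrK.
  rewrite (le_lt_trans (qD _ _ (Es _ qs)))// (lt_le_trans _ (Hd _ qs))//.
  by rewrite ltrD2l; exact: yz.
- move=> x U /lcs_nbhsP[s [e [e0 Es sU]]].
  exists [set y | forall q, q \in s -> q (lcs_val (x - y)) < e] => //=.
  split; first by exists s, e, x; split.
  by move=> q qs; rewrite subrr q0//; exact: Es.
Qed.

HB.instance Definition _ :=
  PreTopologicalNmodule_isTopologicalNmodule.Build (lcs_type E)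
    lcs_add_continuous.
HB.instance Definition _ :=
  TopologicalNmodule_isTopologicalLmodule.Build R[i] (lcs_type E)
    lcs_scale_continuous.
HB.instance Definition _ :=
  Uniform_isTvs.Build R[i] (lcs_type E) lcs_locally_convex.

End LcsTopology.

(* Coarsest locally convex topology on the intersection making every
   inclusion into E i continuous. *)
Section ProjectiveLimit.
Variables (I : Type) (E : I -> lcs).

Let D : set X := \bigcap_i lcs_dom (E i).

Fact proj_lim_domP : subspace D.
Proof.
split=> [i _|a x y Dx Dy i _]; first by case: (lcs_domP (E i)).
by have [_] := lcs_domP (E i); apply; [exact: Dx|exact: Dy].
Qed.

Let Q : set (X -> R) := \bigcup_i lcs_seminorms (E i).

Fact proj_lim_seminormsP q : Q q -> seminorm_on D q.
Proof.
move=> [i _ /lcs_seminormsP[qD qZ]]; split=> [x y Dx Dy|a x Dx].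
  by apply: qD; [exact: Dx|exact: Dy].
by apply: qZ; exact: Dx.
Qed.

Definition proj_lim : lcs := Lcs proj_lim_domP proj_lim_seminormsP.

End ProjectiveLimit.

(* Directedness is only there to make the union a subspace. *)
Definition directed_lcs (I : Type) (E : I -> lcs) :=
  [set: I] !=set0 /\ forall i j, exists k,
    lcs_dom (E i) `<=` lcs_dom (E k) /\ lcs_dom (E j) `<=` lcs_dom (E k).

(* Finest locally convex topology on the union making every inclusion of E i
   continuous: its continuous seminorms are all the seminorms with continuous
   restrictions. *)
Section InductiveLimit.
Variables (I : Type) (E : I -> lcs) (dirE : directed_lcs E).

Let D : set X := \bigcup_i lcs_dom (E i).

Fact ind_lim_domP : subspace D.
Proof.
have [[i0 _] dir] := dirE; split=> [|a x y [i _ Ex] [j _ Ey]].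
  by exists i0 => //; case: (lcs_domP (E i0)).
have [k [ik jk]] := dir i j; exists k => //.
by have [_] := lcs_domP (E k); apply; [exact: ik|exact: jk].
Qed.

Let Q : set (X -> R) := [set q | seminorm_on D q /\
  forall i, continuous (fun x : lcs_type (E i) => q (lcs_val x))].

Fact ind_lim_seminormsP q : Q q -> seminorm_on D q.
Proof. by case. Qed.

Definition ind_lim : lcs := Lcs ind_lim_domP ind_lim_seminormsP.

End InductiveLimit.

(* {x in D | sup_i c_i |l_i(x)| < oo}, normed by this supremum. *)
Section SupNorm.
Variables (D : set X) (I : Type) (c : I -> {nonneg R}) (l : I -> X -> R[i]).
Hypothesis DP : subspace D.
Hypothesis lP : forall i a x y, D x -> D y ->
  l i (a *: x + y) = a * l i x + l i y.

Definition sup_norm (x : X) : \bar R :=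
  ereal_sup [set ((c i)%:num * cmod (l i x))%:E | i in [set: I]].

Definition sup_dom : set X := [set x | D x /\ (sup_norm x < +oo)%E].

Let sup_normP x i : sup_dom x -> (c i)%:num * cmod (l i x) <= fine (sup_norm x).
Proof.
move=> [_ xoo].
have h : (((c i)%:num * cmod (l i x))%:E <= sup_norm x)%E.
  by apply: ereal_sup_ubound; exists i.
by rewrite -lee_fin fineK// fin_numE -ltNye -ltey xoo (lt_le_trans _ h)// ltNyr.
Qed.

Let sup_norm_le x (b : R) : 0 <= b ->
  (forall i, (c i)%:num * cmod (l i x) <= b) ->
  (sup_norm x < +oo)%E /\ fine (sup_norm x) <= b.
Proof.
move=> b0 xb.
have h : (sup_norm x <= b%:E)%E.
  by apply: ge_ereal_sup => _ [i _ <-]; rewrite lee_fin.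
split; first by rewrite (le_lt_trans h)// ltry.
by move: h; case: (sup_norm x) => [r| |] //=; rewrite lee_fin.
Qed.

Let fine_ge0 x : sup_dom x -> 0 <= fine (sup_norm x).
Proof.
move=> Dx; have [[i _]|/set0P/negP/negPn/eqP I0] := pselect ([set: I] !=set0).
  rewrite (le_trans _ (sup_normP i Dx))// mulr_ge0//.
by rewrite /sup_norm I0 image_set0 ereal_sup0.
Qed.

Let cmodD (a b : R[i]) : cmod (a + b) <= cmod a + cmod b.
Proof. by have := ler_normD a b; rewrite -lecR rmorphD. Qed.

Let cmodM (a b : R[i]) : cmod (a * b) = cmod a * cmod b.
Proof. exact: ComplexField.Normc.normcM. Qed.

Let l0 i : l i 0 = 0.
Proof.
by have := @lP i (-1) 0 0 DP.1 DP.1; rewrite scaler0 addr0 mulN1r addNr.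
Qed.

Let comb a x y : sup_dom x -> sup_dom y -> sup_dom (a *: x + y) /\
  fine (sup_norm (a *: x + y)) <=
  cmod a * fine (sup_norm x) + fine (sup_norm y).
Proof.
move=> Dx Dy; have [||fi le] := @sup_norm_le (a *: x + y)
    (cmod a * fine (sup_norm x) + fine (sup_norm y)).
- by rewrite addr_ge0 ?mulr_ge0 ?fine_ge0.
- move=> i; rewrite lP; [|exact: Dx.1|exact: Dy.1].
  rewrite (@le_trans _ _ ((c i)%:num * (cmod a * cmod (l i x) + cmod (l i y))))//.
    by rewrite ler_wpM2l// (le_trans (cmodD _ _))// cmodM.
  rewrite mulrDr mulrCA lerD//; last exact: sup_normP.
  by rewrite ler_wpM2l//; exact: sup_normP.
- by split=> //; split=> //; apply: DP.2; [exact: Dx.1|exact: Dy.1].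
Qed.

Let norm0 : sup_dom 0 /\ fine (sup_norm 0) = 0.
Proof.
have [//|i|foo f0] := @sup_norm_le 0 0.
  by rewrite l0 /cmod ComplexField.Normc.normc0 mulr0.
have D0 : sup_dom 0 by split=> //; exact: DP.1.
by split => //; apply/eqP; rewrite eq_le f0 fine_ge0.
Qed.

Fact sup_domP : subspace sup_dom.
Proof.
split; first by have [] := norm0.
by move=> a x y Dx Dy; have [] := comb a Dx Dy.
Qed.

Fact sup_seminormsP q : [set fine \o sup_norm] q -> seminorm_on sup_dom q.
Proof.
have [D0 n0] := norm0.
have cmod1 : cmod 1 = 1 by exact: ComplexField.Normc.normc1.
move=> ->; split=> [x y Dx Dy|a x Dx] /=.
  by have [_] := comb 1 Dx Dy; rewrite scale1r cmod1 mul1r.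
have leZ b y : sup_dom y ->
    fine (sup_norm (b *: y)) <= cmod b * fine (sup_norm y).
  by move=> Dy; have [_] := comb b Dy D0; rewrite n0 !addr0.
have [->|a0] := eqVneq a 0.
  by rewrite scale0r n0 /cmod ComplexField.Normc.normc0 mul0r.
apply/eqP; rewrite eq_le leZ//=.
have Dax : sup_dom (a *: x) by have [+ _] := comb a Dx D0; rewrite addr0.
have := leZ a^-1 _ Dax; rewrite scalerA mulVf// scale1r => h.
rewrite (le_trans (ler_wpM2l (cmod_ge0 a) h))// mulrA -cmodM mulfV//.
by rewrite cmod1 mul1r.
Qed.

Definition sup_lcs : lcs := Lcs sup_domP sup_seminormsP.

End SupNorm.

Lemma sup_dom_mono (D : set X) (I : Type) (c c' : I -> {nonneg R})
    (l : I -> X -> R[i]) :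
  (forall i, (c i)%:num <= (c' i)%:num) -> sup_dom D c' l `<=` sup_dom D c l.
Proof.
move=> cc x [Dx xoo]; split=> //; apply: le_lt_trans xoo.
apply: ge_ereal_sup => _ [i _ <-].
apply: (@le_trans _ _ ((c' i)%:num * cmod (l i x))%:E).
  by rewrite lee_fin ler_wpM2r//; exact: cmod_ge0.
by apply: ereal_sup_ubound; exists i.
Qed.

End LocallyConvexSubspaces.

Section ContinuousLinearMaps.
Context (R : realType) (E F : tvsType R[i]).

Definition clin : Type := {f : E -> F | `[< linear f /\ continuous f >]}.

Fact clin0_subproof : `[< linear (fun _ : E => 0 : F) /\
                          continuous (fun _ : E => 0 : F) >].
Proof.
by apply/asboolP; split=> [a x y|]; [rewrite scaler0 addr0|exact: cst_continuous].
Qed.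

Definition clin0 : clin := exist _ (fun=> 0) clin0_subproof.

(* The topology of uniform convergence on the sets of G. *)
Definition clin_unif (G : set (set E)) : topologicalType :=
  initial_topology (fun f : clin => val f : {family G, E -> F}).

Definition tvs_bounded (B : set E) := forall U : set E, nbhs 0 U ->
  exists2 r : R, 0 < r & B `<=` [set r%:C *: u | u in U].

Definition Lb : topologicalType := clin_unif tvs_bounded.

End ContinuousLinearMaps.

(* The sets contained and bounded in some step E i of the inductive limit;
   uniform convergence on them is the topology bs. *)
Definition step_bounded (R : realType) (X : lmodType R[i]) (I : Type)
    (E : I -> lcs X) (dirE : directed_lcs E) :
    set (set (lcs_type (ind_lim dirE))) :=
  [set B | exists i, exists2 B' : set (lcs_type (E i)),
    tvs_bounded B' & @lcs_val R X _ @` B = @lcs_val R X _ @` B'].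
Arguments step_bounded {R X I E} dirE _.

Section WeightSequences.
Context (R : realType).

Record weight_sequence := WeightSequence {
  ws_fun :> nat -> {posnum R};
  ws_cvg : (fun p => (ws_fun p.+1)%:num / (ws_fun p)%:num) @ \oo --> +oo }.

Definition cond_M1 (M : nat -> {posnum R}) :=
  forall p, (M p.+1)%:num ^+ 2 <= (M p)%:num * (M p.+2)%:num.

Definition cond_M2 (M : nat -> {posnum R}) :=
  exists C0 H : R, [/\ 1 <= C0, 1 <= H & forall p q,
    (M (p + q)%N)%:num <= C0 * H ^+ (p + q) * (M p)%:num * (M q)%:num].

Definition prec (M N : nat -> R) :=
  forall h, 0 < h -> exists2 C, 0 < C & forall p, M p <= C * h ^+ p * N p.

Definition assoc_fun (A : nat -> {posnum R}) (t : R) : R :=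
  if 0 < t then sup [set ln (t ^+ p * (A 0%N)%:num / (A p)%:num) | p in [set: nat]]
  else 0.

Lemma assoc_fun_has_sup (A : weight_sequence) t : 0 < t ->
  has_sup [set ln (t ^+ p * (A 0%N)%:num / (A p)%:num) | p in [set: nat]].
Proof.
move=> t0; split; first by eexists; exists 0%N.
set u := fun p => _.
have [N _ HN] : \forall p \near \oo, t <= (A p.+1)%:num / (A p)%:num.
  by have /cvgryPge/(_ t) := @ws_cvg A.
exists (\sum_(i < N.+1) `|u i|) => _ [p _ <-].
elim: p => [|p IH].
  by rewrite (le_trans (ler_norm _))// big_ord_recl lerDl sumr_ge0.
have [Np|pN] := leqP N p; last first.
  rewrite (le_trans (ler_norm _))//.
  have pN' : (p.+1 < N.+1)%N by [].
  by rewrite (bigD1 (Ordinal pN'))//= lerDl sumr_ge0.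
rewrite (le_trans _ IH)// /u ler_ln ?posrE ?divr_gt0 ?mulr_gt0 ?exprn_gt0//.
have := HN p Np; rewrite /= ler_pdivlMr// => h.
rewrite exprSr [_ * t * _]mulrAC; set a := t ^+ p * _.
have a0 : 0 < a by rewrite mulr_gt0 ?exprn_gt0.
rewrite ler_pdivrMr// [leRHS]mulrAC ler_pdivlMr// -mulrA ler_pM2l//.
Qed.

Lemma assoc_fun_mono (A : weight_sequence) (s t : R) : s <= t ->
  assoc_fun A s <= assoc_fun A t.
Proof.
move=> st; rewrite /assoc_fun; case: ifPn => [s0|_].
  have t0 := lt_le_trans s0 st; rewrite t0; apply: ge_sup.
    by have [] := assoc_fun_has_sup A s0.
  move=> _ [p _ <-]; apply: le_trans (ub_le_sup (assoc_fun_has_sup A t0).2 _).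
    2: by exists p.
  rewrite ler_ln ?posrE ?divr_gt0 ?mulr_gt0 ?exprn_gt0//.
  by rewrite ler_pM2r// ler_pM2r// lerXn2r// nnegrE ltW.
case: ifPn => [t0|//].
apply: le_trans (ub_le_sup (assoc_fun_has_sup A t0).2 _); last by exists 0%N.
by rewrite expr0 mul1r divff// ln1.
Qed.

End WeightSequences.

Section UltradifferentiableSpaces.
Context (R : realType) (d : nat).
Local Notation Rd := 'rV[R]_d.
Local Notation fct := ('rV[R]_d -> R[i]^o).

(* The Euclidean norm; the library norm on row vectors is the max norm. *)
Definition enorm (x : Rd) : R := Num.sqrt (\sum_i x 0 i ^+ 2).

(* Partial derivative of a complex-valued function of real variables, computed
   on the real and imaginary parts. *)
Definition pderiv (i : 'I_d) (f : fct) : fct := fun x =>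
  'D_(delta_mx 0 i) (fun y => complex.Re (f y)) x +i*
  'D_(delta_mx 0 i) (fun y => complex.Im (f y)) x.

Definition pderivs (s : seq 'I_d) (f : fct) : fct := foldr pderiv f s.

Definition smooth (f : fct) := forall s : seq 'I_d,
  continuous (pderivs s f) /\ forall i x,
    derivable (fun y => complex.Re (pderivs s f y)) x (delta_mx 0 i) /\
    derivable (fun y => complex.Im (pderivs s f y)) x (delta_mx 0 i).

Definition multi_index := {ffun 'I_d -> nat}.
Definition morder (alpha : multi_index) : nat := (\sum_i alpha i)%N.
Definition mderiv (alpha : multi_index) : fct -> fct :=
  pderivs (flatten [seq nseq (alpha i) i | i <- enum 'I_d]).

Let derive_comb (p q : R) (h1 h2 h3 : Rd -> R) (x v : Rd) :
  derivable h1 x v -> derivable h2 x v -> derivable h3 x v ->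
  derivable (p *: h1 + q *: h2 + h3) x v /\
  'D_v (p *: h1 + q *: h2 + h3) x = p * 'D_v h1 x + q * 'D_v h2 x + 'D_v h3 x.
Proof.
move=> d1 d2 d3.
have dp : derivable (p *: h1) x v by exact: derivableZ.
have dq : derivable (q *: h2) x v by exact: derivableZ.
have dpq : derivable (p *: h1 + q *: h2) x v by exact: derivableD.
split; first exact: derivableD.
rewrite (deriveD dpq d3) (deriveD dp dq); congr (_ + _ + _); exact: deriveZ.
Qed.

Let Re_comb a (f g : fct) : (fun y => complex.Re ((a *: f + g) y)) =
  complex.Re a *: (fun y => complex.Re (f y)) +
  (- complex.Im a) *: (fun y => complex.Im (f y)) +
  (fun y => complex.Re (g y)).
Proof.
apply/funext => y; rewrite !fctE scaleNr.
by case: a (f y) (g y) => [? ?] [? ?] [? ?].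
Qed.

Let Im_comb a (f g : fct) : (fun y => complex.Im ((a *: f + g) y)) =
  complex.Re a *: (fun y => complex.Im (f y)) +
  complex.Im a *: (fun y => complex.Re (f y)) +
  (fun y => complex.Im (g y)).
Proof.
apply/funext => y; rewrite !fctE.
by case: a (f y) (g y) => [? ?] [? ?] [? ?].
Qed.

Fact pderivs_comb s a (f g : fct) : smooth f -> smooth g ->
  pderivs s (a *: f + g) = a *: pderivs s f + pderivs s g.
Proof.
move=> sf sg; elim: s => [//|i s /= ->].
have [_ /(_ i) df] := sf s; have [_ /(_ i) dg] := sg s.
apply/funext => x; rewrite /pderiv Re_comb Im_comb.
have [dRf dIf] := df x; have [dRg dIg] := dg x.
have [_ ->] := derive_comb (complex.Re a) (- complex.Im a) dRf dIf dRg.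
have [_ ->] := derive_comb (complex.Re a) (complex.Im a) dIf dRf dIg.
by rewrite !fctE mulNr; case: (a) => [? ?].
Qed.

Let continuous_comb a (f g : fct) : continuous f -> continuous g ->
  continuous (a *: f + g).
Proof.
move=> cf cg x.
have h := @cvgZl_tmp _ R[i]^o _ _ _ a f (f x) (cf x).
exact: (@cvgD _ R[i]^o _ _ _ _ _ _ _ (h _) (cg x)).
Qed.

Fact smooth_subspace : subspace smooth.
Proof.
have c0 s : pderivs s 0 = 0.
  elim: s => [//|i s /= ->]; apply/funext => x; rewrite /pderiv.
  have -> : (fun y : Rd => complex.Re ((0 : fct) y)) = cst 0 by [].
  by rewrite !derive_cst.
split.
  move=> s; rewrite c0; split; first exact: cst_continuous.
  by move=> i x; split; exact: derivable_cst.
move=> a f g sf sg s; rewrite pderivs_comb//.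
have [cf df] := sf s; have [cg dg] := sg s.
split.
  exact: continuous_comb.
move=> i x.
have [dRf dIf] := df i x; have [dRg dIg] := dg i x; rewrite Re_comb Im_comb.
have [? _] := derive_comb (complex.Re a) (- complex.Im a) dRf dIf dRg.
by have [? _] := derive_comb (complex.Re a) (complex.Im a) dIf dRf dIg.
Qed.

Fact continuous_subspace : subspace (fun f : fct => continuous f).
Proof. by split; [exact: cst_continuous|move=> a f g; exact: continuous_comb]. Qed.

Fact mderiv_linear (ax : multi_index * Rd) (a : R[i]) (f g : fct) :
  smooth f -> smooth g ->
  mderiv ax.1 (a *: f + g) ax.2 = a * mderiv ax.1 f ax.2 + mderiv ax.1 g ax.2.
Proof. by move=> sf sg; rewrite /mderiv pderivs_comb. Qed.

Fact eval_linear (x : Rd) (a : R[i]) (f g : fct) :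
  continuous f -> continuous g -> (a *: f + g) x = a * f x + g x.
Proof. by []. Qed.

Definition weight := Rd -> {posnum R}.

(* B^{M_p,h}_w *)
Definition Bh (M : nat -> {posnum R}) (h : {posnum R}) (w : weight) : lcs fct :=
  @sup_lcs R fct smooth (multi_index * Rd)
    (fun ax => (h%:num ^+ morder ax.1 * (w ax.2)%:num /
                (M (morder ax.1))%:num)%:nng)
    (fun ax f => mderiv ax.1 f ax.2) smooth_subspace mderiv_linear.

(* The continuous functions f with sup_x |f(x)| w(x) < oo. *)
Definition Cw (w : weight) : lcs fct :=
  @sup_lcs R fct (fun f => continuous f) Rd (fun x => (w x)%:num%:nng)
    (fun x f => f x) continuous_subspace eval_linear.

Inductive ultra_class := Beurling | Roumieu.

Lemma Bh_mono M (h h' : {posnum R}) (w w' : weight) :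
  h%:num <= h'%:num -> (forall x, (w x)%:num <= (w' x)%:num) ->
  lcs_dom (Bh M h' w') `<=` lcs_dom (Bh M h w).
Proof.
move=> hh ww; apply: sup_dom_mono => -[alpha x] /=.
rewrite ler_pM2r// ler_pM ?exprn_ge0//.
by rewrite lerXn2r// nnegrE.
Qed.

Let directed_pos (E : {posnum R} -> lcs fct) :
  (forall h h' : {posnum R}, h%:num <= h'%:num ->
    lcs_dom (E h') `<=` lcs_dom (E h)) -> directed_lcs E.
Proof.
move=> mono; split; first by exists 1%:pos.
move=> h h'; exists (Num.min h%:num h'%:num)%:pos.
by split; apply: mono; rewrite /= ge_min lexx ?orbT.
Qed.

Fact directed_Bh M w : directed_lcs (fun h => Bh M h w).
Proof. by apply: directed_pos => h h' hh; exact: Bh_mono. Qed.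

(* B^*_w *)
Definition Bw (c : ultra_class) (M : nat -> {posnum R}) (w : weight) : lcs fct :=
  match c with
  | Beurling => proj_lim (fun h => Bh M h w)
  | Roumieu => ind_lim (directed_Bh M w)
  end.

Record decreasing_weight_system := DecreasingWeightSystem {
  dws_fun :> nat -> weight;
  dws_cont : forall n, continuous (fun x => (dws_fun n x)%:num);
  dws_decr : forall n x, (dws_fun n.+1 x)%:num <= (dws_fun n x)%:num }.

Record increasing_weight_system := IncreasingWeightSystem {
  iws_fun :> nat -> weight;
  iws_cont : forall n, continuous (fun x => (iws_fun n x)%:num);
  iws_incr : forall n x, (iws_fun n x)%:num <= (iws_fun n.+1 x)%:num }.

Section DualSystem.
Variable V : decreasing_weight_system.

Definition dual_fun n : weight := fun x => ((V n x)%:num^-1)%:pos.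

Fact dual_cont n : continuous (fun x => (dual_fun n x)%:num).
Proof.
move=> x; apply: (@cvgV _ _ (nbhs x) _ (fun y => (V n y)%:num) (V n x)%:num).
  by apply: lt0r_neq0.
exact: dws_cont.
Qed.

Fact dual_incr n x : (dual_fun n x)%:num <= (dual_fun n.+1 x)%:num.
Proof. by rewrite /= lef_pV2 ?posrE//; exact: dws_decr. Qed.

Definition dual_system := IncreasingWeightSystem dual_cont dual_incr.
End DualSystem.

Lemma dws_mono (V : decreasing_weight_system) m n x : (m <= n)%N ->
  (V n x)%:num <= (V m x)%:num.
Proof.
by move=> /subnK <-; elim: (n - m)%N => [|k IH]//; exact: le_trans (dws_decr _ _ _) IH.
Qed.

Fact directed_Bw c M (V : decreasing_weight_system) :
  directed_lcs (fun n => Bw c M (V n)).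
Proof.
split; first by exists 0%N.
move=> m n; exists (maxn m n).
by split; case: c => f /=;
  [move=> Bf h _; apply: Bh_mono (Bf h I) => // x|
   move=> [h _ Bf]; exists h => //; apply: Bh_mono Bf => // x|
   move=> Bf h _; apply: Bh_mono (Bf h I) => // x|
   move=> [h _ Bf]; exists h => //; apply: Bh_mono Bf => // x];
  apply: dws_mono; rewrite ?leq_maxl ?leq_maxr.
Qed.

(* B^*_V *)
Definition BV c (M : nat -> {posnum R}) (V : decreasing_weight_system) : lcs fct :=
  ind_lim (directed_Bw c M V).

(* B^{M_p,h}_W *)
Definition BhW (M : nat -> {posnum R}) h (W : increasing_weight_system) : lcs fct :=
  proj_lim (fun N => Bh M h (W N)).

Fact directed_BhW M W : directed_lcs (fun h => BhW M h W).
Proof.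
apply: directed_pos => h h' hh f /= Bf N _.
exact: (Bh_mono hh (fun=> lexx _) (Bf N I)).
Qed.

(* B^*_W *)
Definition BW c (M : nat -> {posnum R}) (W : increasing_weight_system) : lcs fct :=
  match c with
  | Beurling => proj_lim (fun h => BhW M h W)
  | Roumieu => ind_lim (directed_BhW M W)
  end.

Definition WC (W : increasing_weight_system) : lcs fct := proj_lim (fun N => Cw (W N)).

Definition gs_weight (A : nat -> {posnum R}) (lambda : {posnum R}) : weight :=
  fun x => PosNum (expR_gt0 (assoc_fun A (enorm (lambda%:num *: x)))).

Fact gs_weight_mono (A : weight_sequence R) (h h' : {posnum R}) (x : Rd) :
  h%:num <= h'%:num -> (gs_weight A h x)%:num <= (gs_weight A h' x)%:num.
Proof.
move=> hh; rewrite /gs_weight /=.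
have le_en : enorm (h%:num *: x) <= enorm (h'%:num *: x).
  apply: ler_wsqrtr; apply: ler_sum => i _; rewrite !mxE !exprMn.
  by apply: ler_wpM2r; [exact: sqr_ge0|rewrite lerXn2r// nnegrE].
by have := assoc_fun_mono A le_en; rewrite -ler_expR.
Qed.

Fact directed_GS M (A : weight_sequence R) :
  directed_lcs (fun h => Bh M h (gs_weight A h)).
Proof.
apply: (@directed_pos (fun h => Bh M h (gs_weight A h))) => h h' hh.
exact (@Bh_mono M h h' _ _ hh (fun x => gs_weight_mono A x hh)).
Qed.

(* S^{(M_p)}_{(A_p)} and S^{{M_p}}_{{A_p}} *)
Definition GS c (M A : weight_sequence R) : lcs fct :=
  match c with
  | Beurling => proj_lim (fun h => Bh M h (gs_weight A h))
  | Roumieu => ind_lim (directed_GS M A)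
  end.

Definition dual (E : lcs fct) : Type := clin (lcs_type E) R[i]^o.

(* <f, phi>, with the junk value 0 for phi outside E. *)
Definition pairing (E : lcs fct) (f : dual E) (phi : fct) : R[i] :=
  if insub phi is Some u then val f u else 0.

Definition conv (E : lcs fct) (f : dual E) (phi : fct) : fct :=
  fun x => pairing f (fun t => phi (x - t)).

(* phi |-> f * phi as an element of L(S, F). The defaults of insubd would only
   be used if some f * phi were not in F, or if this map were not linear and
   continuous, which does not happen for the spaces considered below. *)
Definition conv_map (E S F : lcs fct) (f : dual E) :
    clin (lcs_type S) (lcs_type F) :=
  insubd (clin0 _ _)
    (fun phi => insubd (0 : lcs_type F) (conv f (lcs_val phi))).

Definition conv_topology (E S F : lcs fct) : topologicalType :=
  initial_topology
    (@conv_map E S F : dual E -> Lb (lcs_type S) (lcs_type F)).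

Definition dual_topology (E : lcs fct) (G : set (set (lcs_type E))) :
    topologicalType :=
  clin_unif R[i]^o G.

(* The sets of uniform convergence on the dual of B^*_V: bs in the Beurling case,
   the strong topology in the Roumieu case. *)
Definition BV_sets c M V : set (set (lcs_type (BV c M V))) :=
  match c with
  | Beurling => step_bounded (directed_Bw c M V)
  | Roumieu => @tvs_bounded R (lcs_type (BV c M V))
  end.

(* v_m(x) / v_n(x) = O(|x|^-(d+1)) as |x| -> oo *)
Definition weight_decay (V : decreasing_weight_system) :=
  forall n, exists2 m, (n < m)%N & exists C r : R, [/\ 0 < C, 0 < r &
    forall x, r <= enorm x ->
      (V m x)%:num / (V n x)%:num <= C * (enorm x) ^- d.+1].

Definition admissible c (A : nat -> {posnum R}) (V : decreasing_weight_system) :=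
  let bound n lambda m := exists2 C : R, 0 < C & forall x t : Rd,
    (V m (x + t))%:num <=
    C * (V n x)%:num * expR (assoc_fun A (enorm (lambda *: t))) in
  match c with
  | Beurling => forall n, exists lambda : R, 0 < lambda /\
      exists2 m, (n <= m)%N & bound n lambda m
  | Roumieu => forall n (lambda : R), 0 < lambda ->
      exists2 m, (n <= m)%N & bound n lambda m
  end.

End UltradifferentiableSpaces.

(* Main.v *)
Require Import Defs.
From HB Require Import structures.
From mathcomp Require Import all_boot all_order all_algebra.
From mathcomp Require Import all_classical all_reals all_analysis.
From mathcomp Require Import complex ring lra.

Set Implicit Arguments.
Unset Strict Implicit.
Unset Printing Implicit Defensive.

Import Order.TTheory GRing.Theory Num.Theory.
Import numFieldNormedType.Exports.

Local Open Scope classical_set_scope.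
Local Open Scope complex_scope.
Local Open Scope ring_scope.

(** Write f * psi for the convolution of a functional f on B_V with psi in S.
    The topologies are compared in a cycle: (i) is coarser than (iii), (ii) is
    coarser than (i), and (iii) is coarser than (ii).

    (i) from (iii). Derivatives pass to the test function,
    (f * psi)^(a)(x) = <f, psi^(a)(x - .)>, so the size of f * psi in
    B^{M,h}_{1/v_N} is the size of f on the functions
    h^|a| psi^(a)(x - .) / (M_a v_N(x)). By (M.2) for M and admissibility of V
    these functions form a bounded set of one step of B_V when psi ranges over
    a bounded set of S ([bnd_refl_deriv], [translate_sets], [conv_close]). The
    same estimate, applied to difference quotients through Taylor's formula
    ([bnd_remainder]), shows that f * psi is smooth and that psi |-> f * psi is
    continuous, so that the operators in (i) and (ii) are really the
    convolutions ([conv_smooth], [conv_map_BW], [conv_map_WC]).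

    (ii) from (i). The space B_{V°} is continuously included in V°C.

    (iii) from (ii). A bounded set of B_V is recovered from convolutions by
    means of a partition of unity 1 = sum_k ch(k - .), k in Z^d, with ch in S.
    For phi in B_V put psi_y(t) = phi(y - t) ch(t); then
    <f, phi ch(y - .)> = (f * psi_y)(y), hence <f, phi> is the sum over the
    lattice of the numbers (f * psi_k)(k). By Leibniz' rule with (M.1), by (M.2)
    for A and by admissibility, the functions v_m(y) psi_y are bounded in S,
    uniformly in y and in phi from a bounded set ([bnd_localise],
    [localised_sets]). Therefore the sum is at most
    sum_k v_l(k) / v_m(k) times the norm of the f * (v_m(k) psi_k) in C_{1/v_l},
    and the decay of V makes sum_k v_l(k) / v_m(k) finite ([decay_quad],
    [lattice_sum], [pairing_close]).

    The partition of unity is obtained from one nonzero phi in S^{(M)}_{(A)}: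
    the restriction g of |phi|^2 to a line parallel to a coordinate axis is
    nonnegative, and if G is its antiderivative, normalised to increase from 0
    to 1, the translates of theta = G(. + 1) - G by integers telescope to 1; ch
    is the product of such functions theta, one for each coordinate ([bump],
    [window_sum]). The finite partial sums P_N satisfy phi P_N -> phi in a later
    step of B_V because 1 - P_N is O(1/N) in a norm with polynomial weight
    ([window_cvg], [pairing_remainder]).

    In the Roumieu case bounded sets of S and of B_V have to lie in one step of
    the inductive limit. This regularity holds because the norms are weighted
    suprema: if a set is unbounded in every step, points where it is large can
    be collected diagonally into a single continuous seminorm which is unbounded
    on the set ([diagonal_seminorm]). *)

(** * Topologies of uniform convergence *)

Section UniformConvergenceTopologies.
Context (R : realType) (E F : tvsType R[i]).

Lemma clin_unif_nbhs (G : set (set E)) (f : clin_unif F G) A U :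
  entourage U -> G A ->
  nbhs f [set g : clin_unif F G | forall y, A y -> U (val f y, val g y)].
Proof.
move=> entU GA.
exact: (@initial_continuous (clin E F) {family G, E -> F} _ f _
  (fam_nbhs _ entU GA)).
Qed.

(** Continuity of T at a point only has to be tested on one set A and one
    entourage at a time: the topology is the supremum of those of uniform
    convergence on the single sets A. *)
Lemma clin_unif_nbhs_sub (D : Type) (G : set (set E)) (f : clin_unif F G)
    (Fl : set_system D) (T : D -> clin_unif F G) :
  Filter Fl ->
  (forall A U, G A -> entourage U ->
     Fl [set x | forall y, A y -> U (val f y, val (T x) y)]) ->
  forall O, nbhs f O -> Fl (T @^-1` O).
Proof.
move=> FFl H O [_ [[B oB <-] /= Bf BO]].
have cv : {family G, (fun x => val (T x)) @ Fl --> val f}.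
  apply/fam_cvgP => A GA W /uniform_nbhs[U [entU UW]] /=.
  by apply: filterS (H A U GA entU) => x Hx; apply: UW.
have : nbhs (val f : {family G, E -> F}) B by rewrite nbhsE; exists B => //; split.
by move=> /cv; apply: (@filterS D Fl FFl) => x Bx; exact: BO.
Qed.

End UniformConvergenceTopologies.

(** The form in which a topology induced by a map into a space of operators is
    shown to be coarser than a topology given by its neighbourhood filters. *)
Lemma initial_open_sub (R : realType) (E F : tvsType R[i]) (G : set (set E))
    (D : choiceType) (T : D -> clin_unif F G)
    (op : set_system D) (nb : D -> set_system D) :
  (forall x, Filter (nb x)) -> (forall O, (forall x, O x -> nb x O) -> op O) ->
  (forall x A U, G A -> entourage U ->
     nb x [set z | forall y, A y -> U (val (T x) y, val (T z) y)]) ->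
  @open (initial_topology T) `<=` op.
Proof.
move=> Fnb opE H _ [B oB <-]; apply: opE => x Bx.
apply: (@clin_unif_nbhs_sub _ _ _ _ _ (T x)) => //.
- by move=> A U GA entU; exact: H.
- by apply: open_nbhs_nbhs.
Qed.

(** * Seminorms and bounded sets of locally convex spaces *)

Section LcsFacts.
Context (R : realType) (X : lmodType R[i]).
Implicit Types (E F : lcs X) (q : X -> R) (s : seq (X -> R)).

Lemma cmod_ge0 (a : R[i]) : 0 <= cmod a.
Proof. by rewrite -ler0c; exact: (normr_ge0 a). Qed.

Lemma cmodE (a : R[i]) : `|a| = (cmod a)%:C.
Proof. by []. Qed.

Lemma cmod0 : cmod (0 : R[i]) = 0.
Proof. exact: ComplexField.Normc.normc0. Qed.

Lemma cmod1 : cmod (1 : R[i]) = 1.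
Proof. exact: ComplexField.Normc.normc1. Qed.

Lemma cmodN (a : R[i]) : cmod (- a) = cmod a.
Proof. by apply: (@complexI R); rewrite -!cmodE normrN. Qed.

Lemma cmodM (a b : R[i]) : cmod (a * b) = cmod a * cmod b.
Proof. exact: ComplexField.Normc.normcM. Qed.

Lemma cmodD (a b : R[i]) : cmod (a + b) <= cmod a + cmod b.
Proof. by have := ler_normD a b; rewrite -lecR rmorphD. Qed.

Lemma cmodB (a b : R[i]) : cmod (a - b) <= cmod a + cmod b.
Proof. by rewrite -(cmodN b) cmodD. Qed.

Lemma cmod_real (r : R) : cmod r%:C = `|r|.
Proof. by apply: (@complexI R); rewrite -cmodE normc_def /= expr0n /= addr0 sqrtr_sqr. Qed.

Lemma cmod_sum (I : Type) (r : seq I) (P : pred I) (a : I -> R[i]) :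
  cmod (\sum_(i <- r | P i) a i) <= \sum_(i <- r | P i) cmod (a i).
Proof.
elim/big_rec2: _ => [|i x y _ h]; first by rewrite cmod0.
by rewrite (le_trans (cmodD _ _))// lerD2l.
Qed.

Lemma lcs_dom_val E (x : lcs_type E) : lcs_dom E (lcs_val x).
Proof. by have := lcs_valP x; rewrite unfold_in => /set_mem. Qed.

Lemma lcs_dom_in E x : lcs_dom E x -> x \in lcs_pred E.
Proof. by move=> Ex; rewrite unfold_in; exact/mem_set. Qed.

Definition lcs_elt E x (Ex : lcs_dom E x) : lcs_type E := LcsElt (lcs_dom_in Ex).

Section SeminormOn.
Variables (D : set X) (q : X -> R).
Hypotheses (DP : Defs.subspace D) (qP : seminorm_on D q).

Lemma subspaceZ a x : D x -> D (a *: x).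
Proof. by move=> Dx; have := DP.2 a x 0 Dx DP.1; rewrite addr0. Qed.

Lemma subspaceB x y : D x -> D y -> D (x - y).
Proof. by move=> Dx Dy; have := DP.2 (-1) y x Dy Dx; rewrite scaleN1r addrC. Qed.

Lemma seminorm0 : q 0 = 0.
Proof. by rewrite -(scale0r 0) qP.2 ?cmod0 ?mul0r//; exact: DP.1. Qed.

Lemma seminormN x : D x -> q (- x) = q x.
Proof. by move=> Dx; rewrite -scaleN1r qP.2// cmodN cmod1 mul1r. Qed.

Lemma seminorm_ge0 x : D x -> 0 <= q x.
Proof.
move=> Dx; have DNx : D (- x) by rewrite -scaleN1r; exact: subspaceZ.
have := qP.1 _ _ Dx DNx; rewrite subrr seminorm0 seminormN//.
by rewrite -mulr2n pmulrn_lge0.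
Qed.

Lemma seminormB x y : D x -> D y -> q (x - y) = q (y - x).
Proof. by move=> Dx Dy; rewrite -opprB seminormN//; exact: subspaceB. Qed.

Lemma seminorm_dist x y : D x -> D y -> `|q x - q y| <= q (x - y).
Proof.
move=> Dx Dy.
have h u v : D u -> D v -> q u - q v <= q (u - v).
  move=> Du Dv; rewrite lerBlDr -{1}(subrK v u).
  by apply: qP.1 => //; exact: subspaceB.
by rewrite ler_norml lerNl opprB h// seminormB// h.
Qed.

End SeminormOn.

Lemma lcs_seminorm_ge0 E q x : lcs_seminorms E q -> lcs_dom E x -> 0 <= q x.
Proof. by move=> Eq; exact: seminorm_ge0 (lcs_domP E) (lcs_seminormsP Eq) _. Qed.

Lemma lcs_sum_ge0 E s x : (forall q, q \in s -> lcs_seminorms E q) ->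
  lcs_dom E x -> 0 <= \sum_(p <- s) p x.
Proof.
by move=> Es Ex; rewrite big_seq sumr_ge0// => p /Es /lcs_seminorm_ge0; apply.
Qed.

Lemma lcs_nbhs_seminorm E q (x : lcs_type E) (e : R) : 0 < e ->
  lcs_seminorms E q -> nbhs x [set y | q (lcs_val (x - y)) < e].
Proof.
move=> e0 Eq; apply/lcs_nbhsP; exists [:: q], e; split=> // [p|y H].
  by rewrite inE => /eqP ->.
by apply: H; rewrite inE.
Qed.

Lemma lcs_nbhs_sum E s (x : lcs_type E) (e : R) : 0 < e ->
  (forall q, q \in s -> lcs_seminorms E q) ->
  nbhs x [set y | \sum_(p <- s) p (lcs_val (x - y)) < e].
Proof.
move=> e0; elim: s e e0 => [|p s IH] e e0 Es.
  by apply: filterE => y /=; rewrite big_nil.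
have e20 : 0 < e / 2 by rewrite divr_gt0.
have h1 := lcs_nbhs_seminorm x e20 (Es p (mem_head _ _)).
have h2 : nbhs x [set y | \sum_(p <- s) p (lcs_val (x - y)) < e / 2].
  by apply: IH => // q qs; apply: Es; rewrite inE qs orbT.
apply: filterS (filterI h1 h2) => y [/= y1 y2].
by rewrite big_cons [ltRHS]splitr ltrD.
Qed.

(** A seminorm that is below 1 near 0 is dominated by finitely many of the
    seminorms presenting the topology. *)
Lemma lcs_bound E (g : lcs_type E -> R) :
  (forall (a : R[i]) x, g (a *: x) = cmod a * g x) ->
  nbhs (0 : lcs_type E) [set x | g x < 1] ->
  exists s (C : R), [/\ 0 <= C, forall q, q \in s -> lcs_seminorms E q &
    forall x, g x <= C * \sum_(p <- s) p (lcs_val x)].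
Proof.
move=> gZ /lcs_nbhsP[s [e [e0 Es sg]]]; exists s, e^-1; split=> //.
  by rewrite invr_ge0 ltW.
move=> x; set S := \sum_(p <- s) _.
have S0 : 0 <= S by exact: (lcs_sum_ge0 Es (lcs_dom_val x)).
apply/ler_addgt0Pr => r r0.
have re0 : 0 < S + r * e by rewrite ltr_wpDl// mulr_gt0.
have c0 : 0 < e / (S + r * e) by rewrite divr_gt0.
have : g ((- (e / (S + r * e)))%:C *: x) < 1.
  apply: sg => q qs; rewrite sub0r rmorphN scaleNr opprK.
  have [_ ->] := lcs_seminormsP (Es _ qs); last exact: lcs_dom_val.
  rewrite cmod_real gtr0_norm// mulrAC ltr_pdivrMr// ltr_pM2l//.
  rewrite (@le_lt_trans _ _ S) ?ltrDl ?mulr_gt0//.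
  rewrite /S (big_rem q)//= lerDl; apply: (@lcs_sum_ge0 E); last exact: lcs_dom_val.
  by move=> p /mem_rem /Es.
rewrite gZ cmod_real normrN gtr0_norm// -ltr_pdivlMl// mulr1 invf_div => /ltW.
by move=> /le_trans; apply; rewrite mulrDl mulfK ?gt_eqF// mulrC.
Qed.

Lemma lcs_seminorm_bound E q : seminorm_on (lcs_dom E) q ->
  continuous (fun x : lcs_type E => q (lcs_val x)) ->
  exists s (C : R), [/\ 0 <= C, forall q, q \in s -> lcs_seminorms E q &
    forall x, lcs_dom E x -> q x <= C * \sum_(p <- s) p x].
Proof.
move=> qP qc; have [||s [C [C0 Es sC]]] := @lcs_bound E (q \o @lcs_val _ _ E).
- by move=> a x /=; rewrite qP.2//; exact: lcs_dom_val.
- have q0 : q (lcs_val (0 : lcs_type E)) = 0 by exact: seminorm0 (lcs_domP E) qP.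
  have := qc (0 : lcs_type E) [set t | t < 1]; apply; rewrite /= q0.
  by apply: lt_nbhsl; rewrite ltr01.
- by exists s, C; split=> // x Ex; have := sC (lcs_elt Ex).
Qed.

Lemma lcs_seminorm_continuous E q s (C : R) : seminorm_on (lcs_dom E) q ->
  (forall q, q \in s -> lcs_seminorms E q) -> 0 <= C ->
  (forall x, lcs_dom E x -> q x <= C * \sum_(p <- s) p x) ->
  continuous (fun x : lcs_type E => q (lcs_val x)).
Proof.
move=> qP Es C0 qC x; apply/(@cvgrPdist_lt R R^o _ (nbhs (x : lcs_type E)) (nbhs_filter (x : lcs_type E))) => e e0.
have eC : 0 < e / (C + 1) by rewrite divr_gt0// ltr_wpDl.
have := lcs_nbhs_sum x eC Es; apply: filterS => y /= xy.
have Dx := lcs_dom_val x; have Dy := lcs_dom_val y.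
rewrite (le_lt_trans (seminorm_dist (lcs_domP E) qP Dx Dy))//.
rewrite (le_lt_trans (qC _ (lcs_dom_val (x - y))))//.
rewrite ltr_pdivlMr ?ltr_wpDl// in xy; apply: le_lt_trans xy.
rewrite mulrC ler_wpM2l ?lerDl//.
by apply: (@lcs_sum_ge0 E) => //; exact: lcs_dom_val (x - y).
Qed.

Lemma lcs_linear_continuous E F
    (T : lcs_type E -> lcs_type F) : linear T ->
  (forall q, lcs_seminorms F q -> exists s (C : R), [/\ 0 <= C,
    forall p, p \in s -> lcs_seminorms E p &
    forall x, q (lcs_val (T x)) <= C * \sum_(p <- s) p (lcs_val x)]) ->
  continuous T.
Proof.
move=> Tl H x U /lcs_nbhsP[s [e [e0 Fs sU]]].
suff : nbhs x [set y | forall q, q \in s -> q (lcs_val (T x - T y)) < e].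
  by apply: filterS => y; exact: sU.
elim: s Fs {sU} => [|p s IH] Fs; first exact: filterE.
have h2 := IH (fun q qs => Fs q (@mem_behead _ (p :: s) q qs)).
have [t [C [C0 Et tC]]] := H p (Fs p (mem_head _ _)).
have eC : 0 < e / (C + 1) by rewrite divr_gt0// ltr_wpDl.
apply: filterS (filterI (lcs_nbhs_sum x eC Et) h2) => y [/= y1 y2] q.
rewrite inE => /orP[/eqP ->|]; last exact: y2.
have TB : T x - T y = T (x - y) by rewrite addrC -scaleN1r -Tl scaleN1r addrC.
suff : p (lcs_val (T (x - y))) < e by rewrite -TB.
rewrite (le_lt_trans (tC _))//.
rewrite ltr_pdivlMr ?ltr_wpDl// in y1; apply: le_lt_trans y1.
rewrite mulrC ler_wpM2l ?lerDl//.
by apply: (@lcs_sum_ge0 E) => //; exact: lcs_dom_val (x - y).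
Qed.

Lemma lcs_boundedP E (B : set (lcs_type E)) : tvs_bounded B <->
  forall q, lcs_seminorms E q ->
    exists K : R, forall x, B x -> q (lcs_val x) <= K.
Proof.
split=> [bB q Eq|H U /lcs_nbhsP[s [e [e0 Es sU]]]].
  have [r r0 Br] := bB _ (lcs_nbhs_seminorm 0 ltr01 Eq).
  exists r => _ /Br[u /= qu <-].
  have [_ qZ] := lcs_seminormsP Eq; rewrite qZ; last exact: lcs_dom_val.
  rewrite cmod_real gtr0_norm// ger_pMr// ltW//; move: qu; rewrite sub0r.
  by rewrite (seminormN (lcs_seminormsP Eq))//; exact: lcs_dom_val.
have [K K0 HK] : exists2 K : R, 0 < K &
    forall q x, q \in s -> B x -> q (lcs_val x) <= K.
  elim: s Es {sU} => [|p s IH] Es; first by exists 1.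
  have [K K0 HK] := IH (fun q qs => Es q (@mem_behead _ (p :: s) q qs)).
  have [L HL] := H p (Es p (mem_head _ _)).
  exists (Num.max K L) => [|q x]; first by rewrite lt_max K0.
  rewrite inE => /orP[/eqP -> /HL|qs /(HK q x qs)] h.
    by rewrite le_max h orbT.
  by rewrite le_max h.
have r0 : 0 < (K + 1) / e by rewrite divr_gt0// addr_gt0.
exists ((K + 1) / e) => // x Bx; exists (((K + 1) / e)^-1%:C *: x); last first.
  by rewrite scalerA -rmorphM mulfV ?gt_eqF// scale1r.
apply: sU => q qs; rewrite sub0r (seminormN (lcs_seminormsP (Es _ qs))); last first.
  exact: lcs_dom_val (_ *: x).
have [_ qZ] := lcs_seminormsP (Es _ qs); rewrite qZ; last exact: lcs_dom_val.
rewrite cmod_real gtr0_norm ?invr_gt0// invf_div mulrAC ltr_pdivrMr ?addr_gt0//.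
by rewrite ltr_pM2l// (le_lt_trans (HK _ _ qs Bx))// ltrDl.
Qed.

End LcsFacts.

(** * Derivatives along lines *)

Section Lines.
Context (R : realType) (d : nat).
Local Notation Rd := 'rV[R]_d.
Implicit Types (u : Rd -> R) (x y v : Rd).

Lemma is_derive_line u x v (t l : R) : is_derive (x + t *: v) v u l ->
  is_derive t 1 (fun r : R => u (x + r *: v)) l.
Proof.
move=> [du ul].
have E : (fun h : R => h^-1 *: (((fun r : R => u (x + r *: v)) \o shift t) (h *: (1 : R)) -
    u (x + t *: v))) =
  (fun h : R => h^-1 *: ((u \o shift (x + t *: v)) (h *: v) - u (x + t *: v))).
  apply/funext => h /=; congr (_ *: (u _ - _)).
  by rewrite /= [h *: 1]mulr1 scalerDl addrCA.
by split; [rewrite /derivable E|rewrite /derive E].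
Qed.

Lemma MVT_line u (du : Rd -> R) x v : (forall y, is_derive y v u (du y)) ->
  exists2 t : R, 0 <= t <= 1 & u (x + v) - u x = du (x + t *: v).
Proof.
move=> ud.
have g t := is_derive_line (ud (x + t *: v)).
have [t t01 H] : exists2 t : R, t \in `[0, 1] &
    u (x + (1 : R) *: v) - u (x + (0 : R) *: v) = du (x + t *: v) * (1 - 0).
  apply: (@MVT_segment R (fun r => u (x + r *: v)) (fun r => du (x + r *: v))) => //.
  apply: derivable_within_continuous => r _.
  by have [] := g r.
exists t; first by move: t01; rewrite in_itv.
by move: H; rewrite scale1r scale0r addr0 subr0 mulr1.
Qed.

Lemma is_deriveZv u x v (k l : R) : is_derive x v u l ->
  is_derive x (k *: v) u (k * l).
Proof.
move=> ul.
have h : is_derive (0 : R) 1 (fun r : R => u (x + r *: v)) l.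
  by apply: is_derive_line; rewrite scale0r addr0.
have [->|k0] := eqVneq k 0.
  by rewrite scale0r mul0r; exact: is_derive0.
have [du ul'] := ul.
pose D (h : R) := h^-1 *: ((u \o shift x) (h *: v) - u x).
have E : (fun h : R => h^-1 *: ((u \o shift x) (h *: (k *: v)) - u x)) =
    (fun h : R => k *: D (k * h)).
  apply/funext => r; rewrite /D /=.
  have [->|r0] := eqVneq r 0; first by rewrite mulr0 !invr0 !scale0r scaler0.
  by rewrite !scalerA invfM mulrA mulfV// mul1r [r * k]mulrC.
have c : (fun h : R => k *: D (k * h)) @ 0^' --> k * l.
  apply: (@cvgZl_tmp _ R^o).
  have c1 : D @ 0^' --> l by rewrite -ul'; exact: du.
  apply: (@cvg_comp _ _ _ (fun h => k * h) D _ 0^' _ _ c1).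
  move=> A [e /= e0 eA]; exists (e / `|k|) => /=.
    by rewrite divr_gt0// normr_gt0.
  move=> r /=; rewrite sub0r normrN => re r0; apply: eA => /=.
    by rewrite sub0r normrN normrM mulrC -ltr_pdivlMr ?normr_gt0.
  by rewrite mulf_neq0.
by split; [rewrite /derivable E; apply/cvg_ex; exists (k * l)
          |rewrite /derive E; exact: cvg_lim].
Qed.

End Lines.

(** * Partial derivatives of complex-valued functions *)

Section PartialDerivatives.
Context (R : realType) (d : nat).
Local Notation Rd := 'rV[R]_d.
Local Notation fct := ('rV[R]_d -> R[i]^o).
Local Notation ReC := (@complex.Re R).
Local Notation ImC := (@complex.Im R).
Implicit Types (f g : fct) (x y t : Rd) (i j : 'I_d) (s : seq 'I_d).

Lemma cmod_Re (z : R[i]) : `|ReC z| <= cmod z.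
Proof.
case: z => a b; rewrite /cmod /= -sqrtr_sqr ler_wsqrtr//.
by rewrite lerDl sqr_ge0.
Qed.

Lemma cmod_Im (z : R[i]) : `|ImC z| <= cmod z.
Proof.
case: z => a b; rewrite /cmod /= -sqrtr_sqr ler_wsqrtr//.
by rewrite lerDr sqr_ge0.
Qed.

Lemma cmod_ReIm (z : R[i]) : cmod z <= `|ReC z| + `|ImC z|.
Proof.
case: z => a b; rewrite /cmod /= -[leRHS]ger0_norm ?addr_ge0// -sqrtr_sqr.
rewrite ler_wsqrtr// sqrrD !real_normK ?num_real// lerD2r lerDl.
by rewrite mulrn_wge0// mulr_ge0.
Qed.

(** Unlike an equation on the values of [pderiv], this records that both partial
    derivatives exist. *)
Definition is_pd i f x (l : R[i]) :=
  is_derive x (delta_mx 0 i) (fun y => ReC (f y)) (ReC l) /\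
  is_derive x (delta_mx 0 i) (fun y => ImC (f y)) (ImC l).

Lemma is_pd_pderiv i f x l : is_pd i f x l -> pderiv i f x = l.
Proof.
by move=> [h1 h2]; rewrite /pderiv !derive_val; case: (l).
Qed.

Lemma smooth_pd f s i x : smooth f ->
  is_pd i (pderivs s f) x (pderivs (i :: s) f x).
Proof. by move=> /(_ s)[_ /(_ i x)[h1 h2]]; split; exact: DeriveDef. Qed.

Lemma smooth_continuous f s : smooth f -> continuous (pderivs s f).
Proof. by move=> /(_ s)[]. Qed.

(** Smoothness follows once candidates for all iterated derivatives are known
    and each is the derivative of the preceding one. *)
Lemma smooth_jet (F : seq 'I_d -> fct) :
  (forall s, continuous (F s)) ->
  (forall s i x, is_pd i (F s) x (F (i :: s) x)) ->
  smooth (F [::]) /\ forall s, pderivs s (F [::]) = F s.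
Proof.
move=> cF dF.
have FE s : pderivs s (F [::]) = F s.
  elim: s => [//|i s /= ->]; apply/funext => x.
  by apply: is_pd_pderiv.
split=> // s; rewrite FE; split=> [//|i x].
by have [[h1 _] [h2 _]] := dF s i x.
Qed.

Lemma pderivs_cat s1 s2 f : pderivs (s1 ++ s2) f = pderivs s1 (pderivs s2 f).
Proof. exact: foldr_cat. Qed.

Lemma smooth_pderivs f s : smooth f -> smooth (pderivs s f).
Proof. by move=> sf s'; rewrite -pderivs_cat; exact: sf. Qed.

Lemma is_pd_eq i f x l l' : is_pd i f x l -> l = l' -> is_pd i f x l'.
Proof. by move=> + <-. Qed.

Lemma is_pd_cst i x (a : R[i]) : is_pd i (cst a) x 0.
Proof. by split; exact: is_derive_cst. Qed.

Lemma is_pdD i f g x l m : is_pd i f x l -> is_pd i g x m ->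
  is_pd i (fun y => f y + g y) x (l + m).
Proof.
move=> [f1 f2] [g1 g2]; split.
  have -> : (fun y => ReC (f y + g y)) = (fun y => ReC (f y)) + (fun y => ReC (g y)).
    by apply/funext => y; rewrite !fctE; case: (f y) (g y) => ? ? [].
  apply: (is_derive_eq (is_deriveD f1 g1)).
  by case: (l) (m) => ? ? [].
have -> : (fun y => ImC (f y + g y)) = (fun y => ImC (f y)) + (fun y => ImC (g y)).
  by apply/funext => y; rewrite !fctE; case: (f y) (g y) => ? ? [].
apply: (is_derive_eq (is_deriveD f2 g2)).
by case: (l) (m) => ? ? [].
Qed.

Lemma is_pdM i f g x l m : is_pd i f x l -> is_pd i g x m ->
  is_pd i (fun y => f y * g y) x (l * g x + f x * m).
Proof.
move=> [f1 f2] [g1 g2]; split.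
  have -> : (fun y => ReC (f y * g y)) =
    (fun y => ReC (f y)) * (fun y => ReC (g y)) -
    (fun y => ImC (f y)) * (fun y => ImC (g y)).
    by apply/funext => y; rewrite !fctE; case: (f y) (g y) => ? ? [].
  apply: (is_derive_eq (is_deriveB (is_deriveM f1 g1) (is_deriveM f2 g2))).
  case: (l) (m) (f x) (g x) => [a b] [a' b'] [p q] [p' q'] /=; rewrite /GRing.scale /=; ring.
have -> : (fun y => ImC (f y * g y)) =
    (fun y => ReC (f y)) * (fun y => ImC (g y)) +
    (fun y => ImC (f y)) * (fun y => ReC (g y)).
  by apply/funext => y; rewrite !fctE; case: (f y) (g y) => ? ? [].
apply: (is_derive_eq (is_deriveD (is_deriveM f1 g2) (is_deriveM f2 g1))).
case: (l) (m) (f x) (g x) => [a b] [a' b'] [p q] [p' q'] /=; rewrite /GRing.scale /=; ring.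
Qed.

Lemma is_pdZ i f x l (a : R[i]) : is_pd i f x l -> is_pd i (fun y => a * f y) x (a * l).
Proof.
move=> fl; apply: is_pd_eq; first exact: (is_pdM (is_pd_cst i x a) fl).
by rewrite mul0r add0r.
Qed.

Lemma is_pd_sum i (I : eqType) (r : seq I) (F : I -> fct) (L : I -> R[i]) x :
  (forall k, k \in r -> is_pd i (F k) x (L k)) ->
  is_pd i (fun y => \sum_(k <- r) F k y) x (\sum_(k <- r) L k).
Proof.
elim: r => [|k r IH] H.
  have -> : (fun y => \sum_(k <- [::]) F k y) = cst 0 :> fct.
    by apply/funext => y; rewrite big_nil.
  by rewrite big_nil; exact: is_pd_cst.
have -> : (fun y => \sum_(k <- k :: r) F k y) =
    (fun y => F k y + \sum_(k <- r) F k y) :> fct.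
  by apply/funext => y; rewrite big_cons.
rewrite big_cons; apply: is_pdD; first by apply: H; rewrite mem_head.
by apply: IH => k' k'r; apply: H; rewrite inE k'r orbT.
Qed.

Lemma is_pd_conj i f x l : is_pd i f x l -> is_pd i (fun y => (f y)^*%C) x (l^*%C).
Proof.
move=> [f1 f2]; split.
  have -> : (fun y => ReC (f y)^*%C) = (fun y => ReC (f y)).
    by apply/funext => y; case: (f y).
  by case: (l) f1.
have -> : (fun y => ImC (f y)^*%C) = - (fun y => ImC (f y)).
  by apply/funext => y; rewrite fctE; case: (f y).
apply: (is_derive_eq (is_deriveN f2)).
by case: (l).
Qed.

Lemma is_pd_refl i f x t l : is_pd i f (x - t) l ->
  is_pd i (fun y => f (x - y)) t (- l).
Proof.
have h (u : Rd -> R) (m : R) : is_derive (x - t) (delta_mx 0 i) u m ->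
    is_derive t (delta_mx 0 i) (fun y => u (x - y)) (- m).
  move=> um.
  have [du ul] := @is_deriveZv R d u (x - t) (delta_mx 0 i) (-1) m um.
  have E : (fun h : R => h^-1 *: (((fun y => u (x - y)) \o shift t) (h *: (delta_mx 0 i)) -
      u (x - t))) =
    (fun h : R => h^-1 *: ((u \o shift (x - t)) (h *: (-1 *: delta_mx 0 i)) - u (x - t))).
    apply/funext => h /=; congr (_ *: (u _ - _)).
    by rewrite opprD addrCA scaleN1r scalerN.
  by split; [rewrite /derivable E|rewrite /derive E -[RHS]mulN1r -ul].
move=> [f1 f2]; split.
  by apply: is_derive_eq; [exact: (h (fun y => ReC (f y)) _ f1)|case: (l)].
by apply: is_derive_eq; [exact: (h (fun y => ImC (f y)) _ f2)|case: (l)].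
Qed.

End PartialDerivatives.

(** * Mean value estimates *)

Section MeanValue.
Context (R : realType) (d : nat).
Local Notation Rd := 'rV[R]_d.
Local Notation fct := ('rV[R]_d -> R[i]^o).
Local Notation ReC := (@complex.Re R).
Local Notation ImC := (@complex.Im R).
Implicit Types (f g : fct) (x y t : Rd) (i j : 'I_d) (s : seq 'I_d).
Local Notation e_ i := (delta_mx 0 i : Rd).

(** The intermediate point is written x + r e_i with |r| <= |h|, so that the sign
    of h does not matter. *)
Lemma MVT_pd (u du : Rd -> R) i x (h : R) :
  (forall y, is_derive y (e_ i) u (du y)) ->
  exists2 r : R, `|r| <= `|h| & u (x + h *: e_ i) - u x = h * du (x + r *: e_ i).
Proof.
move=> ud.
have [t /andP[t0 t1] ->] := MVT_line x (fun y => is_deriveZv h (ud y)).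
by exists (t * h); rewrite ?scalerA// normrM ger0_norm// ler_piMl.
Qed.

(** The mean value theorem is applied to the real and imaginary parts
    separately, which costs the factor 2. *)
Lemma pd_increment f f' i x (h K : R) : (forall y, is_pd i f y (f' y)) ->
  (forall r : R, `|r| <= `|h| -> cmod (f' (x + r *: e_ i)) <= K) ->
  cmod (f (x + h *: e_ i) - f x) <= 2 * (`|h| * K).
Proof.
move=> fd f'K.
have [r1 r1h E1] := MVT_pd x h (fun y => (fd y).1).
have [r2 r2h E2] := MVT_pd x h (fun y => (fd y).2).
rewrite (le_trans (cmod_ReIm _))// mulr_natl mulr2n.
have -> : ReC (f (x + h *: e_ i) - f x) = ReC (f (x + h *: e_ i)) - ReC (f x).
  by case: (f _) (f _) => ? ? [].
have -> : ImC (f (x + h *: e_ i) - f x) = ImC (f (x + h *: e_ i)) - ImC (f x).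
  by case: (f _) (f _) => ? ? [].
rewrite E1 E2 !normrM lerD// ler_wpM2l//.
  by rewrite (le_trans (cmod_Re _))// f'K.
by rewrite (le_trans (cmod_Im _))// f'K.
Qed.

Lemma pd_taylor f f' f'' i x (h K : R) : (forall y, is_pd i f y (f' y)) ->
  (forall y, is_pd i f' y (f'' y)) ->
  (forall r : R, `|r| <= `|h| -> cmod (f'' (x + r *: e_ i)) <= K) ->
  cmod (f (x + h *: e_ i) - f x - h%:C * f' x) <= 2 * (`|h| ^+ 2 * K).
Proof.
move=> fd fd' f''K.
have K0 : 0 <= K by rewrite (le_trans _ (f''K 0 _)) ?normr0// cmod_ge0.
have key (u du ddu : Rd -> R) : (forall y, is_derive y (e_ i) u (du y)) ->
   (forall y, is_derive y (e_ i) du (ddu y)) ->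
   (forall r : R, `|r| <= `|h| -> `|ddu (x + r *: e_ i)| <= K) ->
   `|u (x + h *: e_ i) - u x - h * du x| <= `|h| ^+ 2 * K.
  move=> ud dud dduK.
  have [r rh ->] := MVT_pd x h ud.
  have [r' r'r] := MVT_pd x r dud.
  rewrite -mulrBr => ->; rewrite !normrM mulrA expr2 ler_pM//.
    by rewrite ler_wpM2l.
  by rewrite dduK// (le_trans r'r).
rewrite (le_trans (cmod_ReIm _))// mulr_natl mulr2n.
have -> : ReC (f (x + h *: e_ i) - f x - h%:C * f' x) =
    ReC (f (x + h *: e_ i)) - ReC (f x) - h * ReC (f' x).
  by case: (f _) (f _) (f' _) => ? ? [? ?] [? ?] /=; rewrite mul0r subr0.
have -> : ImC (f (x + h *: e_ i) - f x - h%:C * f' x) =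
    ImC (f (x + h *: e_ i)) - ImC (f x) - h * ImC (f' x).
  by case: (f _) (f _) (f' _) => ? ? [? ?] [? ?] /=; rewrite mul0r addr0.
rewrite lerD//.
  apply: (key (fun y => ReC (f y)) (fun y => ReC (f' y)) (fun y => ReC (f'' y))).
  - by move=> y; have [] := fd y.
  - by move=> y; have [] := fd' y.
  - by move=> r rh; rewrite (le_trans (cmod_Re _))// f''K.
apply: (key (fun y => ImC (f y)) (fun y => ImC (f' y)) (fun y => ImC (f'' y))).
- by move=> y; have [] := fd y.
- by move=> y; have [] := fd' y.
- by move=> r rh; rewrite (le_trans (cmod_Im _))// f''K.
Qed.

Lemma coord_le_norm x i : `|x 0 i| <= `|x|.
Proof.
rewrite -[leRHS]/(mx_norm x) mx_normrE.
exact: (@le_bigmax _ _ _ _ (fun ij : 'I_1 * 'I_d => `|x ij.1 ij.2|) (0, i)).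
Qed.

Lemma norm_le_coord x (K : R) : 0 <= K -> (forall i, `|x 0 i| <= K) -> `|x| <= K.
Proof.
move=> K0 H; rewrite -[leLHS]/(mx_norm x) mx_normrE.
by apply: bigmax_le => // -[a b] _ /=; rewrite ord1.
Qed.

Lemma norm_e i : `|e_ i| <= 1.
Proof.
apply: norm_le_coord => // k; rewrite !mxE /=.
by case: (_ == _); rewrite ?normr1 ?normr0.
Qed.

(** A function whose partial derivatives exist and are locally bounded is
    continuous: coordinates are changed one at a time. *)
Lemma pd_continuous f (f' : 'I_d -> fct) :
  (forall i y, is_pd i f y (f' i y)) ->
  (forall x, exists K : R, \forall y \near x, forall i, cmod (f' i y) <= K) ->
  continuous f.
Proof.
move=> fd bd x.
have [K /nbhs_normP[e /= e0 HK]] := bd x.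
pose mix y (n : nat) : Rd := \row_i (if (i < n)%N then y 0 i else x 0 i).
have mixS y (i : 'I_d) : mix y i.+1 = mix y i + (y 0 i - x 0 i) *: e_ i.
  apply/rowP => k; rewrite !mxE eqxx /=.
  have [->|ki] := eqVneq k i; first by rewrite ltnn ltnSn mulr1 addrC subrK.
  have ki' : (k == i :> nat) = false by exact: negbTE.
  by rewrite mulr0 addr0 ltnS leq_eqVlt ki'.
have step y (i : 'I_d) : `|x - y| < e ->
    cmod (f (mix y i.+1) - f (mix y i)) <= 2 * (`|x - y| * K).
  move=> xy; rewrite mixS.
  have yx : `|y 0 i - x 0 i| <= `|x - y|.
    by rewrite distrC; have := coord_le_norm (x - y) i; rewrite !mxE.
  apply: le_trans (pd_increment (K := K) (fun z => fd i z) _) _.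
    move=> r rh; apply: HK => /=; apply: le_lt_trans xy.
    apply: norm_le_coord => // b; rewrite !mxE /=.
    have := coord_le_norm (x - y) b; rewrite !mxE => hb.
    have [->|bi] := eqVneq b i.
      by rewrite ltnn mulr1 opprD addrA subrr sub0r normrN (le_trans rh).
    rewrite mulr0 addr0; case: ifP => // _; by rewrite subrr normr0.
  have K0 : 0 <= K by rewrite (le_trans (cmod_ge0 _) (HK x _ i))//= subrr normr0.
  by rewrite ler_pM2l// ler_wpM2r.
have bound y : `|x - y| < e -> cmod (f y - f x) <= d%:R * (2 * (`|x - y| * K)).
  move=> xy.
  have -> : f y - f x = \sum_(i < d) (f (mix y i.+1) - f (mix y i)).
    have -> : f y = f (mix y d) by congr f; apply/rowP => k; rewrite mxE ltn_ord.
    have -> : f x = f (mix y 0%N) by congr f; apply/rowP => k; rewrite mxE.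
    by rewrite -(@telescope_sumr _ 0%N d (fun k => f (mix y k)))// big_mkord.
  apply: le_trans (cmod_sum _ _ _) _.
  rewrite (le_trans (ler_sum _ (fun i _ => step y i xy)))//.
  by rewrite sumr_const card_ord -[leLHS]mulr_natl.
apply/(@cvgrPdist_lt R[i] R[i]^o _ (nbhs (x : Rd)) (nbhs_filter (x : Rd))) => eps.
rewrite ltcE /= => /andP[/eqP eim eps0].
have -> : eps = (ReC eps)%:C by case: (eps) eim => a b /= ->.
set r := ReC eps in eps0 *.
pose del := Num.min e (r / (d%:R * (2 * `|K|) + 1)).
have q0 : 0 < d%:R * (2 * `|K|) + 1 by rewrite ltr_wpDl// !mulr_ge0.
have del0 : 0 < del by rewrite lt_min e0 divr_gt0.
apply: (iffRL (nbhs_normP (x : Rd) _)); exists del => //= y; rewrite /= lt_min => /andP[xye xyr].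
rewrite cmodE ltcR -cmodN opprB (le_lt_trans (bound y xye))//.
rewrite ltr_pdivlMr// in xyr; apply: le_lt_trans xyr.
have -> : d%:R * (2 * (`|x - y| * K)) = `|x - y| * (d%:R * (2 * K)) by ring.
rewrite ler_wpM2l// (@le_trans _ _ (d%:R * (2 * `|K|)))//.
  by rewrite !ler_wpM2l// ler_norm.
by rewrite lerDl.
Qed.

End MeanValue.

(** * Symmetry of partial derivatives *)

Section Schwarz.
Context (R : realType) (d : nat).
Local Notation Rd := 'rV[R]_d.
Local Notation fct := ('rV[R]_d -> R[i]^o).
Local Notation ReC := (@complex.Re R).
Local Notation ImC := (@complex.Im R).
Implicit Types (f g : fct) (x y t : Rd) (i j : 'I_d) (s : seq 'I_d).
Local Notation e_ i := (delta_mx 0 i : Rd).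

Lemma continuous_epsP (V : normedModType R) (u : Rd -> V) : continuous u <->
  forall x (e : R), 0 < e -> exists2 del : R, 0 < del &
    forall y, `|x - y| < del -> `|u x - u y| < e.
Proof.
split=> [cu x e e0|H x].
  have /(@cvgrPdist_lt R V _ (nbhs (x : Rd)) (nbhs_filter (x : Rd))) h := cu x.
  have [del /= del0 Hd] := iffLR (nbhs_normP (x : Rd) _) (h e e0).
  by exists del.
apply/(@cvgrPdist_lt R V _ (nbhs (x : Rd)) (nbhs_filter (x : Rd))) => e e0.
by have [del del0 Hd] := H x e e0; apply: (iffRL (nbhs_normP (x : Rd) _)); exists del.
Qed.

Lemma is_derive_shiftv (u : Rd -> R) x v a l :
  is_derive (x + a) v u l -> is_derive x v (fun y => u (y + a)) l.
Proof.
move=> [du <-].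
have E : (fun h : R => h^-1 *: (((fun y => u (y + a)) \o shift x) (h *: v) - u (x + a))) =
    (fun h : R => h^-1 *: ((u \o shift (x + a)) (h *: v) - u (x + a))).
  by apply/funext => h /=; rewrite addrA.
by split; [rewrite /derivable E|rewrite /derive E].
Qed.

(** The second difference on the left is symmetric in i and j, up to the order
    of the terms; this is the source of the symmetry of mixed derivatives. *)
Lemma second_difference (u ui uji : Rd -> R) i j x (h : R) :
  (forall y, is_derive y (e_ i) u (ui y)) ->
  (forall y, is_derive y (e_ j) ui (uji y)) ->
  exists2 y, `|x - y| <= 2 * `|h| &
    u (x + h *: e_ i + h *: e_ j) - u (x + h *: e_ i) -
    (u (x + h *: e_ j) - u x) = h ^+ 2 * uji y.
Proof.
move=> ud uid.
have [r rh E] := @MVT_pd R d (fun y => u (y + h *: e_ j) - u y)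
  (fun y => ui (y + h *: e_ j) - ui y) i x h
  (fun y => is_deriveB (is_derive_shiftv (ud (y + h *: e_ j))) (ud y)).
have [r' rh' E'] := MVT_pd (x + r *: e_ i) h uid.
exists (x + r *: e_ i + r' *: e_ j); last by rewrite E E' mulrA -expr2.
rewrite -addrA opprD addrA subrr sub0r normrN mulr_natl mulr2n.
rewrite (le_trans (ler_normD _ _))// !normrZ lerD//.
  by rewrite (le_trans _ rh)// ler_piMr// norm_e.
by rewrite (le_trans _ rh')// ler_piMr// norm_e.
Qed.

Lemma mixed_derivatives (u ui uj uji uij : Rd -> R) i j :
  (forall y, is_derive y (e_ i) u (ui y)) ->
  (forall y, is_derive y (e_ j) u (uj y)) ->
  (forall y, is_derive y (e_ j) ui (uji y)) ->
  (forall y, is_derive y (e_ i) uj (uij y)) ->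
  continuous uji -> continuous uij -> uji = uij.
Proof.
move=> di dj dji dij cji cij; apply/funext => x.
apply/eqP; rewrite -subr_eq0 -normr_eq0; apply/eqP/le_anti; rewrite normr_ge0 andbT.
apply/ler_addgt0Pr => e e0; rewrite add0r.
have e20 : 0 < e / 2 by rewrite divr_gt0.
have [d1 d10 H1] := (iffLR (@continuous_epsP R^o uji)) cji x _ e20.
have [d2 d20 H2] := (iffLR (@continuous_epsP R^o uij)) cij x _ e20.
pose h := Num.min d1 d2 / 3.
have m0 : 0 < Num.min d1 d2 by rewrite lt_min d10.
have h0 : 0 < h by rewrite divr_gt0.
have hm : 2 * `|h| < Num.min d1 d2 by rewrite gtr0_norm// /h; lra.
have [p xp Ep] := second_difference x h di dji.
have [q xq Eq] := second_difference x h dj dij.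
have pq : uji p = uij q.
  have h2 : h ^+ 2 != 0 by rewrite expf_eq0 gt_eqF.
  apply: (mulfI h2); rewrite -Ep -Eq.
  by rewrite [x + h *: e_ j + h *: e_ i]addrAC; ring.
rewrite [leRHS]splitr (_ : uji x - uij x = (uji x - uji p) - (uij x - uij q)); last first.
  by rewrite pq opprB addrA subrK.
rewrite (le_trans (ler_normB _ _))// lerD//.
  by apply/ltW/H1; apply: (le_lt_trans xp); apply: (lt_le_trans hm); rewrite ge_min lexx.
by apply/ltW/H2; apply: (le_lt_trans xq); apply: (lt_le_trans hm); rewrite ge_min lexx orbT.
Qed.

Lemma continuous_ReIm f : continuous f ->
  continuous (fun y => ReC (f y)) /\ continuous (fun y => ImC (f y)).
Proof.
move=> cf.
have H x (e : R) : 0 < e -> exists2 del : R, 0 < del &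
    forall y, `|x - y| < del -> cmod (f x - f y) < e.
  move=> e0.
  have /(@cvgrPdist_lt R[i] R[i]^o _ (nbhs (x : Rd)) (nbhs_filter (x : Rd))) h := cf x.
  have e0' : 0 < e%:C by rewrite ltcR.
  have [del /= del0 Hd] := iffLR (nbhs_normP (x : Rd) _) (h _ e0').
  by exists del => // y /Hd /=; rewrite cmodE ltcR.
split; apply/(@continuous_epsP R^o) => x e e0; have [del del0 Hd] := H x e e0;
    exists del => // y /Hd; apply: le_lt_trans.
  apply: le_trans (cmod_Re _); rewrite le_eqVlt; apply/orP; left; apply/eqP.
  by congr (`|_|); case: (f x) (f y) => ? ? [].
apply: le_trans (cmod_Im _); rewrite le_eqVlt; apply/orP; left; apply/eqP.
by congr (`|_|); case: (f x) (f y) => ? ? [].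
Qed.

Lemma pderivC f i j : smooth f -> pderiv i (pderiv j f) = pderiv j (pderiv i f).
Proof.
move=> sf.
have d0 k y := smooth_pd [::] k y sf.
have dk k l y := smooth_pd [:: l] k y sf.
have c2 k l := continuous_ReIm (@smooth_continuous _ _ f [:: k; l] sf).
have HR := @mixed_derivatives _ _ _ _ _ i j
  (fun y => (d0 i y).1) (fun y => (d0 j y).1)
  (fun y => (dk j i y).1) (fun y => (dk i j y).1) (c2 j i).1 (c2 i j).1.
have HI := @mixed_derivatives _ _ _ _ _ i j
  (fun y => (d0 i y).2) (fun y => (d0 j y).2)
  (fun y => (dk j i y).2) (fun y => (dk i j y).2) (c2 j i).2 (c2 i j).2.
apply/funext => x.
apply/eqP; rewrite eq_complex; apply/andP; split; apply/eqP.
  exact: esym (congr1 (@^~ x) HR).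
exact: esym (congr1 (@^~ x) HI).
Qed.

Lemma pderivs_perm f s s' : smooth f -> perm_eq s s' -> pderivs s f = pderivs s' f.
Proof.
move=> sf; move: s'; elim: s => [|i s IH] s' /=.
  by rewrite perm_sym => /perm_nilP ->.
move=> h; have is' : i \in s' by rewrite -(perm_mem h) mem_head.
have [s1 [s2 Es]] : exists s1 s2, s' = s1 ++ i :: s2.
  by case/splitPr: is' => s1 s2; exists s1, s2.
rewrite Es in h *.
rewrite perm_sym -cat1s perm_catCA /= perm_cons perm_sym in h.
rewrite (IH _ h) !pderivs_cat /=.
elim: s1 {h is' Es} => [//|k s1 IH1 /=].
rewrite -IH1 pderivC// -pderivs_cat; exact: smooth_pderivs.
Qed.

Definition seq_index s : multi_index d := [ffun i => count_mem i s].

Lemma perm_index_seq s :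
  perm_eq s (flatten [seq nseq (seq_index s i) i | i <- enum 'I_d]).
Proof.
apply/allP => i _ /=; rewrite count_flatten -map_comp /comp.
rewrite sumnE big_map big_enum /= (bigD1 i)//= count_nseq /= eqxx mul1n ffunE.
rewrite big1 ?addn0// => k ki; rewrite count_nseq /=.
by rewrite (negbTE ki).
Qed.

Lemma size_index_seq (a : multi_index d) :
  size (flatten [seq nseq (a i) i | i <- enum 'I_d]) = morder a.
Proof.
rewrite size_flatten /shape -map_comp sumnE big_map big_enum /=.
by apply: eq_bigr => i _; rewrite /= size_nseq.
Qed.

(** By symmetry of mixed partial derivatives, bounds over multi-indices and
    bounds over arbitrary sequences of differentiation directions agree; the
    latter are the convenient ones for induction. *)
Lemma mderiv_seq f s : smooth f -> pderivs s f = mderiv (seq_index s) f.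
Proof. by move=> sf; apply: pderivs_perm => //; exact: perm_index_seq. Qed.

Lemma morder_seq s : morder (seq_index s) = size s.
Proof. by rewrite -size_index_seq; apply/esym/perm_size/perm_index_seq. Qed.

End Schwarz.

(** * The Leibniz rule and weighted derivative bounds *)

Section LogConvex.
Context (R : realType) (M : nat -> {posnum R}) (M1 : cond_M1 M).
Local Notation m p := ((M p)%:num).

Lemma M1_ratio p q : m q.+1 * m (q + p) <= m q * m (q + p).+1.
Proof.
elim: p => [|p IH]; first by rewrite addn0 mulrC.
rewrite addnS; set n := (q + p)%N in IH *.
have n1 : 0 < m n.+1 by [].
rewrite -(ler_pM2r n1) -mulrA -expr2.
rewrite (le_trans (ler_wpM2l _ (M1 n)))// mulrA.
by rewrite (le_trans (ler_wpM2r _ IH))// mulrAC.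
Qed.

(** Log-convexity makes M_(p+1) / M_p nondecreasing, so shifting indices from one
    factor to the other can only increase the product. *)
Lemma M1_mul p q : m p * m q <= m 0%N * m (p + q).
Proof.
elim: q => [|q IH]; first by rewrite addn0 mulrC.
have q0 : 0 < m q by [].
rewrite -(ler_pM2r q0) mulrAC (le_trans (ler_wpM2r _ IH))// addnS -!mulrA.
by rewrite ler_pM2l// mulrC [leRHS]mulrC addnC M1_ratio.
Qed.

Lemma M1_step p : m 1%N * m p <= m 0%N * m p.+1.
Proof. by have := M1_mul 1 p. Qed.

End LogConvex.

Section Leibniz.
Context (R : realType) (d : nat).
Local Notation Rd := 'rV[R]_d.
Local Notation fct := ('rV[R]_d -> R[i]^o).
Implicit Types (f g : fct) (x y t : Rd) (i j : 'I_d) (s : seq 'I_d).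

(** All ways of distributing the derivatives in s over the two factors of a
    product, with multiplicity. *)
Fixpoint splits s : seq (seq 'I_d * seq 'I_d) :=
  if s is i :: s' then
    [seq (i :: p.1, p.2) | p <- splits s'] ++ [seq (p.1, i :: p.2) | p <- splits s']
  else [:: ([::], [::])].

Lemma size_splits s : size (splits s) = (2 ^ size s)%N.
Proof. by elim: s => //= i s IH; rewrite size_cat !size_map IH addnn expnS mul2n. Qed.

Lemma splits_size s p : p \in splits s -> (size p.1 + size p.2)%N = size s.
Proof.
elim: s p => [|i s IH] p /=; first by rewrite inE => /eqP ->.
by rewrite mem_cat => /orP[] /mapP[q /IH <- ->] //=; rewrite addnS.
Qed.

Lemma continuous_cmul (f g : fct) : continuous f -> continuous g ->
  continuous (fun y => f y * g y : R[i]^o).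
Proof.
by move=> cf cg x; exact: (@cvgM R[i] _ _ _ f g _ _ (cf x) (cg x)).
Qed.

Lemma continuous_csum (I : Type) (r : seq I) (F : I -> fct) :
  (forall k, continuous (F k)) -> continuous (fun y => \sum_(k <- r) F k y : R[i]^o).
Proof.
move=> cF; elim: r => [|k r IH].
  rewrite (_ : (fun y => _) = cst 0); first exact: cst_continuous.
  by apply/funext => y; rewrite big_nil.
rewrite (_ : (fun y => _) = (fun y => F k y + \sum_(k <- r) F k y)); last first.
  by apply/funext => y; rewrite big_cons.
move=> x; exact: (@cvgD _ R[i]^o _ _ _ _ _ _ _ (cF k x) (IH x)).
Qed.

Lemma leibniz f g : smooth f -> smooth g ->
  smooth (fun y => f y * g y) /\ forall s, pderivs s (fun y => f y * g y) =
    (fun y => \sum_(p <- splits s) pderivs p.1 f y * pderivs p.2 g y).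
Proof.
move=> sf sg.
pose F s : fct := fun y => \sum_(p <- splits s) pderivs p.1 f y * pderivs p.2 g y.
have F0 : F [::] = (fun y => f y * g y).
  by apply/funext => y; rewrite /F /= big_cons big_nil addr0.
rewrite -F0; apply: smooth_jet => [s|s i x].
  apply: continuous_csum => p.
  by apply: continuous_cmul; exact: smooth_continuous.
have := @is_pd_sum R d i _ (splits s)
  (fun p y => pderivs p.1 f y * pderivs p.2 g y)
  (fun p => pderivs (i :: p.1) f x * pderivs p.2 g x +
            pderivs p.1 f x * pderivs (i :: p.2) g x) x.
have -> : F (i :: s) x = \sum_(p <- splits s) (pderivs (i :: p.1) f x * pderivs p.2 g x +
            pderivs p.1 f x * pderivs (i :: p.2) g x).
  by rewrite /F /= big_cat /= !big_map big_split.
by apply=> p _; apply: is_pdM; exact: smooth_pd.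
Qed.

(** There are 2^|s| terms in Leibniz' rule, and by (M.1) each is at most M_0 times
    the bound for a single function of order |s|. *)
Lemma leibniz_bound (M : nat -> {posnum R}) (f g : fct) (a b r : R) x s :
  cond_M1 M -> smooth f -> smooth g -> 0 <= a -> 0 <= b -> 0 <= r ->
  (forall s, cmod (pderivs s f x) <= a * (r ^+ size s * (M (size s))%:num)) ->
  (forall s, cmod (pderivs s g x) <= b * (r ^+ size s * (M (size s))%:num)) ->
  cmod (pderivs s (fun y => f y * g y) x) <=
    (M 0%N)%:num * a * b * ((2 * r) ^+ size s * (M (size s))%:num).
Proof.
move=> M1 sf sg a0 b0 r0 Hf Hg.
have [_ ->] := leibniz sf sg.
apply: le_trans (cmod_sum _ _ _) _.
apply: (@le_trans _ _ (\sum_(p <- splits s)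
    ((M 0%N)%:num * a * b * (r ^+ size s * (M (size s))%:num)))); last first.
  rewrite big_const_seq count_predT size_splits iter_addr_0 -[leLHS]mulr_natl natrX exprMn.
  by rewrite le_eqVlt; apply/orP; left; apply/eqP; ring.
rewrite big_seq [leRHS]big_seq; apply: ler_sum => p ps.
rewrite cmodM (le_trans (ler_pM (cmod_ge0 _) (cmod_ge0 _) (Hf _) (Hg _)))//.
have e := splits_size ps; have := M1_mul M1 (size p.1) (size p.2); rewrite e => h.
have -> : r ^+ size s = r ^+ size p.1 * r ^+ size p.2 by rewrite -e exprD.
have -> : a * (r ^+ size p.1 * (M (size p.1))%:num) *
    (b * (r ^+ size p.2 * (M (size p.2))%:num)) =
    a * b * (r ^+ size p.1 * r ^+ size p.2) *
    ((M (size p.1))%:num * (M (size p.2))%:num) by ring.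
have -> : (M 0%N)%:num * a * b *
    (r ^+ size p.1 * r ^+ size p.2 * (M (size s))%:num) =
    a * b * (r ^+ size p.1 * r ^+ size p.2) * ((M 0%N)%:num * (M (size s))%:num) by ring.
by rewrite ler_wpM2l// !mulr_ge0// exprn_ge0.
Qed.

End Leibniz.

Section Bounds.
Context (R : realType) (d : nat).
Local Notation Rd := 'rV[R]_d.
Local Notation fct := ('rV[R]_d -> R[i]^o).
Implicit Types (f g : fct) (x y t : Rd) (i j : 'I_d) (s : seq 'I_d).
Implicit Types (M : nat -> {posnum R}) (h K : R) (w : Rd -> R).

(** The norm of f in B^{M,h}_w is at most K; derivatives are indexed by sequences
    of directions instead of multi-indices. *)
Definition bnd M h w K f := smooth f /\ forall s x,
  h ^+ size s * w x * cmod (pderivs s f x) <= K * (M (size s))%:num.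

Lemma sup_norm_ub (X : lmodType R[i]) (D : set X) (I : Type) (c : I -> {nonneg R})
    (l : I -> X -> R[i]) (x : X) (i : I) : sup_dom D c l x ->
  (c i)%:num * cmod (l i x) <= fine (sup_norm c l x).
Proof.
move=> [_ xoo].
have h : (((c i)%:num * cmod (l i x))%:E <= sup_norm c l x)%E.
  by apply: ereal_sup_ubound; exists i.
by rewrite -lee_fin fineK// fin_numE -ltNye -ltey xoo (lt_le_trans _ h)// ltNyr.
Qed.

Lemma sup_norm_lub (X : lmodType R[i]) (D : set X) (I : Type) (c : I -> {nonneg R})
    (l : I -> X -> R[i]) (x : X) (b : R) : D x -> 0 <= b ->
  (forall i : I, (c i)%:num * cmod (l i x) <= b) ->
  sup_dom D c l x /\ fine (sup_norm c l x) <= b.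
Proof.
move=> Dx b0 xb.
have h : (sup_norm c l x <= b%:E)%E.
  by apply: ge_ereal_sup => _ [i _ <-]; rewrite lee_fin.
split; first by split => //; rewrite (le_lt_trans h)// ltry.
by move: h; case: (sup_norm _ _ x) => [r| |] //=; rewrite lee_fin.
Qed.

Lemma bnd_ge0 M h w K f : (forall x, 0 <= w x) -> bnd M h w K f -> 0 <= K.
Proof.
move=> w0 [_ /(_ [::] 0)]; rewrite /= expr0 mul1r => h1.
have : 0 <= K * (M 0%N)%:num by apply: le_trans h1; rewrite mulr_ge0// cmod_ge0.
by rewrite pmulr_lge0.
Qed.

Lemma bnd_Bh M (h : {posnum R}) (w : weight R d) K f :
  bnd M h%:num (fun x => (w x)%:num) K f ->
  lcs_dom (Bh M h w) f /\ forall q, lcs_seminorms (Bh M h w) q -> q f <= K.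
Proof.
move=> fK; have K0 : 0 <= K by apply: bnd_ge0 fK => x.
have [sf H] := fK.
have [|dom le] := @sup_norm_lub fct (@smooth R d) (multi_index d * Rd)
    (fun ax => (h%:num ^+ morder ax.1 * (w ax.2)%:num /
                (M (morder ax.1))%:num)%:nng)
    (fun ax f => mderiv ax.1 f ax.2) f K sf K0.
  move=> [a x] /=; have := H (flatten [seq nseq (a i) i | i <- enum 'I_d]) x.
  by rewrite size_index_seq [X in _ -> X <= _]mulrAC ler_pdivrMr.
by split=> // q ->.
Qed.

Lemma Bh_bnd M (h : {posnum R}) (w : weight R d) q f :
  lcs_seminorms (Bh M h w) q -> lcs_dom (Bh M h w) f ->
  bnd M h%:num (fun x => (w x)%:num) (q f) f.
Proof.
move=> -> df; have [sf _] := df; split=> // s x.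
have := sup_norm_ub (seq_index s, x) df; rewrite /= morder_seq -mderiv_seq//.
by rewrite [X in X <= _]mulrAC ler_pdivrMr.
Qed.

Lemma Bh_domP M (h : {posnum R}) (w : weight R d) f :
  lcs_dom (Bh M h w) f <-> exists K, bnd M h%:num (fun x => (w x)%:num) K f.
Proof.
split=> [df|[K /bnd_Bh[]//]].
eexists; apply: (@Bh_bnd M h w) df; reflexivity.
Qed.

Lemma bnd_mono M h h' w w' K K' f : bnd M h w K f -> 0 <= h' <= h ->
  (forall x, 0 <= w' x) -> (forall x, w' x <= w x) -> K <= K' -> bnd M h' w' K' f.
Proof.
move=> [sf H] /andP[h0 hh] w0 ww KK; split=> // s x.
apply: le_trans (le_trans (H s x) _); last by rewrite ler_wpM2r.
apply: ler_wpM2r; first exact: cmod_ge0.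
by apply: ler_pM => //; rewrite ?exprn_ge0// lerXn2r// nnegrE (le_trans h0).
Qed.

Lemma bnd_scale M h w K f (a : R[i]) : (forall x, 0 <= w x) -> 0 <= h ->
  bnd M h w K f -> bnd M h w (cmod a * K) (fun x => a * f x).
Proof.
move=> w0 h0 [sf H].
have saf := subspaceZ (@smooth_subspace R d) a sf.
split=> [//|s x].
have -> : pderivs s (fun y => a * f y) = a *: pderivs s f.
  have := pderivs_comb s a sf (smooth_subspace R d).1.
  have -> : pderivs s 0 = 0 :> fct.
    by have := pderivs_comb s (-1) (smooth_subspace R d).1 (smooth_subspace R d).1; rewrite scaler0 addr0 scaleN1r addNr.
  by rewrite !addr0 => <-.
rewrite -[(a *: _) x]/(a * pderivs s f x) cmodM mulrCA -mulrA.
by rewrite ler_wpM2l// cmod_ge0.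
Qed.

Lemma bnd_comb M h w K K' f g (a : R[i]) : (forall x, 0 <= w x) -> 0 <= h ->
  bnd M h w K f -> bnd M h w K' g ->
  bnd M h w (cmod a * K + K') (fun x => a * f x + g x).
Proof.
move=> w0 h0 [sf Hf] [sg Hg].
split=> [|s x]; first exact: (@smooth_subspace R d).2.
rewrite [pderivs s _](pderivs_comb s a sf sg).
rewrite -[(a *: _ + _) x]/(a * pderivs s f x + pderivs s g x) mulrDl.
apply: (@le_trans _ _ (h ^+ size s * w x *
   (cmod a * cmod (pderivs s f x) + cmod (pderivs s g x)))).
  rewrite ler_wpM2l ?mulr_ge0 ?exprn_ge0// (le_trans (cmodD _ _))//.
  by rewrite cmodM.
by rewrite mulrDr lerD// mulrCA -[leRHS]mulrA ler_wpM2l// cmod_ge0.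
Qed.

Lemma bndB M h w K K' f g : (forall x, 0 <= w x) -> 0 <= h ->
  bnd M h w K f -> bnd M h w K' g -> bnd M h w (K + K') (fun x => f x - g x).
Proof.
move=> w0 h0 fK gK'; have := bnd_comb (-1) w0 h0 gK' fK.
rewrite cmodN cmod1 mul1r addrC.
by congr (bnd _ _ _ _ _); apply/funext => x; rewrite mulN1r addrC.
Qed.

End Bounds.

(** * Projective and inductive limits over the parameter h *)

Section ClassQuantifiers.
Context (R : realType).
Implicit Types (c : ultra_class) (P Q : {posnum R} -> Prop).

(** Membership in, and boundedness in, a space of class c is tested for all h
    in the Beurling case and for some h in the Roumieu case; continuity of
    seminorms and functionals on it obeys the opposite quantifier. *)
Definition qspace c P := match c with
  | Beurling => forall h, P h | Roumieu => exists h, P h end.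
Definition qdual c P := match c with
  | Beurling => exists h, P h | Roumieu => forall h, P h end.

Lemma qspace_qdual c P Q : qspace c P -> qdual c Q -> exists h, P h /\ Q h.
Proof. by case: c => /= [H [h Qh]|[h Ph] H]; exists h; split. Qed.

Lemma qspace_impl c P Q : (forall h, P h -> Q h) -> qspace c P -> qspace c Q.
Proof. by move=> PQ; case: c => /= [H h|[h /PQ]]; [exact/PQ|exists h]. Qed.

Lemma qdual_impl c P Q : (forall h, P h -> Q h) -> qdual c P -> qdual c Q.
Proof. by move=> PQ; case: c => /= [[h /PQ]|H h]; [exists h|exact/PQ]. Qed.

Lemma qdual_and c P Q :
  (forall h h' : {posnum R}, h%:num <= h'%:num -> P h -> P h') ->
  (forall h h' : {posnum R}, h%:num <= h'%:num -> Q h -> Q h') ->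
  qdual c P -> qdual c Q -> qdual c (fun h => P h /\ Q h).
Proof.
move=> mP mQ; case: c => /= [[h Ph] [h' Qh']|HP HQ h]; last by split.
exists (Num.max h%:num h'%:num)%:pos; split.
  by apply: mP Ph; rewrite /= le_max lexx.
by apply: mQ Qh'; rewrite /= le_max lexx orbT.
Qed.

End ClassQuantifiers.

Section ClassLimits.
Context (R : realType) (X : lmodType R[i]) (c : ultra_class).
Variables (E : {posnum R} -> lcs X) (dirE : directed_lcs E).
Variable G : {posnum R} -> R -> X -> Prop.
Hypothesis G_mono : forall (h h' : {posnum R}) K x, h%:num <= h'%:num ->
  G h' K x -> G h K x.

(** The common shape of the spaces of test functions: E h is the step with
    parameter h, and G h K x stands for the bound K on the norm of x in it. *)
Definition clim : lcs X := match c with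
  | Beurling => proj_lim E | Roumieu => ind_lim dirE end.

Lemma clim_domP x : lcs_dom clim x <-> qspace c (fun h => lcs_dom (E h) x).
Proof.
rewrite /clim; case: (c) => /=; first by split=> H h; [exact: H|move=> _; exact: H].
by split=> [[h _ H]|[h H]]; exists h.
Qed.

Definition dominated D (q : X -> R) h :=
  exists2 C : R, 0 <= C & forall x K, D x -> G h K x -> q x <= C * K.

Lemma dominated_mono D q h h' : h%:num <= h'%:num ->
  dominated D q h -> dominated D q h'.
Proof.
move=> hh [C C0 H]; exists C => // x K Dx Gx; apply: H => //.
exact: G_mono Gx.
Qed.

Lemma dominated_sum D (s : seq (X -> R)) :
  (forall q, q \in s -> qdual c (dominated D q)) ->
  qdual c (dominated D (fun x => \sum_(q <- s) q x)).
Proof.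
elim: s => [|q s IH] H.
  have d0 h : dominated D (fun x => \sum_(q <- [::]) q x) h.
    by exists 0 => // x K _ _; rewrite big_nil mul0r.
  by case: (c) => /=; [exists 1%:pos; exact: d0|move=> h; exact: d0].
have h1 := H q (mem_head _ _).
have h2 : qdual c (dominated D (fun x => \sum_(q <- s) q x)).
  by apply: IH => p ps; apply: H; rewrite inE ps orbT.
have := qdual_and (@dominated_mono _ _) (@dominated_mono _ _) h1 h2.
apply: qdual_impl => h [[C C0 HC] [C' C'0 HC']].
exists (C + C') => [|x K Dx Gx]; first exact: addr_ge0.
by rewrite big_cons mulrDl lerD//; [exact: HC|exact: HC'].
Qed.

Hypothesis GE : forall h q, lcs_seminorms (E h) q -> dominated (lcs_dom (E h)) q h.
Hypothesis GD : forall h K x, G h K x -> lcs_dom (E h) x.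

Lemma dominatedZ D q r h (C : R) : 0 <= C -> dominated D q h ->
  (forall x, D x -> r x <= C * q x) -> dominated D r h.
Proof.
move=> C0 [C' C'0 H] rq; exists (C * C') => [|x K Dx Gx]; first exact: mulr_ge0.
by rewrite (le_trans (rq _ Dx))// -mulrA ler_wpM2l//; exact: H.
Qed.

Lemma step_dominated h q : seminorm_on (lcs_dom (E h)) q ->
  continuous (fun x : lcs_type (E h) => q (lcs_val x)) ->
  dominated (lcs_dom (E h)) q h.
Proof.
move=> qs qc; have [s [C [C0 Es sC]]] := lcs_seminorm_bound qs qc.
apply: (dominatedZ C0 _ sC).
elim: s Es {sC} => [|p s IH] Es.
  by exists 0 => // x K _ _; rewrite big_nil mul0r.
have [C1 C10 H1] := GE (Es p (mem_head _ _)).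
have [|C2 C20 H2] := IH; first by move=> r rs; apply: Es; rewrite inE rs orbT.
exists (C1 + C2) => [|x K Dx Gx]; first exact: addr_ge0.
by rewrite big_cons mulrDl lerD//; [exact: H1|exact: H2].
Qed.

(** In the Beurling case a defining seminorm comes from one step; in the Roumieu
    case it is continuous on each step, hence dominated on each step. *)
Lemma clim_seminorm_dominated q : lcs_seminorms clim q ->
  qdual c (dominated (lcs_dom clim) q).
Proof.
rewrite /clim; case: (c) => /=.
  move=> [h _ qh]; exists h; have [C C0 H] := GE qh.
  by exists C => // x K Dx; apply: H; exact: Dx.
move=> [qs qc] h.
have qsh : seminorm_on (lcs_dom (E h)) q.
  by split=> [x y Ex Ey|a x Ex]; apply qs; exists h.
have [C C0 H] := step_dominated qsh (qc h).
by exists C => // x K _ Gx; apply: H => //; exact: GD Gx.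
Qed.

Lemma clim_dominated q : seminorm_on (lcs_dom clim) q ->
  continuous (fun x : lcs_type clim => q (lcs_val x)) ->
  qdual c (dominated (lcs_dom clim) q).
Proof.
move=> qs qc; have [s [C [C0 Es sC]]] := lcs_seminorm_bound qs qc.
have := dominated_sum (fun q qs => clim_seminorm_dominated (Es q qs)).
by apply: qdual_impl => h /(dominatedZ C0); apply; exact: sC.
Qed.

Lemma clim_bounded (B : set (lcs_type clim)) :
  qspace c (fun h => exists K, forall x, B x -> G h K (lcs_val x)) ->
  tvs_bounded B.
Proof.
move=> HB; apply/lcs_boundedP => q /clim_seminorm_dominated qd.
have [h [[K HK] [C C0 H]]] := qspace_qdual HB qd.
by exists (C * K) => x Bx; apply: H; [exact: lcs_dom_val|exact: HK].
Qed.

End ClassLimits.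

Section Spaces.
Context (R : realType) (d : nat).
Local Notation Rd := 'rV[R]_d.
Local Notation fct := ('rV[R]_d -> R[i]^o).
Local Notation wt w := (fun x => (w x)%:num).
Implicit Types (f : fct) (h : {posnum R}) (M : nat -> {posnum R}).
Implicit Types (V : decreasing_weight_system R d) (A : weight_sequence R).

Definition Gw M (w : weight R d) h K f := bnd M h%:num (wt w) K f.
Definition Gs M A h K f := Gw M (gs_weight A h) h K f.

Lemma Gw_mono M w (h h' : {posnum R}) K f : h%:num <= h'%:num ->
  Gw M w h' K f -> Gw M w h K f.
Proof. by move=> hh /bnd_mono; apply; rewrite ?hh ?andbT// => x. Qed.

Lemma Gs_mono M A (h h' : {posnum R}) K f : h%:num <= h'%:num ->
  Gs M A h' K f -> Gs M A h K f.
Proof.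
move=> hh H; have h0 : 0 <= h%:num <= h'%:num by rewrite hh andbT.
have w0 (x : Rd) : 0 <= (gs_weight A h x)%:num by exact: ltW (gt0 _).
exact (bnd_mono H h0 w0 (fun x => gs_weight_mono A x hh) (lexx K)).
Qed.

Lemma Bh_dominated M w h q : lcs_seminorms (@Bh R d M h w) q ->
  dominated (Gw M w) (lcs_dom (Bh M h w)) q h.
Proof. by move=> Eq; exists 1 => // f K _ /bnd_Bh[_ /(_ _ Eq)]; rewrite mul1r. Qed.

Lemma Gw_dom M w h K f : Gw M w h K f -> lcs_dom (Bh M h w) f.
Proof. by case/bnd_Bh. Qed.

Lemma Bw_domP c M (w : weight R d) f :
  lcs_dom (Bw c M w) f <-> qspace c (fun h => exists K, Gw M w h K f).
Proof.
have := @clim_domP R fct c _ (directed_Bh M w) f.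
rewrite -/(Bw c M w) => ->.
by split; apply: qspace_impl => h /Bh_domP.
Qed.

Lemma GS_domP c (M A : weight_sequence R) f :
  lcs_dom (GS d c M A) f <-> qspace c (fun h => exists K, Gs M A h K f).
Proof.
have := @clim_domP R fct c _ (directed_GS d M A) f.
rewrite -/(GS d c M A) => ->.
by split; apply: qspace_impl => h /Bh_domP.
Qed.

Lemma BV_domP c M V f : lcs_dom (BV c M V) f <->
  exists n, qspace c (fun h => exists K, Gw M (V n) h K f).
Proof.
split=> [[n _ /Bw_domP]|[n /Bw_domP]]; first by exists n.
by exists n.
Qed.

Lemma Bw_seminorm_dominated c M (w : weight R d) q :
  seminorm_on (lcs_dom (Bw c M w)) q ->
  continuous (fun x : lcs_type (Bw c M w) => q (lcs_val x)) ->
  qdual c (dominated (Gw M w) (lcs_dom (Bw c M w)) q).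
Proof.
apply: (@clim_dominated R fct c _ (directed_Bh M w)).
- exact: Gw_mono.
- exact: Bh_dominated.
- exact: Gw_dom.
Qed.

End Spaces.

(** * Functionals and convolution operators *)

Section Pairing.
Context (R : realType) (d : nat).
Local Notation Rd := 'rV[R]_d.
Local Notation fct := ('rV[R]_d -> R[i]^o).
Implicit Types (E S F : lcs fct).

Lemma dualP E (f : dual E) : linear (val f) /\ continuous (val f).
Proof. exact: (asboolW (valP f)). Qed.

Lemma pairingE E (f : dual E) phi (Ephi : lcs_dom E phi) :
  pairing f phi = val f (lcs_elt Ephi).
Proof.
rewrite /pairing insubT; first exact: lcs_dom_in.
by move=> p; congr (val f _); exact: val_inj.
Qed.

Lemma pairing_lin E (f : dual E) (a : R[i]) phi psi :
  lcs_dom E phi -> lcs_dom E psi ->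
  pairing f (a *: phi + psi) = a * pairing f phi + pairing f psi.
Proof.
move=> Ephi Epsi; have Ec : lcs_dom E (a *: phi + psi) by exact: (lcs_domP E).2.
rewrite (pairingE f Ec) (pairingE f Ephi) (pairingE f Epsi).
have [fl _] := dualP f; rewrite -[RHS]fl; congr (val f _).
exact: val_inj.
Qed.

Lemma pairing0 E (f : dual E) : pairing f 0 = 0.
Proof.
have E0 := (lcs_domP E).1.
have := pairing_lin f (-1) E0 E0.
by rewrite scaler0 addr0 mulN1r addNr.
Qed.

Lemma pairingZ E (f : dual E) (a : R[i]) phi : lcs_dom E phi ->
  pairing f (a *: phi) = a * pairing f phi.
Proof.
move=> Ephi; have := pairing_lin f a Ephi (lcs_domP E).1.
by rewrite addr0 pairing0 addr0.
Qed.

Lemma pairingB E (f : dual E) phi psi : lcs_dom E phi -> lcs_dom E psi ->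
  pairing f (phi - psi) = pairing f phi - pairing f psi.
Proof.
move=> Ephi Epsi; have := pairing_lin f (-1) Epsi Ephi.
by rewrite scaleN1r mulN1r addrC => ->; rewrite addrC.
Qed.

Lemma pairing_sum E (f : dual E) (I : Type) (r : seq I) (phi : I -> fct) :
  (forall k, lcs_dom E (phi k)) ->
  lcs_dom E (\sum_(k <- r) phi k) /\
  pairing f (\sum_(k <- r) phi k) = \sum_(k <- r) pairing f (phi k).
Proof.
move=> Ek; elim: r => [|k r [IH1 IH2]].
  by rewrite !big_nil pairing0; split=> //; exact: (lcs_domP E).1.
rewrite !big_cons; split.
  by have := (lcs_domP E).2 1 _ _ (Ek k) IH1; rewrite scale1r.
by rewrite -IH2 -{1}[phi k]scale1r pairing_lin// mul1r.
Qed.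

(** Continuity of f as an inequality on the steps of B^*_{v_n}; the quantifier on h
    is the one for seminorms. *)
Lemma dual_dominated c (M : nat -> {posnum R}) (V : decreasing_weight_system R d)
    (f : dual (BV c M V)) n :
  qdual c (dominated (Gw M (V n)) (lcs_dom (Bw c M (V n)))
    (fun phi : fct => cmod (pairing f phi))).
Proof.
have [fl fc] := dualP f.
have fZ a x : cmod (val f (a *: x)) = cmod a * cmod (val f x).
  by rewrite -cmodM; congr cmod; have := fl a x 0; rewrite !addr0 => ->;
    have := fl (-1) 0 0; rewrite scaler0 addr0 scaleN1r addNr => ->; rewrite addr0.
have f0 : val f 0 = 0 by have := fl (-1) 0 0; rewrite scaler0 addr0 scaleN1r addNr.
have [|s [C [C0 Es sC]]] := lcs_bound fZ.
  have /(@cvgrPdist_lt R[i] R[i]^o _ (nbhs (0 : lcs_type (BV c M V)))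
    (nbhs_filter (0 : lcs_type (BV c M V)))) h := fc 0.
  have := h 1 ltr01; apply: filterS => x.
  by rewrite f0 sub0r normrN cmodE -[1]/(1%:C) ltcR.
have sub (x : fct) : lcs_dom (Bw c M (V n)) x -> lcs_dom (BV c M V) x by move=> ?; exists n.
have H q : q \in s -> qdual c (dominated (Gw M (V n)) (lcs_dom (Bw c M (V n))) q).
  move=> /Es[qs qc]; apply: Bw_seminorm_dominated (qc n).
  by split=> [x y Ex Ey|a x Ex]; apply qs; exact: sub.
have := dominated_sum (@Gw_mono _ _ _ _) H.
apply: qdual_impl => h /(dominatedZ C0); apply => x Ex.
by rewrite (pairingE f (sub _ Ex)); exact: sC.
Qed.

(** The default values in the definition of [conv_map] are not taken as soon as
    f * psi belongs to F and its seminorms are dominated by those of psi. *)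
Lemma conv_mapE E S F (f : dual E) :
  (forall psi, lcs_dom S psi -> lcs_dom F (Defs.conv f psi)) ->
  (forall psi, lcs_dom S psi -> forall x, lcs_dom E (fun t => psi (x - t))) ->
  (forall q, lcs_seminorms F q -> exists s (C : R), [/\ 0 <= C,
    forall p, p \in s -> lcs_seminorms S p &
    forall psi : lcs_type S,
      q (Defs.conv f (lcs_val psi)) <= C * \sum_(p <- s) p (lcs_val psi)]) ->
  forall psi : lcs_type S, lcs_val (val (conv_map S F f) psi) = Defs.conv f (lcs_val psi).
Proof.
move=> SF SE Fq.
pose T (psi : lcs_type S) : lcs_type F := lcs_elt (SF _ (lcs_dom_val psi)).
have TE : (fun phi : lcs_type S => insubd (0 : lcs_type F) (Defs.conv f (lcs_val phi))) = T.
  apply/funext => psi; apply: val_inj; rewrite /= insubdK//.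
  exact: lcs_dom_in (SF _ (lcs_dom_val psi)).
have Tl : linear T.
  move=> a u v; apply: val_inj; apply/funext => x.
  have h := pairing_lin f a (SE _ (lcs_dom_val u) x) (SE _ (lcs_dom_val v) x).
  exact: h.
have Tc : continuous T by apply: lcs_linear_continuous Tl _ => q /Fq.
by move=> psi; rewrite /conv_map TE /= insubdK//; apply/asboolP; split.
Qed.

End Pairing.

(** * The exponential of the associated function *)

Section AssociatedFunction.
Context (R : realType) (A : weight_sequence R).
Local Notation a p := ((A p)%:num).

(** The constant is opaque: comparing two of its values must not unfold the
    exponential. *)
Fact eA_spec : {e : R -> R | forall t, e t = expR (assoc_fun A t)}.
Proof. by exists (fun t => expR (assoc_fun A t)). Qed.

Definition eA : R -> R := sval eA_spec.

Lemma eAE t : eA t = expR (assoc_fun A t).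
Proof. exact: (svalP eA_spec). Qed.

Lemma eA_ge t p : 0 <= t -> t ^+ p * a 0 / a p <= eA t.
Proof.
rewrite le_eqVlt => /orP[/eqP <-|t0].
  rewrite eAE /assoc_fun ltxx expR0; case: p => [|p].
    by rewrite expr0 mul1r divff.
  by rewrite exprS !mul0r.
rewrite eAE /assoc_fun t0.
have p0 : 0 < t ^+ p * a 0 / a p by rewrite divr_gt0// mulr_gt0// exprn_gt0.
rewrite -[leLHS]lnK ?posrE// ler_expR.
by apply: ub_le_sup; [exact: (assoc_fun_has_sup A t0).2|exists p].
Qed.

Lemma eA_le t B : 0 <= t -> (forall p, t ^+ p * a 0 / a p <= B) -> eA t <= B.
Proof.
move=> t0 H.
have B1 : 1 <= B by have := H 0%N; rewrite expr0 mul1r divff.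
have B0 : 0 < B by exact: lt_le_trans B1.
move: t0; rewrite le_eqVlt => /orP[/eqP t0|t0].
  by rewrite eAE /assoc_fun -t0 ltxx expR0.
rewrite eAE /assoc_fun t0 -[leRHS]lnK ?posrE// ler_expR.
apply: ge_sup; first by have [] := assoc_fun_has_sup A t0.
by move=> _ [p _ <-]; rewrite ler_ln ?posrE ?H// divr_gt0// mulr_gt0// exprn_gt0.
Qed.

Lemma eA_mono s t : s <= t -> eA s <= eA t.
Proof. by move=> st; rewrite !eAE ler_expR; exact: assoc_fun_mono. Qed.

Lemma eA_gt0 t : 0 < eA t.
Proof. by rewrite eAE expR_gt0. Qed.

Lemma eA0 : eA 0 = 1.
Proof. by rewrite eAE /assoc_fun ltxx expR0. Qed.

Lemma eA_ge1 t : 0 <= t -> 1 <= eA t.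
Proof. by move=> t0; rewrite -eA0 eA_mono. Qed.

Lemma eA_add s t : 0 <= s -> 0 <= t -> eA (s + t) <= eA (2 * s) * eA (2 * t).
Proof.
move=> s0 t0.
have [st|/ltW ts] := leP s t.
  rewrite -[leLHS]mul1r ler_pM ?ler01// ?(ltW (eA_gt0 _)) ?eA_ge1 ?mulr_ge0//.
  by apply: eA_mono; lra.
rewrite mulrC -[leLHS]mul1r ler_pM ?ler01// ?(ltW (eA_gt0 _)) ?eA_ge1 ?mulr_ge0//.
by apply: eA_mono; lra.
Qed.

(** The term of index 2 of the supremum. *)
Lemma eA_quad : exists2 C : R, 0 < C & forall t, 0 <= t -> 1 + t ^+ 2 <= C * eA t.
Proof.
exists (1 + a 2 / a 0) => [|t t0]; first by rewrite addr_gt0// divr_gt0.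
rewrite mulrDl mul1r lerD//; first exact: eA_ge1.
have := eA_ge 2 t0; rewrite ler_pdivrMr// => h.
by rewrite mulrAC ler_pdivlMr// [a 2 * _]mulrC.
Qed.

(** (M.2) lets the square of an exponential weight be absorbed by a dilation. *)
Lemma eA_sq : cond_M2 A -> exists C H : R, [/\ 0 < C, 1 <= H &
  forall t, 0 <= t -> eA t * eA t <= C * eA (H * t)].
Proof.
move=> [C0 [H [C01 H1 HA]]]; exists (C0 * a 0), H; split=> //.
  by rewrite mulr_gt0// (lt_le_trans ltr01).
move=> t t0.
have H0 : 0 <= H by exact: le_trans H1.
set B := _ * eA (H * t).
have B0 : 0 <= B by rewrite !mulr_ge0// ?(ltW (eA_gt0 _))// (le_trans ler01).
suff h : eA t <= Num.sqrt B.
  by rewrite -(sqr_sqrtr B0) expr2 ler_pM// ltW// eA_gt0.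
apply: eA_le => // p.
have x0 : 0 <= t ^+ p * a 0 / a p by rewrite divr_ge0// mulr_ge0// exprn_ge0.
rewrite -[leLHS]ger0_norm// -sqrtr_sqr ler_wsqrtr//.
have h := eA_ge (p + p) (mulr_ge0 H0 t0).
have C00 : 0 <= C0 * a 0 by rewrite mulr_ge0// (le_trans ler01).
apply: le_trans (ler_wpM2l C00 h).
have k := HA p p.
rewrite [(H * t) ^+ _]exprMn expr2.
have ap0 : 0 < a p by [].
have app0 : 0 < a (p + p)%N by [].
rewrite [leRHS]mulrA ler_pdivlMr//.
have -> : t ^+ p * a 0 / a p * (t ^+ p * a 0 / a p) * a (p + p)%N =
    (t ^+ p * t ^+ p * a 0 ^+ 2) * a (p + p)%N / (a p * a p).
  by field; rewrite gt_eqF.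
rewrite ler_pdivrMr ?mulr_gt0//.
have -> : C0 * a 0 * (H ^+ (p + p) * t ^+ (p + p) * a 0) * (a p * a p) =
   (t ^+ p * t ^+ p * a 0 ^+ 2) * (C0 * H ^+ (p + p) * a p * a p).
  by rewrite [t ^+ (p + p)]exprD; ring.
by rewrite ler_wpM2l// !mulr_ge0// exprn_ge0.
Qed.

End AssociatedFunction.

(** * Two estimates for translates and localised pieces *)

Section KeyEstimates.
Context (R : realType) (d : nat).
Local Notation Rd := 'rV[R]_d.
Local Notation fct := ('rV[R]_d -> R[i]^o).
Implicit Types (f g psi phi chi : fct) (x y t : Rd) (s : seq 'I_d).
Implicit Types (M : nat -> {posnum R}) (A : weight_sequence R).

Lemma enorm_ge0 x : 0 <= enorm x.
Proof. exact: sqrtr_ge0. Qed.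

Lemma enormN x : enorm (- x) = enorm x.
Proof. by rewrite /enorm; congr Num.sqrt; apply: eq_bigr => i _; rewrite mxE sqrrN. Qed.

Lemma enormZ (a : R) x : 0 <= a -> enorm (a *: x) = a * enorm x.
Proof.
move=> a0; rewrite /enorm -[X in X * _]ger0_norm// -sqrtr_sqr -sqrtrM ?sqr_ge0//.
by rewrite mulr_sumr; congr Num.sqrt; apply: eq_bigr => i _; rewrite mxE exprMn.
Qed.

Lemma coord_enorm x i : `|x 0 i| <= enorm x.
Proof.
rewrite -sqrtr_sqr ler_wsqrtr// (bigD1 i)//= lerDl.
by apply: sumr_ge0 => k _; exact: sqr_ge0.
Qed.

Lemma gs_weightE A (h : {posnum R}) x :
  (gs_weight A h x)%:num = eA A (h%:num * enorm x).
Proof. by rewrite /= eAE enormZ. Qed.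

Definition gsw A (h : {posnum R}) x : R := eA A (h%:num * enorm x).

Lemma gsw_gt0 A h x : 0 < gsw A h x.
Proof. exact: eA_gt0. Qed.

Lemma gsw_ge0 A h x : 0 <= gsw A h x.
Proof. exact: ltW (eA_gt0 _ _). Qed.

Lemma GsE M A h K f : Gs M A h K f = bnd M h%:num (gsw A h) K f.
Proof.
rewrite /Gs /Gw; congr (bnd _ _ _ _ _).
by apply/funext => x; exact: gs_weightE.
Qed.

(** The inequality of admissibility, for one pair of weights. *)
Definition adm A (C : R) (lambda : {posnum R}) (v w : Rd -> R) :=
  forall x t, v (x + t) <= C * w x * gsw A lambda t.

Lemma continuous_refl f x : continuous f -> continuous (fun t => f (x - t)).
Proof.
move=> cf t; apply: (@continuous_comp _ _ _ (fun t => x - t) f); last exact: cf.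
by apply: (@cvgB R Rd Rd (nbhs (t : Rd)) (nbhs_filter (t : Rd)) (cst x) id x t); [exact: cvg_cst|exact: cvg_id].
Qed.

Lemma smooth_refl psi x : smooth psi ->
  smooth (fun t => psi (x - t)) /\ forall s, pderivs s (fun t => psi (x - t)) =
    (fun t => (-1) ^+ size s * pderivs s psi (x - t)).
Proof.
move=> spsi.
pose F s : fct := fun t => (-1) ^+ size s * pderivs s psi (x - t).
have F0 : F [::] = (fun t => psi (x - t)).
  by apply/funext => t; rewrite /F /= expr0 mul1r.
rewrite -F0; apply: smooth_jet => [s|s i t].
  apply: continuous_cmul; first exact: cst_continuous.
  by apply: continuous_refl; exact: smooth_continuous.
apply: is_pd_eq.
  apply: (is_pdZ ((-1) ^+ size s)).
  by apply: is_pd_refl; exact: smooth_pd.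
by rewrite /F /= exprS mulN1r mulrN mulNr.
Qed.

Lemma cmod_sign n (z : R[i]) : cmod ((-1) ^+ n * z) = cmod z.
Proof.
elim: n => [|n IH]; first by rewrite expr0 mul1r.
by rewrite exprS mulN1r mulNr cmodN.
Qed.

(** (M.2) splits M_(|a|+|b|) for the derivatives of psi^(a), while admissibility
    turns the weight v at t into w at x times the exponential weight of x - t,
    which psi absorbs. *)
Lemma bnd_refl_deriv M A (psi : fct) (k H C C0 K : R) (lambda kk : {posnum R}) (v w : Rd -> R) :
  k = kk%:num -> 0 < C -> 1 <= C0 -> 1 <= H ->
  (forall p q, (M (p + q)%N)%:num <= C0 * H ^+ (p + q) * (M p)%:num * (M q)%:num) ->
  (forall x, 0 < v x) -> (forall x, 0 < w x) ->
  adm A C lambda v w -> lambda%:num <= k ->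
  bnd M kk%:num (gsw A kk) K psi -> forall s x,
  bnd M (k / H) v (C * C0 * K * w x * ((M (size s))%:num * (H / k) ^+ size s))
    (fun t => pderivs s psi (x - t)).
Proof.
move=> ke C_gt0 C01 H1 HM v0 w0 ad lk [spsi Hpsi] s x.
have k0 : 0 < k by rewrite ke.
have H0 : 0 < H by exact: lt_le_trans H1.
have C00 : 0 < C0 by exact: lt_le_trans C01.
have [sr rE] := smooth_refl x (smooth_pderivs s spsi).
split=> // s' t; rewrite rE cmod_sign -pderivs_cat.
have := Hpsi (s' ++ s) (x - t); rewrite -ke; set D := cmod _.
have D0 : 0 <= D by exact: cmod_ge0.
set g := gsw A kk (x - t) => HD.
have g0 : 0 < g by exact: gsw_gt0.
have vt : v t <= C * w x * g.
  have gl : gsw A lambda (t - x) <= g.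
    rewrite /g /gsw -opprB enormN; apply: eA_mono.
    by rewrite -ke ler_wpM2r ?enorm_ge0.
  have := ad x (t - x); move: gl; set b := gsw A lambda _ => gl.
  rewrite addrC subrK => /le_trans; apply.
  by rewrite ler_wpM2l ?mulr_ge0 ?(ltW C_gt0) ?(ltW (w0 _)).
rewrite size_cat in HD.
have kk0 : 0 < k ^+ (size s' + size s) by rewrite exprn_gt0.
have HH0 : 0 < H ^+ size s' by rewrite exprn_gt0.
have ks0 : 0 < k ^+ size s by rewrite exprn_gt0.
have K0 : 0 <= K.
  have : 0 <= K * (M (size s' + size s))%:num.
    by apply: le_trans HD; rewrite !mulr_ge0// ltW.
  by rewrite pmulr_lge0.
apply: (@le_trans _ _ ((k / H) ^+ size s' * (C * w x * g) * D)).
  rewrite ler_wpM2r// ler_wpM2l// exprn_ge0// divr_ge0// ltW//.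
have -> : (k / H) ^+ size s' * (C * w x * g) * D =
    C * w x / k ^+ size s / H ^+ size s' * (k ^+ (size s' + size s) * g * D).
  by rewrite expr_div_n exprD; field; rewrite !gt_eqF.
apply: (@le_trans _ _ (C * w x / k ^+ size s / H ^+ size s' *
   (K * (C0 * H ^+ (size s' + size s) * (M (size s'))%:num * (M (size s))%:num)))).
  rewrite ler_wpM2l ?mulr_ge0 ?invr_ge0 ?(ltW C_gt0) ?(ltW (w0 _)) ?(ltW ks0) ?(ltW HH0)//.
  by rewrite (le_trans HD)// ler_wpM2l.
rewrite le_eqVlt; apply/orP; left; apply/eqP.
by rewrite expr_div_n exprD; field; rewrite !gt_eqF.
Qed.

(** Around y the function phi is of size 1/v, which admissibility bounds by
    1/w(y) up to an exponential weight; chi absorbs this weight and the one in the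
    conclusion, and the Leibniz rule halves h. *)
Lemma bnd_localise M A (phi chi : fct) (C C' K K' : R) (lambda h h' k : {posnum R})
    (v w : Rd -> R) :
  cond_M1 M -> 0 < C -> 0 < C' -> (forall x, 0 < v x) -> (forall x, 0 < w x) ->
  adm A C lambda w v ->
  (forall t, gsw A lambda t * gsw A h' t <=
     C' * gsw A k t) ->
  bnd M h%:num v K phi -> bnd M k%:num (gsw A k) K' chi -> h%:num <= k%:num -> forall y,
  bnd M (h%:num / 2) (gsw A h')
    ((M 0%N)%:num * C * C' * K * K' / w y) (fun t => phi (y - t) * chi t).
Proof.
move=> M1 C0 C'0 v0 w0 ad prodE Hphi [schi Hchi] hk y.
have [sphi Dphi] := Hphi.
have K0 : 0 <= K by apply: bnd_ge0 Hphi => x; exact: ltW.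
have K'0 : 0 <= K'.
  apply: (@bnd_ge0 R d M k%:num (gsw A k) K' chi); last by split.
  by move=> x; exact: ltW (gsw_gt0 _ _ _).
have [sr rE] := smooth_refl y sphi.
have [sp _] := leibniz sr schi.
split=> // s t.
have g0 := gsw_gt0 A k t.
have vy0 := v0 (y - t); have wy0 := w0 y.
have h0 : 0 < h%:num by [].
have a0 : 0 <= K / v (y - t) by rewrite divr_ge0// ltW.
have b0 : 0 <= K' / gsw A k t by apply: divr_ge0 => //; exact: ltW.
have r0 : 0 <= h%:num^-1 by rewrite invr_ge0 ltW.
have := leibniz_bound (x := t) s M1 sr schi a0 b0 r0.
set D := cmod _ => HD.
have {}HD : D <= (M 0%N)%:num * (K / v (y - t)) * (K' / gsw A k t) *
    ((2 / h%:num) ^+ size s * (M (size s))%:num).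
  apply: HD => s'.
    rewrite rE cmod_sign; have := Dphi s' (y - t).
    rewrite mulrAC -ler_pdivlMr// -ler_pdivlMl ?exprn_gt0// => /le_trans; apply.
    rewrite le_eqVlt; apply/orP; left; apply/eqP.
    by rewrite exprVn; field; rewrite !gt_eqF ?exprn_gt0.
  have h1 := Hchi s' t; rewrite mulrAC in h1.
  have h2 : (h%:num ^+ size s' * cmod (pderivs s' chi t)) * gsw A k t <= K' * (M (size s'))%:num.
    apply: le_trans h1; rewrite ler_wpM2r ?(ltW g0)// ler_wpM2r ?cmod_ge0//.
    by rewrite lerXn2r// nnegrE.
  rewrite -ler_pdivlMr// -ler_pdivlMl ?exprn_gt0// in h2.
  apply: le_trans h2 _; rewrite le_eqVlt; apply/orP; left; apply/eqP.
  by rewrite exprVn; field; rewrite !gt_eqF ?exprn_gt0.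
set gh := gsw A h' t; set gk := gsw A k t in g0 HD *.
have gh0 : 0 < gh by exact: gsw_gt0.
have wy : w y * gh <= C * C' * v (y - t) * gk.
  have := ad (y - t) t; rewrite subrK => h1.
  apply: (@le_trans _ _ (C * v (y - t) * gsw A lambda t * gh)).
    by rewrite ler_wpM2r// ltW.
  have -> : C * C' * v (y - t) * gk = C * v (y - t) * (C' * gk) by ring.
  by rewrite -mulrA ler_wpM2l ?mulr_ge0 ?(ltW C0) ?(ltW (v0 _))//; exact: prodE.
apply: le_trans (ler_wpM2l _ HD) _.
  by rewrite mulr_ge0 ?(ltW gh0)// exprn_ge0// divr_ge0.
have -> : (h%:num / 2) ^+ size s * gh * ((M 0%N)%:num * (K / v (y - t)) * (K' / gk) *
    ((2 / h%:num) ^+ size s * (M (size s))%:num)) =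
   (M 0%N)%:num * K * K' * (M (size s))%:num * (gh / (v (y - t) * gk)).
  rewrite !expr_div_n; field.
  by rewrite !gt_eqF ?exprn_gt0.
have -> : (M 0%N)%:num * C * C' * K * K' / w y * (M (size s))%:num =
   (M 0%N)%:num * K * K' * (M (size s))%:num * (C * C' / w y) by ring.
rewrite ler_wpM2l ?mulr_ge0//.
rewrite ler_pdivrMr ?mulr_gt0// mulrAC ler_pdivlMr//.
by rewrite mulrC mulrA.
Qed.

End KeyEstimates.

(** * Regularity of the Roumieu inductive limits *)

Section Regularity.
Context (R : realType) (d : nat).
Local Notation Rd := 'rV[R]_d.
Local Notation fct := ('rV[R]_d -> R[i]^o).
Implicit Types (M : nat -> {posnum R}) (V : decreasing_weight_system R d).

(** For each j there are an element of B, a derivative s_j and a point x_j where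
    the j-th norm exceeds j. The supremum over j of these evaluations, each with
    the coefficient it has in the j-th norm, is a seminorm that is unbounded on B.
    It is continuous on the k-th step: the coefficients decrease with the step, so
    the terms with j >= k are below the k-th norm, and the finitely many others
    are comparable to it. *)
Lemma diagonal_seminorm M (h_ : nat -> {posnum R}) (w_ : nat -> Rd -> R) (B : set fct) :
  (forall i j, (i <= j)%N -> (h_ j)%:num <= (h_ i)%:num) ->
  (forall j x, 0 < w_ j x) ->
  (forall i j x, (i <= j)%N -> w_ j x <= w_ i x) ->
  (forall phi, B phi -> smooth phi) ->
  (forall j, ~ exists K, forall phi, B phi -> bnd M (h_ j)%:num (w_ j) K phi) ->
  exists (D : set fct) (q : fct -> R),
    [/\ Defs.subspace D, seminorm_on D q,
      forall j, exists2 C : R, 0 <= C & forall K phi,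
        bnd M (h_ j)%:num (w_ j) K phi -> D phi /\ q phi <= C * K &
      forall j, exists2 phi, B phi & (D phi -> j%:R < q phi)].
Proof.
move=> hmono wpos wmono Bs NB.
have /choice[pick pickP] : forall j, exists t : fct * (seq 'I_d * Rd), B t.1 /\
    j%:R * (M (size t.2.1))%:num < (h_ j)%:num ^+ size t.2.1 * w_ j t.2.2 *
      cmod (pderivs t.2.1 t.1 t.2.2).
  move=> j; apply: contrapT => H; apply: (NB j); exists j%:R => phi Bphi.
  split=> [|s x]; first exact: Bs.
  by rewrite leNgt; apply/negP => lt; apply: H; exists (phi, (s, x)).
pose s_ j := (pick j).2.1; pose x_ j := (pick j).2.2.
pose cj (k j : nat) : R := (h_ k)%:num ^+ size (s_ j) * w_ k (x_ j) / (M (size (s_ j)))%:num.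
have cj0 k j : 0 < cj k j by rewrite /cj divr_gt0// mulr_gt0// exprn_gt0.
pose cn (j : nat) : {nonneg R} := NngNum (ltW (cj0 j j)).
pose l (j : nat) (f : fct) : R[i] := pderivs (s_ j) f (x_ j).
have lP j (a : R[i]) (f g : fct) : smooth f -> smooth g ->
    l j (a *: f + g) = a * l j f + l j g.
  by move=> sf sg; rewrite /l pderivs_comb.
exists (sup_dom (@smooth R d) cn l), (fine \o sup_norm cn l).
split.
- exact: (sup_domP cn (@smooth_subspace R d) lP).
- exact: (sup_seminormsP (@smooth_subspace R d) lP).
(* the sum compares the finitely many coefficients with index below k *)
- move=> k; pose C : R := 1 + \sum_(i < k) cj i i / cj k i.
  have t0 i : 0 <= cj i i / cj k i by rewrite divr_ge0// ltW.
  have C1 : 1 <= C by rewrite lerDl sumr_ge0.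
  have C0 : 0 <= C by exact: le_trans C1.
  exists C => // K phi Hphi; have [sphi H] := Hphi.
  have K0 : 0 <= K by apply: bnd_ge0 Hphi => x; exact: ltW.
  apply: sup_norm_lub => //; first exact: mulr_ge0.
  move=> j; rewrite -[(cn j)%:num]/(cj j j).
  have Hk : cj k j * cmod (l j phi) <= K.
    by rewrite /cj mulrAC ler_pdivrMr//; exact: H.
  have [kj|jk] := leqP k j.
    have ck : cj j j <= cj k j.
      rewrite /cj ler_pM2r ?invr_gt0// ler_pM ?exprn_ge0 ?(ltW (wpos _ _)) ?wmono//.
      by rewrite lerXn2r ?nnegrE ?hmono.
    rewrite (le_trans (ler_wpM2r (cmod_ge0 _) ck))// (le_trans Hk)//.
    by rewrite ler_peMl.
  have -> : cj j j * cmod (l j phi) = cj j j / cj k j * (cj k j * cmod (l j phi)).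
    by field; rewrite gt_eqF.
  apply: ler_pM => //; first by rewrite mulr_ge0 ?cmod_ge0// ltW.
  rewrite /C (bigD1 (Ordinal jk))//= addrCA lerDl addr_ge0// sumr_ge0//.
- move=> j; have [Bj lt] := pickP j; exists (pick j).1 => // Dj /=.
  apply: lt_le_trans (sup_norm_ub j Dj).
  rewrite -[(cn j)%:num]/(cj j j) /cj mulrAC ltr_pdivlMr//; exact: lt.
Qed.

Definition hinv (j : nat) : {posnum R} := (j.+1%:R^-1 : R)%:pos.

Lemma hinv_mono i j : (i <= j)%N -> (hinv j)%:num <= (hinv i)%:num.
Proof. by move=> ij; rewrite /= lef_pV2 ?posrE// ler_nat ltnS. Qed.

Lemma hinv_small (h : {posnum R}) (n : nat) : exists2 j, (n <= j)%N & (hinv j)%:num <= h%:num.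
Proof.
pose j := Num.truncn (h%:num^-1 : R).
exists (maxn n j); first exact: leq_maxl.
apply: (@le_trans _ _ (hinv j)%:num); first by apply: hinv_mono; exact: leq_maxr.
rewrite /= -[leRHS]invrK lef_pV2 ?posrE// ltW//.
have h0 : 0 <= (h%:num^-1 : R) by rewrite invr_ge0.
by have /andP[] := truncn_itv h0.
Qed.

Lemma Bh_norm_exists M (h : {posnum R}) (w : weight R d) :
  exists q, lcs_seminorms (Bh M h w) q.
Proof. by eexists; reflexivity. Qed.

Lemma Bh_continuous M (h : {posnum R}) (w : weight R d) (D : set fct) q (C : R) :
  seminorm_on D q -> 0 <= C ->
  (forall K phi, Gw M w h K phi -> D phi /\ q phi <= C * K) ->
  continuous (fun x : lcs_type (Bh M h w) => q (lcs_val x)).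
Proof.
move=> qP C0 H; have [p Ep] := Bh_norm_exists M h w.
apply: (@lcs_seminorm_continuous _ _ _ q [:: p] C) => //.
- split=> [x y Dx Dy|a x Dx]; apply qP.
  + exact: (H _ _ (Bh_bnd Ep Dx)).1.
  + exact: (H _ _ (Bh_bnd Ep Dy)).1.
  + exact: (H _ _ (Bh_bnd Ep Dx)).1.
- by move=> r; rewrite inE => /eqP ->.
- by move=> x Dx; rewrite big_seq1; exact: (H _ _ (Bh_bnd Ep Dx)).2.
Qed.

Lemma Gs_smooth M (w : weight R d) h K f : Gw M w h K f -> smooth f.
Proof. by case. Qed.

Lemma GS_Roumieu_regular (M A : weight_sequence R)
    (B : set (lcs_type (GS d Roumieu M A))) : tvs_bounded B ->
  exists h K, forall psi, B psi -> Gs M A h K (lcs_val psi).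
Proof.
move=> bB; apply: contrapT => NB.
have [||||j [K HK]|D [q [Dsub qP qC qB]]] :=
  @diagonal_seminorm M hinv (fun j => gsw A (hinv j)) [set lcs_val x | x in B].
- exact: hinv_mono.
- by move=> j x; exact: gsw_gt0.
- by move=> i j x ij; rewrite /gsw eA_mono// ler_wpM2r ?enorm_ge0// hinv_mono.
- move=> _ [psi _ <-]; have /GS_domP[h [K]] := lcs_dom_val psi.
  exact: Gs_smooth.
- by apply: NB; exists (hinv j), K => psi Bpsi; rewrite GsE; apply: HK; exists psi.
have qC' h : exists2 C : R, 0 <= C & forall K phi,
    Gs M A h K phi -> D phi /\ q phi <= C * K.
  have [j _ jh] := hinv_small h 0; have [C C0 HC] := qC j; exists C => // K phi.
  by move=> /(Gs_mono jh); rewrite GsE; exact: HC.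
have Eq : lcs_seminorms (GS d Roumieu M A) q.
  split=> [|h]; last first.
    by have [C C0 HC] := qC' h; exact: Bh_continuous qP C0 HC.
  have DE x : lcs_dom (GS d Roumieu M A) x -> D x.
    by move=> /GS_domP[h [K Gx]]; have [C _ HC] := qC' h; exact: (HC _ _ Gx).1.
  by split=> [x y Ex Ey|a x Ex]; apply qP; exact: DE.
have [K HK] := (iffLR (lcs_boundedP B)) bB q Eq.
have [_ [psi Bpsi <-] lt] := qB (Num.truncn K).+1.
have Dpsi : D (lcs_val psi).
  have /GS_domP[h [K' Gx]] := lcs_dom_val psi; have [C _ HC] := qC' h.
  exact: (HC _ _ Gx).1.
have := lt_le_trans (lt Dpsi) (HK _ Bpsi).
by rewrite ltNge => /negP; apply; rewrite ltW// truncnS_gt.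
Qed.

Lemma BV_Roumieu_regular M V (B : set (lcs_type (BV Roumieu M V))) : tvs_bounded B ->
  exists n h K, forall phi, B phi -> Gw M (V n) h K (lcs_val phi).
Proof.
move=> bB; apply: contrapT => NB.
have [||||j [K HK]|D [q [Dsub qP qC qB]]] :=
  @diagonal_seminorm M hinv (fun j x => (V j x)%:num) [set lcs_val x | x in B].
- exact: hinv_mono.
- by [].
- by move=> i j x ij; exact: dws_mono.
- by move=> _ [phi _ <-]; have /BV_domP[n [h [K]]] := lcs_dom_val phi; exact: Gs_smooth.
- by apply: NB; exists j, (hinv j), K => phi Bphi; apply: HK; exists phi.
have qC' n h : exists2 C : R, 0 <= C & forall K phi,
    Gw M (V n) h K phi -> D phi /\ q phi <= C * K.
  have [j nj jh] := hinv_small h n; have [C C0 HC] := qC j; exists C => // K phi G.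
  apply: HC; apply: (bnd_mono G) => //; first by rewrite jh andbT.
  by move=> x; exact: dws_mono.
have DE x : lcs_dom (BV Roumieu M V) x -> D x.
  by move=> /BV_domP[n [h [K Gx]]]; have [C _ HC] := qC' n h; exact: (HC _ _ Gx).1.
have Eq : lcs_seminorms (BV Roumieu M V) q.
  split=> [|n]; first by split=> [x y Ex Ey|a x Ex]; apply qP; exact: DE.
  have qn : lcs_seminorms (Bw Roumieu M (V n)) q.
    split=> [|h]; last first.
      by have [C C0 HC] := qC' n h; exact: Bh_continuous qP C0 HC.
    have DEn x : lcs_dom (Bw Roumieu M (V n)) x -> D x by move=> Ex; apply: DE; exists n.
    by split=> [x y Ex Ey|a x Ex]; apply qP; exact: DEn.
  apply: (@lcs_seminorm_continuous _ _ _ q [:: q] 1) => //.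
  - exact: lcs_seminormsP qn.
  - by move=> r; rewrite inE => /eqP ->.
  - by move=> x _; rewrite big_seq1 mul1r.
have [K HK] := (iffLR (lcs_boundedP B)) bB q Eq.
have [_ [phi Bphi <-] lt] := qB (Num.truncn K).+1.
have := lt_le_trans (lt (DE _ (lcs_dom_val phi))) (HK _ Bphi).
by rewrite ltNge => /negP; apply; rewrite ltW// truncnS_gt.
Qed.

Lemma GS_bounded_bnd c (M A : weight_sequence R) (B : set (lcs_type (GS d c M A))) :
  tvs_bounded B ->
  qspace c (fun h => exists K, forall psi, B psi -> Gs M A h K (lcs_val psi)).
Proof.
case: c B => /= B bB; last exact: GS_Roumieu_regular.
move=> h; have [p Ep] := Bh_norm_exists M h (gs_weight A h).
have Eq : lcs_seminorms (GS d Beurling M A) p by exists h.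
have [K HK] := (iffLR (lcs_boundedP B)) bB p Eq.
exists K => psi Bpsi.
have G : Gs M A h (p (lcs_val psi)) (lcs_val psi) := Bh_bnd Ep (lcs_dom_val psi h I).
move: G; rewrite !GsE => G.
apply: (bnd_mono G); last exact: HK.
- by rewrite lexx andbT.
- by move=> x; exact: gsw_ge0.
- by move=> x; exact: lexx.
Qed.

(** In the Roumieu case this is the regularity of B_V, so the strong topology and
    the topology bs coincide; both cases are then treated alike. *)
Lemma BV_setsP c M V (B : set (lcs_type (BV c M V))) : BV_sets B <->
  exists n, qspace c (fun h => exists K, forall phi, B phi -> Gw M (V n) h K (lcs_val phi)).
Proof.
case: c B => B; rewrite /BV_sets; split.
- move=> [n [B' bB' E]]; exists n => h.
  have [p Ep] := Bh_norm_exists M h (V n).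
  have Eq : lcs_seminorms (Bw Beurling M (V n)) p by exists h.
  have [K HK] := (iffLR (lcs_boundedP B')) bB' p Eq.
  exists K => phi Bphi.
  have : [set lcs_val x | x in B'] (lcs_val phi) by rewrite -E; exists phi.
  move=> [u B'u <-]; have G := Bh_bnd Ep (lcs_dom_val u h I).
  by apply: (bnd_mono G) => //; [rewrite lexx andbT|exact: HK].
- move=> [n HB]; exists n.
  exists [set u | exists2 phi, B phi & lcs_val phi = lcs_val u].
    apply: (@clim_bounded R fct Beurling _ (directed_Bh M (V n)) (Gw M (V n))).
    + exact: Bh_dominated.
    + exact: Gw_dom.
    + by move=> h; have [K HK] := HB h; exists K => u [phi Bphi <-]; exact: HK.
  apply/seteqP; split=> [_ [phi Bphi <-]|_ [u [phi Bphi E] <-]]; last by exists phi.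
  have Ephi : lcs_dom (Bw Beurling M (V n)) (lcs_val phi).
    by apply/Bw_domP => h; have [K HK] := HB h; exists K; exact: HK.
  by exists (lcs_elt Ephi) => //; exists phi.
- exact: BV_Roumieu_regular.
- move=> [n [h [K HK]]]; apply/lcs_boundedP => q [qs qc].
  have qsn : seminorm_on (lcs_dom (Bw Roumieu M (V n))) q.
    by split=> [x y Ex Ey|a x Ex]; apply qs; exists n.
  have [C C0 HC] := Bw_seminorm_dominated qsn (qc n) h.
  exists (C * K) => phi Bphi; apply: HC; last exact: HK.
  by apply/Bw_domP; exists h, K; exact: HK.
Qed.

End Regularity.

(** * Taylor remainders in the weighted norms *)

Section Remainder.
Context (R : realType) (d : nat).
Local Notation Rd := 'rV[R]_d.
Local Notation fct := ('rV[R]_d -> R[i]^o).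
Implicit Types (f g psi phi chi : fct) (x y t : Rd) (s : seq 'I_d).
Implicit Types (M : nat -> {posnum R}).
Local Notation e_ i := (delta_mx 0 i : Rd).
Local Notation ReC := (@complex.Re R).
Local Notation ImC := (@complex.Im R).

(** Second-order Taylor remainder, measured in the norms of the spaces: this is
    what makes convolution commute with differentiation. *)
Lemma bnd_remainder M (h : R) (v : Rd -> R) phi i x (tau L : R) :
  0 <= h -> (forall t, 0 <= v t) -> smooth phi -> tau != 0 ->
  (forall sg : R, `|sg| <= `|tau| ->
     bnd M h v L (fun t => pderivs [:: i; i] phi (x + sg *: e_ i - t))) ->
  bnd M h v (2 * (`|tau| * L))
    (tau^-1%:C *: ((fun t => phi (x + tau *: e_ i - t)) - (fun t => phi (x - t)))
      - (fun t => pderiv i phi (x - t)) : fct).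
Proof.
move=> h0 v0 sphi tau0 HL.
have [s1 E1] := smooth_refl (x + tau *: e_ i) sphi.
have [s2 E2] := smooth_refl x sphi.
have [s3 E3] := smooth_refl x (smooth_pderivs [:: i] sphi).
have s12 := subspaceB (@smooth_subspace R d) s1 s2.
have s12Z := subspaceZ (@smooth_subspace R d) (tau^-1%:C) s12.
have s123 := subspaceB (@smooth_subspace R d) s12Z s3.
split=> [|s t]; first exact: s123.
have dB f g : smooth f -> smooth g -> pderivs s (f - g) = pderivs s f - pderivs s g.
  move=> sf sg; have := pderivs_comb s (-1) sg sf; rewrite !scaleN1r addrC => ->.
  by rewrite addrC.
have dZ a f : smooth f -> pderivs s (a *: f) = a *: pderivs s f.
  move=> sf; have := pderivs_comb s a sf (smooth_subspace R d).1.
  have z0 : pderivs s (0 : fct) = 0.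
    by have := dB _ _ (smooth_subspace R d).1 (smooth_subspace R d).1; rewrite !subrr.
  by rewrite z0 !addr0.
rewrite (dB _ _ s12Z s3) (dZ _ _ s12) (dB _ _ s1 s2) E1 E2 E3.
set g := pderivs s phi.
have sg : smooth g by exact: smooth_pderivs.
have gi : pderivs s (pderivs [:: i] phi) = pderivs [:: i] g.
  rewrite /g -!pderivs_cat; apply: pderivs_perm => //.
  by rewrite perm_catC.
have gii y : cmod (pderivs [:: i; i] g y) = cmod (pderivs s (pderivs [:: i; i] phi) y).
  rewrite /g -!pderivs_cat; congr (cmod (_ y)); apply: pderivs_perm => //.
  by rewrite perm_catC.
rewrite gi.
set D := cmod _.
have -> : D = cmod (g (x - t + tau *: e_ i) - g (x - t) - tau%:C * pderiv i g (x - t)) / `|tau|.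
  rewrite /D -[RHS]mulrC -normfV -cmod_real -cmodM.
  rewrite -[RHS](cmod_sign (size s)); congr cmod.
  rewrite -[LHS]/(tau^-1%:C * ((-1) ^+ size s * g (x + tau *: e_ i - t) -
    (-1) ^+ size s * g (x - t)) - (-1) ^+ size s * pderiv i g (x - t)).
  rewrite [x - t + _]addrAC -mulrBr mulrCA -mulrBr; congr (_ * _).
  by rewrite [RHS]mulrBr [(tau^-1)%:C * (tau%:C * _)]mulrA -rmorphM mulVf// mul1r.
have [->|hv0] := eqVneq (h ^+ size s * v t) 0.
  rewrite mul0r; have := HL 0; rewrite normr0 => /(_ (normr_ge0 _)) /(bnd_ge0 v0) L0.
  by rewrite !mulr_ge0.
have hvp : 0 < h ^+ size s * v t by rewrite lt_neqAle eq_sym hv0 mulr_ge0// exprn_ge0.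
pose K := L * (M (size s))%:num / (h ^+ size s * v t).
have T := @pd_taylor R d g (pderivs [:: i] g) (pderivs [:: i; i] g) i (x - t) tau K
  (fun y => smooth_pd [::] i y sg) (fun y => smooth_pd [:: i] i y sg).
have {}T : cmod (g (x - t + tau *: e_ i) - g (x - t) - tau%:C * pderiv i g (x - t)) <=
    2 * (`|tau| ^+ 2 * K).
  apply: T => r rt; rewrite gii /K ler_pdivlMr// mulrC.
  have [_ H] := HL r rt; have := H s t.
  have := (smooth_refl (x + r *: e_ i) (smooth_pderivs [:: i; i] sphi)).2 s.
  move: (pderivs [:: i; i] phi) => P ->.
  by rewrite cmod_sign [x + _ - t]addrAC.
have t0 : 0 < `|tau| by rewrite normr_gt0.
rewrite mulrA ler_pdivrMr//.
apply: le_trans (ler_wpM2l (ltW hvp) T) _.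
rewrite le_eqVlt; apply/orP; left; apply/eqP.
by rewrite /K; field; move: hvp => /gt_eqF; rewrite mulf_eq0 => /negbT; rewrite negb_or => /andP[-> ->].
Qed.

(** A first-order expansion with quadratic error gives the derivative. *)
Lemma is_pd_remainder (F : fct) i x (l : R[i]) (del L : R) : 0 < del ->
  (forall tau : R, tau != 0 -> `|tau| < del ->
    cmod (tau^-1%:C * (F (x + tau *: e_ i) - F x) - l) <= L * `|tau|) ->
  is_pd i F x l.
Proof.
move=> del0 H.
have key (u : R[i] -> R) : (forall z, `|u z| <= cmod z) ->
    (forall (r : R) z w, u (r%:C * z - w) = r * u z - u w) ->
    (forall z w, u (z - w) = u z - u w) ->
    is_derive x (e_ i) (fun y => u (F y)) (u l).
  move=> ule uZ uB.
  have c : (fun r : R => r^-1 *: (((fun y => u (F y)) \o shift x) (r *: e_ i) - u (F x)))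
      @ 0^' --> u l.
    apply/cvgrPdist_lt => e e0.
    pose del' := Num.min del (e / (`|L| + 1)).
    have L10 : 0 < `|L| + 1 by rewrite ltr_wpDl.
    have del'0 : 0 < del' by rewrite lt_min del0 divr_gt0.
    exists del' => //= r /=; rewrite sub0r normrN lt_min => /andP[rd re] r0.
    rewrite distrC /= -[r^-1 *: _]/(r^-1 * _) -uB -uZ addrC [r *: _ + x]addrC.
    rewrite (le_lt_trans (ule _))//.
    have := H r r0 rd; rewrite addrC => /le_lt_trans; apply.
    rewrite ltr_pdivlMr// in re; apply: le_lt_trans re.
    by rewrite mulrC ler_wpM2l// (le_trans (ler_norm _))// lerDl.
  by split; [apply/cvg_ex; exists (u l)|exact: cvg_lim].
split; apply: (key).
- exact: cmod_Re.
- by move=> r [a b] [a' b'] /=; rewrite mul0r subr0.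
- by move=> [a b] [a' b'].
- exact: cmod_Im.
- by move=> r [a b] [a' b'] /=; rewrite mul0r addr0.
- by move=> [a b] [a' b'].
Qed.

End Remainder.

(** * Convolution of a functional with a test function *)

Section Convolution.
Context (R : realType) (d : nat).
Local Notation Rd := 'rV[R]_d.
Local Notation fct := ('rV[R]_d -> R[i]^o).
Implicit Types (g psi phi chi : fct) (x y t : Rd) (s : seq 'I_d).
Local Notation e_ i := (delta_mx 0 i : Rd).
Context (c : ultra_class) (M A : weight_sequence R) (V : decreasing_weight_system R d).
Local Notation conv := (@Defs.conv R d).

(** Here k is the parameter of the step V m, and V N measures the growth in x.
    Differentiability comes from the Taylor remainder; continuity of the
    derivatives then follows because they are locally bounded. *)
Lemma conv_smooth (f : dual (BV c M V)) psi (k : {posnum R}) (m N : nat) (C1 : R)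
    (b : seq 'I_d -> R) :
  0 <= C1 -> smooth psi ->
  (forall phi K, lcs_dom (Bw c M (V m)) phi -> Gw M (V m) k K phi ->
     cmod (pairing f phi) <= C1 * K) ->
  (forall s x, lcs_dom (Bw c M (V m)) (fun t => pderivs s psi (x - t))) ->
  (forall s x, Gw M (V m) k (b s * (V N x)%:num) (fun t => pderivs s psi (x - t))) ->
  [/\ smooth (conv f psi), forall s, pderivs s (conv f psi) = conv f (pderivs s psi) &
   forall s x, cmod (pderivs s (conv f psi) x) <= C1 * b s * (V N x)%:num].
Proof.
move=> C10 spsi fC Dpsi Gpsi.
pose F s : fct := conv f (pderivs s psi).
have F0 : F [::] = conv f psi by [].
have b0 s : 0 <= b s.
  have := bnd_ge0 _ (Gpsi s 0); rewrite pmulr_lge0//; apply.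
  by move=> x; exact: ltW.
have Fb s x : cmod (F s x) <= C1 * b s * (V N x)%:num.
  by rewrite -mulrA; apply: fC; [exact: Dpsi|exact: Gpsi].
(* V N is bounded near x, uniformly in the direction of differentiation *)
have Vnear x : exists2 del : R, 0 < del &
    forall y, `|x - y| < del -> (V N y)%:num <= (V N x)%:num + 1.
  have cV : continuous (fun x => (V N x)%:num : R^o) by exact: dws_cont.
  have [del del0 Hd] := (iffLR (@continuous_epsP R d R^o _)) cV x 1 ltr01.
  exists del => // y /Hd /ltW; rewrite distrC => /(le_trans (ler_norm _)).
  by rewrite lerBlDl.
have sub phi : lcs_dom (Bw c M (V m)) phi -> lcs_dom (BV c M V) phi by move=> ?; exists m.
have Fd s i x : is_pd i (F s) x (F (i :: s) x).
  have [del del0 Hd] := Vnear x.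
  pose L := b [:: i, i & s] * ((V N x)%:num + 1).
  apply: (@is_pd_remainder R d (F s) i x _ del (2 * (C1 * L)) del0) => tau tau0 taud.
  have D1 := Dpsi s (x + tau *: e_ i); have D2 := Dpsi s x; have D3 := Dpsi (i :: s) x.
  have D12 := subspaceB (lcs_domP _) D1 D2.
  have D12Z := subspaceZ (lcs_domP _) (tau^-1%:C) D12.
  have Dr := subspaceB (lcs_domP _) D12Z D3.
  have -> : tau^-1%:C * (F s (x + tau *: e_ i) - F s x) - F (i :: s) x =
     pairing f (tau^-1%:C *: ((fun t => pderivs s psi (x + tau *: e_ i - t)) -
      (fun t => pderivs s psi (x - t))) - (fun t => pderivs (i :: s) psi (x - t)) : fct).
    rewrite pairingB; [|exact: sub|exact: sub].
    rewrite pairingZ; last exact: sub.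
    by rewrite pairingB; [|exact: sub|exact: sub].
  have -> : 2 * (C1 * L) * `|tau| = C1 * (2 * (`|tau| * L)) by ring.
  apply: fC; first exact: Dr.
  have kge0 : 0 <= k%:num by [].
  have Vge0 n y : 0 <= (V n y)%:num by [].
  apply: (@bnd_remainder R d M k%:num (fun x => (V m x)%:num) (pderivs s psi)
    i x tau L kge0 (fun x => Vge0 m x) (smooth_pderivs s spsi) tau0) => sg sgt.
  have G2 : bnd M k%:num (fun x => (V m x)%:num)
     (b [:: i, i & s] * (V N (x + sg *: e_ i))%:num)
     (fun t => pderivs [:: i; i] (pderivs s psi) (x + sg *: e_ i - t)) :=
    Gpsi [:: i, i & s] (x + sg *: e_ i).
  apply: (bnd_mono G2).
  - by rewrite lexx andbT.
  - by [].
  - by [].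
  - rewrite ler_wpM2l//; apply: Hd.
    rewrite opprD addrA subrr sub0r normrN normrZ (le_lt_trans _ taud)//.
    by rewrite (le_trans _ sgt)// ler_piMr// norm_e.
have Fc s : continuous (F s).
  apply: (pd_continuous (fun i y => Fd s i y)) => x.
  have [del del0 Hd] := Vnear x.
  exists (C1 * (\sum_i b (i :: s)) * ((V N x)%:num + 1)).
  apply: (iffRL (nbhs_normP (x : Rd) _)); exists del => //= y xy i.
  apply: le_trans (Fb _ _) _; apply: ler_pM => //.
  - by rewrite mulr_ge0.
  - by rewrite ler_wpM2l// (bigD1 i)//= lerDl sumr_ge0.
  - exact: Hd.
have [sF EF] := smooth_jet Fc Fd.
by split=> // s x; rewrite EF.
Qed.

Context (C0 : R) (H : {posnum R}).
Hypotheses (C01 : 1 <= C0) (H1 : 1 <= H%:num).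
Hypothesis HM : forall p q,
  (M (p + q)%N)%:num <= C0 * H%:num ^+ (p + q) * (M p)%:num * (M q)%:num.
Hypothesis admV : admissible c A V.

(** The parameter that remains after one use of (M.2). *)
Definition shrink (k : {posnum R}) : {posnum R} := (k%:num / H%:num)%:pos.

(** Reflected translates of derivatives of psi, with psi of parameter k, lie in the
    step V m with a bound that grows in x like V N. *)
Definition transfer (N : nat) (k : {posnum R}) m := exists2 Cst : R, 0 <= Cst &
  forall psi K, Gs M A k K psi -> forall s x,
  Gw M (V m) (shrink k)
    (Cst * K * (V N x)%:num * ((M (size s))%:num * (H%:num / k%:num) ^+ size s))
    (fun t => pderivs s psi (x - t)).

Lemma adm_transfer N m (lambda k : {posnum R}) (C : R) : 0 < C ->
  adm A C lambda (fun x => (V m x)%:num) (fun x => (V N x)%:num) ->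
  lambda%:num <= k%:num -> transfer N k m.
Proof.
move=> C_gt0 ad lk; exists (C * C0); first by rewrite mulr_ge0 ?(ltW C_gt0)// (le_trans ler01).
move=> psi K; rewrite GsE => G s x.
have Vgt0 n y : 0 < (V n y)%:num by [].
exact: (bnd_refl_deriv (erefl k%:num) C_gt0 C01 H1 HM
  (fun y => Vgt0 m y) (fun y => Vgt0 N y) ad lk G s x).
Qed.

Lemma admissible_adm N : qdual c (fun lambda => exists2 m, (N <= m)%N &
  exists2 C : R, 0 < C & adm A C lambda (fun x => (V m x)%:num) (fun x => (V N x)%:num)).
Proof.
have E (lambda : {posnum R}) t : expR (assoc_fun A (enorm (lambda%:num *: t))) = gsw A lambda t.
  by rewrite -eAE enormZ.
move: admV; rewrite /admissible; case: (c) => /= ad.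
  have [lambda [l0 [m Nm [C C_gt0 HC]]]] := ad N.
  exists (PosNum l0), m => //; exists C => // x t.
  by rewrite -E; exact: HC.
move=> lambda; have [m Nm [C C_gt0 HC]] := ad N lambda%:num (gt0 _).
by exists m => //; exists C => // x t; rewrite -E; exact: HC.
Qed.

(** In the Beurling case the step m does not depend on k, whence the translates
    belong to the projective limit over all h. *)
Lemma transfers N : match c with
  | Beurling => exists m (k0 : {posnum R}), forall k : {posnum R},
      k0%:num <= k%:num -> transfer N k m
  | Roumieu => forall k, exists m, transfer N k m end.
Proof.
have := admissible_adm N; case: (c) => /=.
  move=> [lambda [m _ [C C_gt0 ad]]]; exists m, lambda => k lk.
  exact: adm_transfer ad lk.
move=> HR k; have [m _ [C C_gt0 ad]] := HR k; exists m.
exact: adm_transfer ad (lexx _).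
Qed.

Lemma transfer_Gw N k m psi K : transfer N k m -> Gs M A k K psi ->
  forall s x, exists K', Gw M (V m) (shrink k) K' (fun t => pderivs s psi (x - t)).
Proof. by move=> [Cst _ T] G s x; eexists; exact: T G s x. Qed.

Lemma shrink_large (h k0 : {posnum R}) : exists k : {posnum R},
  k0%:num <= k%:num /\ h%:num <= (shrink k)%:num.
Proof.
exists (Num.max k0%:num (h%:num * H%:num))%:pos => /=.
by rewrite le_max lexx ler_pdivlMr// le_max lexx orbT.
Qed.

Definition conv_estimate (f : dual (BV c M V)) N (k : {posnum R}) :=
  exists2 C : R, 0 <= C & forall psi K, lcs_dom (GS d c M A) psi -> Gs M A k K psi ->
    [/\ forall x, lcs_dom (BV c M V) (fun t => psi (x - t)),
      smooth (conv f psi), forall s, pderivs s (conv f psi) = conv f (pderivs s psi) &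
      bnd M (shrink k)%:num (fun x => (V N x)%:num^-1) (C * K) (conv f psi)].

Lemma conv_estimates (f : dual (BV c M V)) N : match c with
  | Beurling => exists k0 : {posnum R}, forall k : {posnum R},
      k0%:num <= k%:num -> conv_estimate f N k
  | Roumieu => forall k, conv_estimate f N k end.
Proof.
have main m k C1 : 0 <= C1 -> transfer N k m ->
    (forall psi, lcs_dom (GS d c M A) psi -> forall K, Gs M A k K psi -> forall s x,
      lcs_dom (Bw c M (V m)) (fun t => pderivs s psi (x - t))) ->
    (forall phi K, lcs_dom (Bw c M (V m)) phi -> Gw M (V m) (shrink k) K phi ->
       cmod (pairing f phi) <= C1 * K) -> conv_estimate f N k.
  move=> C10 [Cst Cst0 T] TD fC; exists (C1 * Cst) => [|psi K Spsi G]; first exact: mulr_ge0.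
  have spsi : smooth psi by case: G.
  have K0 : 0 <= K.
    by move: G; rewrite GsE => /bnd_ge0; apply => x; exact: gsw_ge0.
  pose b s : R := Cst * K * ((M (size s))%:num * (H%:num / k%:num) ^+ size s).
  have Gb s x : Gw M (V m) (shrink k) (b s * (V N x)%:num) (fun t => pderivs s psi (x - t)).
    have -> : b s * (V N x)%:num = Cst * K * (V N x)%:num *
        ((M (size s))%:num * (H%:num / k%:num) ^+ size s) by rewrite /b mulrAC.
    exact: T.
  have Db := TD psi Spsi K G.
  have [sc Ec Bc] := conv_smooth C10 spsi fC Db Gb.
  split=> // [x|]; first by exists m => //; exact: Db [::] x.
  split=> // s x; have hk : 0 < (k%:num / H%:num : R) ^+ size s by rewrite exprn_gt0.
  rewrite mulrAC ler_pdivrMr// mulrC -ler_pdivlMr// (le_trans (Bc s x))//.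
  rewrite /b le_eqVlt; apply/orP; left; apply/eqP.
  by rewrite !expr_div_n; field; rewrite !gt_eqF ?exprn_gt0.
have fdom := dual_dominated f.
move: f main fdom (transfers N); rewrite /conv_estimate.
case: (c) => f main fdom.
  move=> [m [k0 T]]; have [h [C1 C10 fC]] := fdom m.
  have [k1 [k01 hk1]] := shrink_large h k0.
  exists k1 => k k1k; apply: (main m k C1) => //.
  - by apply: T; exact: le_trans k1k.
  - move=> psi Spsi _ _ s x; apply/Bw_domP => h'.
    have [k2 [k02 hk2]] := shrink_large h' k0.
    have [K' G'] : exists K', Gs M A k2 K' psi by exact: (iffLR (GS_domP Beurling M A psi)).
    have [K'' G''] := transfer_Gw (T k2 k02) G' s x.
    by exists K''; exact: Gw_mono G''.
  - move=> phi K Dphi G; apply: fC => //; apply: Gw_mono G.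
    by rewrite (le_trans hk1)// /= ler_pM2r.
move=> T k; have [m Tk] := T k; have [C1 C10 fC] := fdom m (shrink k).
apply: (main m k C1) => // psi _ K G s x; apply/Bw_domP; exists (shrink k).
exact: transfer_Gw Tk G s x.
Qed.

Lemma conv_estimate_exists (f : dual (BV c M V)) N psi : lcs_dom (GS d c M A) psi ->
  exists k K, conv_estimate f N k /\ Gs M A k K psi.
Proof.
have := conv_estimates f N; move: f; rewrite /conv_estimate.
case: (c) => f HC Spsi.
  have [k0 Hk] := HC.
  have [K G] : exists K, Gs M A k0 K psi by exact: (iffLR (GS_domP Beurling M A psi)).
  by exists k0, K; split => //; apply: Hk.
have [k [K G]] := iffLR (GS_domP Roumieu M A psi) Spsi.
by exists k, K; split => //; exact: HC.
Qed.

End Convolution.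

(** * Convolution operators with values in the dual weighted spaces *)

Section DualSystemSpaces.
Context (R : realType) (d : nat).
Local Notation Rd := 'rV[R]_d.
Local Notation fct := ('rV[R]_d -> R[i]^o).
Implicit Types (g psi phi chi : fct) (x y t : Rd) (s : seq 'I_d).
Context (c : ultra_class) (M : nat -> {posnum R}) (W : increasing_weight_system R d).

Lemma iws_mono m n x : (m <= n)%N -> (W m x)%:num <= (W n x)%:num.
Proof.
by move=> /subnK <-; elim: (n - m)%N => [|k IH]//; exact: le_trans (iws_incr _ _ _).
Qed.

Lemma Gw_iws_mono h K g m n : (m <= n)%N -> Gw M (W n) h K g -> Gw M (W m) h K g.
Proof.
move=> mn G; apply: (bnd_mono G) => //; first by rewrite lexx andbT.
by move=> x; exact: iws_mono.
Qed.

Lemma BhW_domP h g : lcs_dom (BhW M h W) g <-> forall N, exists K, Gw M (W N) h K g.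
Proof.
split=> [D N|D]; first by apply: (iffLR (Bh_domP M h (W N) g)); exact: D N I.
exact (fun N _ => iffRL (Bh_domP M h (W N) g) (D N)).
Qed.

Lemma BW_domP g : lcs_dom (BW c M W) g <->
  qspace c (fun h => forall N, exists K, Gw M (W N) h K g).
Proof.
have := @clim_domP R fct c _ (directed_BhW M W) g.
rewrite -/(BW c M W) => ->.
by split; apply: qspace_impl => h /BhW_domP.
Qed.

Lemma BW_seminorm_dominated q : lcs_seminorms (BW c M W) q ->
  qdual c (fun h => exists N, exists2 C : R, 0 <= C & forall K g,
    lcs_dom (BhW M h W) g -> Gw M (W N) h K g -> q g <= C * K).
Proof.
rewrite /BW; case: (c) => /=.
  move=> [h _ [N _ Eq]]; exists h, N; exists 1 => // K g _ G.
  by have [_ /(_ _ Eq)] := bnd_Bh G; rewrite mul1r.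
move=> [qs qc] h.
have qsh : seminorm_on (lcs_dom (BhW M h W)) q.
  by split=> [x y Ex Ey|a x Ex]; apply qs; exists h.
have [s [C [C0 Es sC]]] := lcs_seminorm_bound qsh (qc h).
have [N [C' C'0 H]] : exists N, exists2 C : R, 0 <= C & forall K g,
    Gw M (W N) h K g -> \sum_(p <- s) p g <= C * K.
  elim: s Es {sC} => [|p s IH] Es.
    by exists 0%N; exists 0 => // K g _; rewrite big_nil mul0r.
  have [N1 [C1 C10 H1]] := IH (fun q qs => Es q (@mem_behead _ (p :: s) q qs)).
  have [N2 _ Ep] := Es p (mem_head _ _).
  exists (maxn N1 N2); exists (1 + C1) => [|K g G]; first exact: addr_ge0.
  rewrite big_cons mulrDl lerD//.
    have G2 := Gw_iws_mono (leq_maxr N1 N2) G.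
    by have [_ /(_ _ Ep)] := bnd_Bh G2; rewrite mul1r.
  exact: H1 (Gw_iws_mono (leq_maxl N1 N2) G).
exists N; exists (C * C') => [|K g Dg G]; first exact: mulr_ge0.
by rewrite (le_trans (sC _ Dg))// -mulrA ler_wpM2l//; exact: H.
Qed.

Lemma WC_domP g : lcs_dom (WC W) g <->
  continuous g /\ forall N, exists K : R, forall x, (W N x)%:num * cmod (g x) <= K.
Proof.
split=> [D|[cg H]].
  split=> [|N]; first by have [] := D 0%N I.
  have DN := D N I.
  by eexists => x; exact: (sup_norm_ub x DN).
suff D N : lcs_dom (Cw (W N)) g by exact (fun N _ => D N).
have [K HK] := H N.
have K0 : 0 <= K by rewrite (le_trans _ (HK 0))// mulr_ge0// cmod_ge0.
by have [] := @sup_norm_lub R fct (fun f => continuous f) Rd (fun x => (W N x)%:num%:nng)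
  (fun x f => f x) g K cg K0 HK.
Qed.

Definition WC_norm N : fct -> R :=
  fine \o @sup_norm R fct Rd (fun x => (W N x)%:num%:nng) (fun x f => f x).

Lemma WC_seminorm q : lcs_seminorms (WC W) q <->
  exists N, q = WC_norm N.
Proof. by split=> [[N _ ->]|[N ->]]; exists N. Qed.

Lemma WC_seminorm_le N g (K : R) : continuous g -> 0 <= K ->
  (forall x, (W N x)%:num * cmod (g x) <= K) ->
  WC_norm N g <= K.
Proof.
move=> cg K0 HK.
by have [] := @sup_norm_lub R fct (fun f => continuous f) Rd (fun x => (W N x)%:num%:nng)
  (fun x f => f x) g K cg K0 HK.
Qed.

Lemma WC_seminorm_ge N g x : lcs_dom (WC W) g -> (W N x)%:num * cmod (g x) <=
  WC_norm N g.
Proof. by move=> D; exact: (sup_norm_ub x (D N I)). Qed.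

End DualSystemSpaces.

Section ConvolutionOperators.
Context (R : realType) (d : nat).
Local Notation Rd := 'rV[R]_d.
Local Notation fct := ('rV[R]_d -> R[i]^o).
Implicit Types (g psi phi chi : fct) (x y t : Rd) (s : seq 'I_d).
Context (c : ultra_class) (M A : weight_sequence R) (V : decreasing_weight_system R d).
Local Notation conv := (@Defs.conv R d).
Context (C0 : R) (H : {posnum R}).
Hypotheses (C01 : 1 <= C0) (H1 : 1 <= H%:num).
Hypothesis HM : forall p q,
  (M (p + q)%N)%:num <= C0 * H%:num ^+ (p + q) * (M p)%:num * (M q)%:num.
Hypothesis admV : admissible c A V.
Local Notation E := (BV c M V).
Local Notation S := (GS d c M A).
Local Notation W := (dual_system V).

Lemma conv_translate (f : dual E) psi x : lcs_dom S psi ->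
  lcs_dom E (fun t => psi (x - t)).
Proof.
move=> Spsi; have [k [K [[C _ HC] G]]] := conv_estimate_exists C01 H1 HM admV f 0 Spsi.
by have [] := HC psi K Spsi G.
Qed.

Lemma conv_derivs (f : dual E) psi s : lcs_dom S psi ->
  smooth (conv f psi) /\ pderivs s (conv f psi) = conv f (pderivs s psi).
Proof.
move=> Spsi; have [k [K [[C _ HC] G]]] := conv_estimate_exists C01 H1 HM admV f 0 Spsi.
by have [] := HC psi K Spsi G.
Qed.

Lemma conv_lin (f : dual E) (a : R[i]) phi psi : lcs_dom S phi -> lcs_dom S psi ->
  conv f (a *: phi + psi) = a *: conv f phi + conv f psi.
Proof.
move=> Sphi Spsi; apply/funext => x.
have h := pairing_lin f a (conv_translate f x Sphi) (conv_translate f x Spsi).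
exact: h.
Qed.

Lemma conv_BW (f : dual E) psi : lcs_dom S psi -> lcs_dom (BW c M W) (conv f psi).
Proof.
have ce := conv_estimates C01 H1 HM admV f.
move=> Spsi; apply/BW_domP; move: f ce Spsi; rewrite /conv_estimate.
case: (c) => f ce Spsi.
  move=> h N; have [k0 Hk] := ce N.
  have [k [k0k hk]] := shrink_large H h k0.
  have [K G] : exists K, Gs M A k K psi by exact: (iffLR (GS_domP Beurling M A psi)).
  have [C _ HC] := Hk k k0k; have [_ _ _ B] := HC psi K Spsi G.
  exists (C * K); apply: (bnd_mono B) => //.
  by rewrite hk andbT.
have [k [K G]] := iffLR (GS_domP Roumieu M A psi) Spsi.
exists (shrink H k) => N.
have [C _ HC] := ce N k; have [_ _ _ B] := HC psi K Spsi G.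
by exists (C * K).
Qed.

Lemma conv_WC (f : dual E) psi : lcs_dom S psi -> lcs_dom (WC W) (conv f psi).
Proof.
move=> Spsi; apply/WC_domP; split=> [|N].
  by have [sc _] := conv_derivs f [::] Spsi; by have [] := sc [::].
have [k [K [[C _ HC] G]]] := conv_estimate_exists C01 H1 HM admV f N Spsi.
have [_ _ _ [_ B]] := HC psi K Spsi G.
exists (C * K * (M 0%N)%:num) => x.
by have := B [::] x; rewrite /= expr0 mul1r.
Qed.

(** A seminorm q of the target is carried back to S by convolution with f: in
    the Roumieu case the seminorm q (f * psi) itself presents the topology of S. *)
Lemma conv_seminorm (F : lcs fct) (f : dual E) (q : fct -> R) :
  seminorm_on (lcs_dom F) q ->
  (forall psi, lcs_dom S psi -> lcs_dom F (conv f psi)) ->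
  qdual c (fun k => exists2 C : R, 0 <= C & forall psi K,
     lcs_dom S psi -> Gs M A k K psi -> q (conv f psi) <= C * K) ->
  exists (s : seq (fct -> R)) (C : R), [/\ 0 <= C, forall p, p \in s -> lcs_seminorms S p &
    forall psi : lcs_type S, q (conv f (lcs_val psi)) <= C * \sum_(p <- s) p (lcs_val psi)].
Proof.
move=> qs SF; have clin := conv_lin f.
move: f SF clin; case: (c) => f SF clin.
  move=> [k [C C_ge0 HC]].
  have [p Ep] := @Bh_norm_exists R d M k (gs_weight A k).
  exists [:: p], C; split=> // [r|psi].
    by rewrite inE => /eqP ->; exists k.
  rewrite big_seq1; apply: HC; first exact: lcs_dom_val.
  exact: Bh_bnd Ep (lcs_dom_val psi k I).
move=> HC; exists [:: q \o conv f], 1; split=> // [r|psi]; last by rewrite big_seq1 mul1r.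
have qcs : seminorm_on (lcs_dom (GS d Roumieu M A)) (q \o conv f).
  split=> [x y Sx Sy|a x Sx] /=.
    have := clin 1 x y Sx Sy; rewrite !scale1r => ->.
    by apply qs; exact: SF.
  have S0 := (lcs_domP (GS d Roumieu M A)).1.
  have := clin a x 0 Sx S0; rewrite addr0 => ->.
  have -> : conv f 0 = 0 by apply/funext => y; exact: pairing0.
  by rewrite addr0; apply qs; exact: SF.
rewrite inE => /eqP ->; split=> // k.
have [C C_ge0 Hk] := HC k.
apply: (@Bh_continuous R d M k (gs_weight A k) _ _ C qcs) => // K phi G.
have Sphi : lcs_dom (GS d Roumieu M A) phi by apply/GS_domP; exists k, K.
by split=> //; exact: Hk.
Qed.

Lemma conv_map_BW (f : dual E) (psi : lcs_type S) :
  lcs_val (val (conv_map S (BW c M W) f) psi) = conv f (lcs_val psi).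
Proof.
apply: conv_mapE => [phi|phi Sphi x|q Eq]; first exact: conv_BW.
  exact: conv_translate.
apply: (conv_seminorm (lcs_seminormsP Eq)); first exact: conv_BW.
have ce := conv_estimates C01 H1 HM admV f.
have cB := conv_BW f.
move: f Eq ce cB => f Eq.
have := BW_seminorm_dominated Eq; rewrite /conv_estimate.
move: f {Eq psi}; case: (c) => f.
  move=> [h [N [C C_ge0 HC]]] /(_ N)[k0 Hk] cB.
  have [k [k0k hk]] := shrink_large H h k0.
  have [C' C'_ge0 HC'] := Hk k k0k.
  exists k; exists (C * C') => [|psi K Spsi G]; first exact: mulr_ge0.
  have [_ _ _ B] := HC' psi K Spsi G.
  rewrite -mulrA; apply: HC; first by apply/BhW_domP; exact: (iffLR (BW_domP _ _ _ _) (cB _ Spsi)).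
  apply: (bnd_mono B) => //; by rewrite hk andbT.
move=> HC ce cB k; have [N [C C_ge0 HC1]] := HC (shrink H k).
have [C' C'_ge0 HC'] := ce N k.
exists (C * C') => [|psi K Spsi G]; first exact: mulr_ge0.
have [_ _ _ B] := HC' psi K Spsi G.
rewrite -mulrA; apply: HC1 => //; apply/BhW_domP => N'.
have [C2 _ HC2] := ce N' k; have [_ _ _ B2] := HC2 psi K Spsi G.
by exists (C2 * K).
Qed.

Lemma conv_map_WC (f : dual E) (psi : lcs_type S) :
  lcs_val (val (conv_map S (WC W) f) psi) = conv f (lcs_val psi).
Proof.
apply: conv_mapE => [phi|phi Sphi x|q Eq]; first exact: conv_WC.
  exact: conv_translate.
apply: (conv_seminorm (lcs_seminormsP Eq)); first exact: conv_WC.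
have [N qE] := iffLR (WC_seminorm _ _) Eq.
have main k : conv_estimate A H f N k -> exists2 C : R, 0 <= C & forall psi K,
    lcs_dom S psi -> Gs M A k K psi -> q (conv f psi) <= C * K.
  move=> [C C_ge0 HC]; exists (C * (M 0%N)%:num) => [|phi K Sphi G]; first exact: mulr_ge0.
  have K0 : 0 <= K by move: G; rewrite GsE => /bnd_ge0; apply => x; exact: gsw_ge0.
  have [_ sc _ [_ B]] := HC phi K Sphi G.
  rewrite qE; apply: WC_seminorm_le.
  - by have [] := sc [::].
  - by rewrite !mulr_ge0.
  - by move=> x; have := B [::] x; rewrite /= expr0 mul1r mulrAC.
have := conv_estimates C01 H1 HM admV f N.
move: f main {psi}; rewrite /conv_estimate; case: (c) => f main.
  by move=> [k0 Hk]; exists k0; apply: main; exact: Hk.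
by move=> Hk k; apply: main; exact: Hk.
Qed.

End ConvolutionOperators.

(** * The first two inclusions of topologies *)

Lemma lcs_entourage_filter (R : realType) (X : lmodType R[i]) (F : lcs X)
    (D I : Type) (Fl : set_system D) (B : set I) (u0 : I -> lcs_type F)
    (u : D -> I -> lcs_type F) (U : set (lcs_type F * lcs_type F)) :
  Filter Fl -> entourage U ->
  (forall q (e : R), lcs_seminorms F q -> 0 < e ->
     Fl [set z | forall a, B a -> q (lcs_val (u0 a) - lcs_val (u z a)) < e]) ->
  Fl [set z | forall a, B a -> U (u0 a, u z a)].
Proof.
move=> FFl [s [e [e0 Es sU]]] H.
suff : Fl [set z | forall a, B a -> forall q, q \in s ->
    q (lcs_val (u0 a) - lcs_val (u z a)) < e].
  by apply: filterS => z Hz a Ba; apply: sU => q qs; exact: Hz.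
elim: s Es {sU} => [|p s IH] Es.
  by apply: filterS filterT => z _ a _ q.
have h2 := IH (fun q qs => Es q (@mem_behead _ (p :: s) q qs)).
have h1 := H p e (Es p (mem_head _ _)) e0.
apply: filterS (filterI h1 h2) => z [/= z1 z2] a Ba q.
by rewrite inE => /orP[/eqP ->|]; [exact: z1|exact: z2].
Qed.

Section FirstInclusions.
Context (R : realType) (d : nat).
Local Notation Rd := 'rV[R]_d.
Local Notation fct := ('rV[R]_d -> R[i]^o).
Implicit Types (g psi phi chi : fct) (x y t : Rd) (s : seq 'I_d).
Context (c : ultra_class) (M A : weight_sequence R) (V : decreasing_weight_system R d).
Local Notation conv := (@Defs.conv R d).
Context (C0 : R) (H : {posnum R}).
Hypotheses (C01 : 1 <= C0) (H1 : 1 <= H%:num).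
Hypothesis HM : forall p q,
  (M (p + q)%N)%:num <= C0 * H%:num ^+ (p + q) * (M p)%:num * (M q)%:num.
Hypothesis admV : admissible c A V.
Local Notation E := (BV c M V).
Local Notation S := (GS d c M A).
Local Notation W := (dual_system V).

(** The factor which makes the bound on the translates of [transfer] independent
    of the derivative and of the point. *)
Definition translate_coef (k : {posnum R}) N s x : R :=
  (shrink H k)%:num ^+ size s / ((M (size s))%:num * (V N x)%:num).

Lemma translate_coef_gt0 k N s x : 0 < translate_coef k N s x.
Proof. by rewrite /translate_coef divr_gt0// exprn_gt0. Qed.

Lemma translate_bound k k2 N m Cst psi K : k%:num <= k2%:num -> 0 <= Cst -> 0 <= K ->
  (forall s x, Gw M (V m) (shrink H k2)
    (Cst * K * (V N x)%:num * ((M (size s))%:num * (H%:num / k2%:num) ^+ size s))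
    (fun t => pderivs s psi (x - t))) ->
  forall s x, Gw M (V m) (shrink H k2) (Cst * K)
    (fun t => (translate_coef k N s x)%:C * pderivs s psi (x - t)).
Proof.
move=> kk2 Cst0 K0 T s x.
have w0 y : 0 <= (V m y)%:num by [].
have h0 : 0 <= (shrink H k2)%:num by [].
have h00 : 0 <= (shrink H k2)%:num <= (shrink H k2)%:num by rewrite h0 lexx.
have G := bnd_scale (translate_coef k N s x)%:C w0 h0 (T s x).
apply: (bnd_mono G) => //.
rewrite cmod_real gtr0_norm ?translate_coef_gt0//.
have -> : translate_coef k N s x *
    (Cst * K * (V N x)%:num * ((M (size s))%:num * (H%:num / k2%:num) ^+ size s)) =
    Cst * K * (k%:num / k2%:num) ^+ size s.
  rewrite /translate_coef /= !expr_div_n; field.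
  by rewrite !gt_eqF ?exprn_gt0.
rewrite ler_piMr ?mulr_ge0// exprn_ile1 ?divr_ge0//.
by rewrite ler_pdivrMr ?mul1r.
Qed.

Lemma translate_sets N (B : set fct) :
  match c with
  | Beurling => (forall h, exists K, forall psi, B psi -> Gs M A h K psi) ->
      exists k0 : {posnum R}, forall k : {posnum R}, k0%:num <= k%:num ->
        exists n, forall h, exists K, forall psi, B psi -> forall s x,
          Gw M (V n) h K (fun t => (translate_coef k N s x)%:C * pderivs s psi (x - t))
  | Roumieu => forall k, (exists K, forall psi, B psi -> Gs M A k K psi) ->
      exists n h K, forall psi, B psi -> forall s x,
        Gw M (V n) h K (fun t => (translate_coef k N s x)%:C * pderivs s psi (x - t))
  end.
Proof.
have K_ge0 k K psi : Gs M A k K psi -> 0 <= K.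
  by rewrite GsE => /bnd_ge0; apply => x; exact: gsw_ge0.
have := transfers C01 H1 HM admV N; case: (c).
  move=> [m [k0 T]] HB; exists k0 => k k0k; exists m => h.
  have [k2 [kk2 hk2]] := shrink_large H h k.
  have [Cst Cst0 HT] := T k2 (le_trans k0k kk2).
  have [K HK] := HB k2; exists (Cst * K) => psi Bpsi s x.
  apply: Gw_mono hk2 _; apply: translate_bound => //.
    exact: K_ge0 (HK _ Bpsi).
  exact: HT (HK _ Bpsi).
move=> T k [K HK]; have [m [Cst Cst0 HT]] := T k.
exists m, (shrink H k), (Cst * K) => psi Bpsi s x.
by apply: translate_bound => //; [exact: K_ge0 (HK _ Bpsi)|exact: HT (HK _ Bpsi)].
Qed.

Definition top_iii := dual_topology (BV_sets (c := c) (M := M) (V := V)).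

Lemma top_iii_nbhs (f : top_iii) (B : set (lcs_type E)) (e : R) : 0 < e -> BV_sets B ->
  nbhs f [set g : top_iii | forall b, B b -> cmod (val (f : dual E) b - val (g : dual E) b) < e].
Proof.
move=> e0 BB.
have entU : entourage [set ab : R[i]^o * R[i]^o | `|ab.1 - ab.2| < e%:C].
  have e0' : 0 < e%:C by rewrite ltcR.
  rewrite -entourage_from_ballE; exists e%:C => //.
have := clin_unif_nbhs f entU BB; apply: filterS => g Hg y By.
by have := Hg y By; rewrite /= cmodE ltcR.
Qed.

(** Uniform smallness of f - f' on a suitable set of rescaled translates of
    derivatives makes (f - f') * psi small in one seminorm of the target. *)
Lemma conv_close k N (B : set fct) (f : top_iii) (e : R) : 0 < e ->
  (forall psi, B psi -> lcs_dom S psi) ->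
  (exists n, qspace c (fun h => exists K, forall psi, B psi -> forall s x,
      Gw M (V n) h K (fun t => (translate_coef k N s x)%:C * pderivs s psi (x - t)))) ->
  nbhs f [set g : top_iii | forall psi, B psi ->
    bnd M (shrink H k)%:num (fun x => (V N x)%:num^-1) e
      (conv (f : dual E) psi - conv (g : dual E) psi)].
Proof.
move=> e0 BS [n HB].
have dom psi s x : B psi -> lcs_dom E (fun t => (translate_coef k N s x)%:C * pderivs s psi (x - t)).
  move=> Bpsi; apply/BV_domP; exists n; apply: qspace_impl HB => h [K HK].
  by exists K; exact: HK.
pose Bs := [set b : lcs_type E | exists psi s x, B psi /\
  lcs_val b = (fun t => (translate_coef k N s x)%:C * pderivs s psi (x - t))].
have BBs : BV_sets Bs.
  apply/BV_setsP; exists n; apply: qspace_impl HB => h [K HK].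
  by exists K => b [psi [s [x [Bpsi ->]]]]; exact: HK.
have := top_iii_nbhs f e0 BBs; apply: filterS => g Hg psi Bpsi.
have Spsi := BS _ Bpsi.
have dom' s x : lcs_dom E (fun t => pderivs s psi (x - t)).
  have := subspaceZ (lcs_domP E) (translate_coef k N s x)^-1%:C (dom psi s x Bpsi).
  congr (lcs_dom E _); apply/funext => t.
  rewrite -[LHS]/((translate_coef k N s x)^-1%:C * ((translate_coef k N s x)%:C * pderivs s psi (x - t))).
  by rewrite mulrA -rmorphM mulVf ?gt_eqF ?translate_coef_gt0// mul1r.
have sB : smooth (conv (f : dual E) psi - conv (g : dual E) psi).
  apply: (subspaceB (@smooth_subspace R d)).
    by have [] := conv_derivs C01 H1 HM admV (f : dual E) [::] Spsi.
  by have [] := conv_derivs C01 H1 HM admV (g : dual E) [::] Spsi.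
split=> // s x.
have -> : pderivs s (conv (f : dual E) psi - conv (g : dual E) psi) =
    conv (f : dual E) (pderivs s psi) - conv (g : dual E) (pderivs s psi).
  have [sf <-] := conv_derivs C01 H1 HM admV (f : dual E) s Spsi.
  have [sg <-] := conv_derivs C01 H1 HM admV (g : dual E) s Spsi.
  by have := pderivs_comb s (-1) sg sf; rewrite !scaleN1r addrC => ->; rewrite addrC.
pose u : fct := fun t => pderivs s psi (x - t).
rewrite -[(_ - _) x]/(pairing (f : dual E) u - pairing (g : dual E) u).
have Eu : lcs_dom E u by exact: dom'.
have Du : lcs_dom E ((translate_coef k N s x)%:C *: u) by exact: dom.
have := Hg (lcs_elt Du) _; rewrite -!pairingE.
have h1 := pairingZ (f : dual E) (translate_coef k N s x)%:C Eu.
have h2 := pairingZ (g : dual E) (translate_coef k N s x)%:C Eu.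
rewrite h1 h2 -mulrBr cmodM cmod_real gtr0_norm ?translate_coef_gt0//.
have Bu : Bs (lcs_elt Du) by exists psi, s, x.
move=> /(_ Bu) /ltW; rewrite /translate_coef => lt.
rewrite -ler_pdivrMr// (le_trans _ lt)// le_eqVlt; apply/orP; left; apply/eqP.
by field; rewrite !gt_eqF.
Qed.

Lemma open_i_sub_iii : @open (conv_topology E S (BW c M W)) `<=` @open top_iii.
Proof.
apply: (@initial_open_sub R (lcs_type S) (lcs_type (BW c M W)) _ (dual E)
  (@conv_map R d E S (BW c M W)) (@open top_iii) (fun f : dual E => nbhs (f : top_iii))).
  by move=> O OO; rewrite openE => f /OO.
move=> f B U bB entU.
have := @lcs_entourage_filter R fct (BW c M W) (dual E) (lcs_type S) (nbhs (f : top_iii)) B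
  (val (conv_map S (BW c M W) f)) (fun z : dual E => val (conv_map S (BW c M W) z)) U _ entU.
apply => q e Eq e0.
pose B' := [set lcs_val psi | psi in B].
have B'S psi : B' psi -> lcs_dom S psi by move=> [u _ <-]; exact: lcs_dom_val.
have HB : qspace c (fun h => exists K, forall psi, B' psi -> Gs M A h K psi).
  have := GS_bounded_bnd bB; apply: qspace_impl => h [K HK].
  by exists K => _ [u Bu <-]; exact: HK.
have valE (g : dual E) u : lcs_val (val (conv_map S (BW c M W) f) u) -
    lcs_val (val (conv_map S (BW c M W) g) u) = conv f (lcs_val u) - conv g (lcs_val u).
  by rewrite !(conv_map_BW C01 H1 HM admV).
have ce (g : dual E) := conv_estimates C01 H1 HM admV g.
have [k [h [N [C C_ge0 [hk [sets [dom HC]]]]]]] :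
  exists k h N, exists2 C : R, 0 <= C & h%:num <= (shrink H k)%:num /\
   ((exists n, qspace c (fun h => exists K, forall psi, B' psi -> forall s x,
      Gw M (V n) h K (fun t => (translate_coef k N s x)%:C * pderivs s psi (x - t)))) /\
    ((forall g : dual E, forall psi, B' psi -> lcs_dom (BhW M h W) (conv g psi)) /\
     forall K g, lcs_dom (BhW M h W) g -> Gw M (W N) h K g -> q g <= C * K)).
  have ts N := translate_sets N B'.
  have dBW (g : dual E) psi : B' psi -> lcs_dom (BW c M W) (conv g psi).
    by move=> /B'S; exact: (conv_BW C01 H1 HM admV g).
  move: (BW_seminorm_dominated Eq) HB ts ce B'S dBW; rewrite /conv_estimate.
  clear; case: (c).
    move=> [h [N [C C_ge0 HC]]] HB /(_ N HB)[k0 Hk] _ B'S dBW.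
    have [k [k0k hk]] := shrink_large H h k0.
    exists k, h, N; exists C => //; split=> //; split; first exact: Hk.
    split=> // g psi Bpsi; apply/BhW_domP.
    exact: (iffLR (BW_domP _ _ _ _) (dBW g psi Bpsi)).
  move=> HC [k [K HK]] ts ce B'S dBW.
  have [N [C C_ge0 HCk]] := HC (shrink H k).
  exists k, (shrink H k), N; exists C => //; split=> //; split; first by apply: ts; exists K.
  split=> // g psi Bpsi; apply/BhW_domP => N'.
  have [C' _ HC'] := ce g N' k.
  by have [_ _ _ ?] := HC' psi K (B'S _ Bpsi) (HK _ Bpsi); exists (C' * K).
have e'0 : 0 < e / (C + 1) by rewrite divr_gt0// ltr_wpDl.
have := conv_close f e'0 B'S sets; apply: filterS => g Hg u Bu.
rewrite valE.
have B'u : B' (lcs_val u) by exists u.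
have Dd := subspaceB (lcs_domP _) (dom f _ B'u) (dom g _ B'u).
apply: (@le_lt_trans _ _ (C * (e / (C + 1)))).
  apply: HC Dd _; apply: (bnd_mono (Hg _ B'u)) => //.
  by rewrite hk andbT.
by rewrite mulrA ltr_pdivrMr ?ltr_wpDl// mulrC ltr_pM2l// ltrDl.
Qed.

Lemma open_ii_sub_i :
  @open (conv_topology E S (WC W)) `<=` @open (conv_topology E S (BW c M W)).
Proof.
apply: (@initial_open_sub R (lcs_type S) (lcs_type (WC W)) _ (dual E)
  (@conv_map R d E S (WC W)) (@open (conv_topology E S (BW c M W)))
  (fun f : dual E => nbhs (f : conv_topology E S (BW c M W)))).
  by move=> O OO; rewrite openE => f /OO.
move=> f B U bB entU.
have := @lcs_entourage_filter R fct (WC W) (dual E) (lcs_type S)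
  (nbhs (f : conv_topology E S (BW c M W))) B
  (val (conv_map S (WC W) f)) (fun z : dual E => val (conv_map S (WC W) z)) U _ entU.
apply => q e /WC_seminorm[N ->] e0.
pose Q : fct -> R := WC_norm W N.
have sub g : lcs_dom (BW c M W) g -> lcs_dom (WC W) g.
  move=> /BW_domP.
  have main h : (forall N, exists K, Gw M (W N) h K g) -> lcs_dom (WC W) g.
    move=> HN; apply/WC_domP; split=> [|N'].
      by have [_ [sg _]] := HN 0%N; have [] := sg [::].
    have [K [_ G]] := HN N'; exists (K * (M 0%N)%:num) => x.
    by have := G [::] x; rewrite /= expr0 mul1r.
  by case: (c) => [/(_ 1%:pos)|[h]] /main.
have Qle h K g : Gw M (W N) h K g -> Q g <= (M 0%N)%:num * K.
  move=> G; have K0 : 0 <= K by apply: bnd_ge0 G => x.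
  have [sg HG] := G; apply: WC_seminorm_le.
  - by have [] := sg [::].
  - by rewrite mulr_ge0.
  - by move=> x; have := HG [::] x; rewrite /= expr0 mul1r [K * _]mulrC.
have [r [C [Er C_gt0 rQ]]] : exists r (C : R), [/\ lcs_seminorms (BW c M W) r, 0 < C &
    forall g, lcs_dom (BW c M W) g -> Q g <= C * r g].
  have WCQ : lcs_seminorms (WC W) Q by exists N.
  have qs : seminorm_on (lcs_dom (BW c M W)) Q.
    by split=> [x y Ex Ey|a x Ex]; apply (lcs_seminormsP WCQ); exact: sub.
  move: qs {f sub U bB B entU}; rewrite /BW; case: (c) => qs.
    have [p Ep] := @Bh_norm_exists R d M 1%:pos (W N).
    exists p, (M 0%N)%:num; split=> // [|g Dg]; first by exists 1%:pos => //; exists N.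
    exact: (Qle 1%:pos) (Bh_bnd Ep (Dg 1%:pos I N I)).
  exists Q, 1; split=> // [|g _]; last by rewrite mul1r.
  split=> // h.
  have [p Ep] := @Bh_norm_exists R d M h (W N).
  apply: (@lcs_seminorm_continuous _ _ _ Q [:: p] (M 0%N)%:num) => //.
  - by split=> [x y Ex Ey|a x Ex]; apply qs; exists h.
  - by move=> r; rewrite inE => /eqP ->; exists N.
  - by move=> g Dg; rewrite big_seq1; exact: (Qle h) (Bh_bnd Ep (Dg N I)).
have valW (g : dual E) u : lcs_val (val (conv_map S (WC W) f) u) -
    lcs_val (val (conv_map S (WC W) g) u) = conv f (lcs_val u) - conv g (lcs_val u).
  by rewrite !(conv_map_WC C01 H1 HM admV).
have valB (g : dual E) u : lcs_val (val (conv_map S (BW c M W) f) u) -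
    lcs_val (val (conv_map S (BW c M W) g) u) = conv f (lcs_val u) - conv g (lcs_val u).
  by rewrite !(conv_map_BW C01 H1 HM admV).
have eC0 : 0 < e / C by rewrite divr_gt0.
have entr : entourage [set ab : lcs_type (BW c M W) * lcs_type (BW c M W) |
    r (lcs_val ab.1 - lcs_val ab.2) < e / C].
  exists [:: r], (e / C); split=> // [p|ab]; first by rewrite inE => /eqP ->.
  by move=> /(_ r (mem_head _ _)).
have near := @initial_continuous (dual E) (clin_unif (lcs_type (BW c M W)) _)
  (@conv_map R d E S (BW c M W)) f _ (clin_unif_nbhs (conv_map S (BW c M W) f) entr bB).
apply: (@filterS (dual E) (nbhs (f : conv_topology E S (BW c M W)))
  (nbhs_filter (f : conv_topology E S (BW c M W))) _ _ _ near) => g Hg u Bu.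
rewrite valW.
have := Hg u Bu; rewrite /= valB => lt.
have Dg (g' : dual E) := conv_BW C01 H1 HM admV g' (lcs_dom_val u).
apply: (le_lt_trans (rQ _ (subspaceB (lcs_domP _) (Dg f) (Dg g)))).
by rewrite mulrC -ltr_pdivlMr.
Qed.

End FirstInclusions.

(** * Antiderivatives on the line *)

Section Antiderivative.
Context (R : realType).
Local Notation mu := (@lebesgue_measure R).

Lemma MVT_real (f df : R -> R) (a b : R) : (forall x : R, a <= x <= b -> is_derive x 1 f (df x)) ->
  a <= b -> exists2 c, a <= c <= b & f b - f a = df c * (b - a).
Proof.
move=> fd ab.
have [c cab ->] : exists2 c, c \in `[a, b] & f b - f a = df c * (b - a).
  apply: MVT_segment => // [x|].
    by rewrite in_itv => /andP[/ltW ax /ltW xb]; apply: fd; rewrite ax.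
  apply: derivable_within_continuous => x; rewrite in_itv => xab.
  by have [] := fd x xab.
by exists c => //; move: cab; rewrite in_itv.
Qed.

(** Integrals from -n to x give antiderivatives on half-lines; those for different
    n differ by constants and are glued after subtracting their value at 0. *)
Lemma antiderivative (g : R -> R) : continuous g ->
  exists G : R -> R, forall x : R, is_derive x 1 G (g x).
Proof.
move=> cg.
pose F (n : nat) (x : R) : R := (\int[mu]_(t in `[(- n%:R), x]) g t)%R.
have Fd n (x : R) : - n%:R < x -> is_derive x 1 (F n) (g x).
  move=> nx.
  have x1 : x < x + 1 by rewrite ltrDl.
  have gi : mu.-integrable `[(- n%:R), (x + 1)] (EFin \o g).
    apply: continuous_compact_integrable; first exact: segment_compact.
    exact: continuous_subspaceT.
  have [d1 d2] := continuous_FTC1_closed x1 gi nx (cg x).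
  by apply: (DeriveDef d1); rewrite -derive1E; exact: d2.
pose idx (x : R) := (Num.truncn `|x|).+1.
have idxP x : `|x| < (idx x)%:R by rewrite truncnS_gt.
have FE n m (x : R) : `|x| < n%:R -> `|x| < m%:R -> F n x - F n 0 = F m x - F m 0.
  move=> xn xm.
  have n0 : - n%:R < 0 :> R by rewrite oppr_lt0 (le_lt_trans _ xn).
  have m0 : - m%:R < 0 :> R by rewrite oppr_lt0 (le_lt_trans _ xm).
  have xn' : - n%:R < x by move: xn; rewrite ltr_norml => /andP[].
  have xm' : - m%:R < x by move: xm; rewrite ltr_norml => /andP[].
  have dd (y : R) : - n%:R < y -> - m%:R < y -> is_derive y 1 (fun z => F n z - F m z) 0.
    by move=> ny my; rewrite -(subrr (g y)); apply: is_deriveB; exact: Fd.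
  apply/eqP; rewrite subr_eq addrAC -subr_eq opprK.
  have [x0|/ltW x0] := leP x 0.
    have [|c _] := @MVT_real (fun z => F n z - F m z) (fun=> 0) x 0 _ x0.
      by move=> y /andP[xy _]; apply: dd; [exact: lt_le_trans xy|exact: lt_le_trans xy].
    by rewrite mul0r => /eqP; rewrite subr_eq0 => /eqP E; apply/eqP; lra.
  have [|c _] := @MVT_real (fun z => F n z - F m z) (fun=> 0) 0 x _ x0.
    by move=> y /andP[xy _]; apply: dd; [exact: lt_le_trans xy|exact: lt_le_trans xy].
  by rewrite mul0r => /eqP; rewrite subr_eq0 => /eqP E; apply/eqP; lra.
exists (fun x => F (idx x) x - F (idx x) 0) => x.
pose n := (idx x).+1.
have near_eq : \forall y \near x, F (idx y) y - F (idx y) 0 = F n y - F n 0.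
  exists 1 => //= y xy; apply: FE; first exact: idxP.
  rewrite (_ : y = x - (x - y)); last by rewrite opprB addrC subrK.
  by rewrite (le_lt_trans (ler_normB _ _))// /n -natr1 ltrD.
have dn : is_derive x 1 (fun y => F n y - F n 0) (g x).
  rewrite -[g x]subr0; apply: is_deriveB.
  apply: Fd; have := idxP x; rewrite ltr_norml => /andP[h _].
  by apply: le_lt_trans h; rewrite lerN2 /n -natr1 lerDl.
have [d1 d2] := dn.
split; last by rewrite -d2; exact: near_eq_derive.
apply: (near_eq_derivable _ d1).
by apply: filterS near_eq => y ->.
Qed.

End Antiderivative.

(** * A step function with controlled derivatives *)

Section Bump.
Context (R : realType) (M A : weight_sequence R) (M1M : cond_M1 M).
Local Notation eA := (eA A).

Definition jet (g : nat -> R -> R) := forall n (x : R), is_derive x (1 : R) (g n) (g n.+1 x).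

Lemma deriv_ge0_mono (G g : R -> R) (a b : R) : (forall x : R, is_derive x (1 : R) G (g x)) ->
  (forall x, a <= x <= b -> 0 <= g x) -> a <= b -> G a <= G b.
Proof.
move=> Gd g0 ab; have [c cab] := MVT_real (fun x _ => Gd x) ab.
move=> E; rewrite -subr_ge0 E mulr_ge0 ?subr_ge0//; exact: g0.
Qed.

(** Comparison with - C / x, whose derivative C / x^2 dominates g. *)
Lemma quadratic_tail (G g : R -> R) (C a b : R) :
  (forall x : R, is_derive x (1 : R) G (g x)) -> (forall x, 0 <= g x) ->
  0 <= C -> (forall x, g x * (1 + x ^+ 2) <= C) -> 0 < a -> a <= b -> G b - G a <= C / a.
Proof.
move=> Gd g0 C0 gC a0 ab; have b0 : 0 < b by exact: lt_le_trans ab.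
have Fd (x : R) : a <= x <= b ->
    is_derive x (1 : R) ((- C) *: (fun t : R => t^-1 : R) - G) (C / x ^+ 2 - g x).
  move=> /andP[ax _]; have x0 : 0 < x by exact: lt_le_trans ax.
  have iv := @is_deriveV R id x 1 1 (lt0r_neq0 x0) (is_derive_id x (1 : R)).
  apply: (is_derive_eq (is_deriveB (is_deriveZ (- C) iv) (Gd x))).
  by rewrite /GRing.scale /=; field; rewrite gt_eqF.
have [x /andP[ax xb]] := MVT_real Fd ab.
rewrite -![(_ - _ : R -> R) _]/(_ - _) -![(_ *: _ : R -> R) _]/(_ * _) => E.
have : 0 <= (C / x ^+ 2 - g x) * (b - a).
  rewrite mulr_ge0 ?subr_ge0// ler_pdivlMr; last by rewrite exprn_gt0// (lt_le_trans a0).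
  by apply: le_trans (gC x); rewrite ler_wpM2l// lerDr.
rewrite -E => h; have : 0 <= C / b by rewrite divr_ge0// ltW.
by lra.
Qed.

(** Either t <= N / 2 and the point N - t is at least N / 2, or t is large and
    1 + t^2 compensates the trivial bound. *)
Lemma window_bound (f : R -> R) (C t : R) (N : nat) : 0 <= C ->
  (forall y, f y <= 1) -> (forall y, 0 < y -> f y <= C / y) ->
  f (N%:R - t) <= 4 * (1 + C) * ((1 + t ^+ 2) / (1 + N%:R)).
Proof.
move=> C0 f1 fC.
have N0 : 0 <= N%:R :> R by [].
rewrite mulrA ler_pdivlMr ?ltr_pwDl//.
have t2 : 0 <= t ^+ 2 by exact: sqr_ge0.
have C1t : 0 <= C * t ^+ 2 by exact: mulr_ge0.
have [->|Npos] := posnP N.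
  by rewrite addr0 mulr1 (le_trans (f1 _))//; nra.
have N1 : 1 <= N%:R :> R by rewrite ler1n.
have [tN|Nt] := leP (2 * t) N%:R.
  have y0 : 0 < N%:R - t by lra.
  have h := fC _ y0; rewrite ler_pdivlMr// in h.
  have [f0|f0] := leP (f (N%:R - t)) 0.
    apply: (@le_trans _ _ 0); last by nra.
    by rewrite mulr_le0_ge0//; lra.
  by nra.
have f' := f1 (N%:R - t).
apply: (@le_trans _ _ (1 + N%:R)); first by rewrite ler_piMl//; lra.
by nra.
Qed.

(** G is the antiderivative of g, normalised to have the limits 0 and 1 at the two
    ends of the line. Its increments over unit intervals inherit the decay of g by
    the mean value theorem; its increments over [- N - t, N - t] tend to 1 at the
    rate 1 / N, with a loss that is polynomial in t. *)
Lemma bump (g : nat -> R -> R) : jet g -> (forall x, 0 <= g 0%N x) -> 0 < g 0%N 0 ->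
  (forall k : R, 0 < k -> exists K, forall n t,
     k ^+ n * eA (k * `|t|) * `|g n t| <= K * (M n)%:num) ->
  exists G : nat -> R -> R,
  [/\ jet G,
   forall k : R, 0 < k -> exists K, forall n t,
     k ^+ n * eA (k * `|t|) * `|G n (t + 1) - G n t| <= K * (M n)%:num &
   forall k : R, 0 < k -> exists K, forall n t (N : nat),
     k ^+ n * `|(n == 0%N)%:R - (G n (N%:R - t) - G n (- N%:R - t))| <=
       K * ((1 + t ^+ 2) / (1 + N%:R)) * (M n)%:num].
Proof.
move=> gJ g_ge0 g00 gB.
have gc : continuous (g 0%N).
  by move=> x; apply/differentiable_continuous/derivable1_diffP; have [] := gJ 0%N x.
have [G0 G0d] := antiderivative gc.
have [Cq Cq0 HCq] := eA_quad A.
(* the exponential weight also yields the factor 1 + t^2, uniformly in k; for this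
   k is replaced by max k 1 *)
have gB' k : 0 < k -> exists2 K, 0 <= K & forall n t, k ^+ n * ((1 + t ^+ 2) * `|g n t|) <= K * (M n)%:num.
  move=> k0; have k10 : 0 < Num.max k 1 by rewrite lt_max k0.
  have [K HK] := gB _ k10.
  have K0 : 0 <= K.
    have : 0 <= K * (M 0%N)%:num.
      apply: le_trans (HK 0%N 0).
      by rewrite expr0 mul1r mulr_ge0// ltW// eA_gt0.
    by rewrite pmulr_lge0.
  exists (Cq * K) => [|n t]; first by rewrite mulr_ge0// ltW.
  have k1 : 1 <= Num.max k 1 by rewrite le_max lexx orbT.
  apply: le_trans (_ : Cq * (Num.max k 1 ^+ n * eA (Num.max k 1 * `|t|) * `|g n t|) <= _); last first.
    by rewrite -[leRHS]mulrA ler_wpM2l ?(ltW Cq0).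
  have -> : Cq * (Num.max k 1 ^+ n * eA (Num.max k 1 * `|t|) * `|g n t|) =
    Num.max k 1 ^+ n * (Cq * eA (Num.max k 1 * `|t|) * `|g n t|) by ring.
  rewrite ler_pM ?exprn_ge0 ?(ltW k0)//.
  - by rewrite mulr_ge0// addr_ge0// sqr_ge0.
  - by rewrite lerXn2r ?nnegrE ?(ltW k0) ?(ltW k10)// le_max lexx.
  rewrite ler_wpM2r// -[t ^+ 2]real_normK ?num_real//.
  rewrite (le_trans (HCq _ (normr_ge0 t)))// ler_wpM2l ?(ltW Cq0)// eA_mono//.
  by rewrite ler_peMl.
have [C1 C10 HC1] : exists2 C1 : R, 0 <= C1 & forall x, g 0%N x * (1 + x ^+ 2) <= C1.
  have [K K0 HK] := gB' 1 ltr01; exists (K * (M 0%N)%:num) => [|x]; first exact: mulr_ge0.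
  by have := HK 0%N x; rewrite expr0 mul1r mulrC ger0_norm.
have mono a b : a <= b -> G0 a <= G0 b.
  by move=> ab; apply: (deriv_ge0_mono G0d).
have tailp a b : 0 < a -> G0 b <= G0 a + C1 / a.
  move=> a0; have [ab|/ltW ba] := leP a b.
    by rewrite -lerBlDl; exact: quadratic_tail G0d g_ge0 C10 HC1 a0 ab.
  by rewrite (le_trans (mono _ _ ba))// lerDl divr_ge0// ltW.
have tailn a b : 0 < a -> G0 (- a) - C1 / a <= G0 b.
  move=> a0; have [ab|/ltW ba] := leP a (- b); last first.
    rewrite lerBlDr (@le_trans _ _ (G0 b))//; first by apply: mono; lra.
    by rewrite lerDl divr_ge0// ltW.
  have Nd (x : R) : is_derive x (1 : R) (fun t => - G0 (- t)) (g 0%N (- x)).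
    have h := @is_derive1_comp R G0 (fun t => - t) x (g 0%N (- x)) (- 1) (G0d (- x)) (is_deriveNid x (1 : R)).
    apply: (is_derive_eq (is_deriveN h)).
    by rewrite mulrN1 opprK.
  have := quadratic_tail Nd (fun x => g_ge0 (- x)) C10 _ a0 ab.
  rewrite opprK => h; have : - G0 b - - G0 (- a) <= C1 / a.
    by apply: h => x; have := HC1 (- x); rewrite sqrrN.
  by lra.
pose S := sup (range G0); pose I := inf (range G0).
have ubG : has_ubound (range G0) by exists (G0 1 + C1 / 1) => _ [x _ <-]; exact: tailp.
have lbG : has_lbound (range G0) by exists (G0 (- 1) - C1 / 1) => _ [x _ <-]; exact: tailn.
have GS x : G0 x <= S by apply: ub_le_sup => //; exists x.
have IG x : I <= G0 x by apply: ge_inf => //; exists x.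
have SG a : 0 < a -> S <= G0 a + C1 / a.
  move=> a0; apply: ge_sup; first by exists (G0 0), 0.
  by move=> _ [x _ <-]; exact: tailp.
have GI a : 0 < a -> G0 (- a) - C1 / a <= I.
  move=> a0; apply: lb_le_inf; first by exists (G0 0), 0.
  by move=> _ [x _ <-]; exact: tailn.
pose L := S - I.
have L0 : 0 < L.
  rewrite subr_gt0 ltNge; apply/negP => SI.
  (* otherwise G0 is constant, although its derivative at 0 is positive *)
  have Gc : G0 = cst S.
    by apply/funext => x; apply/le_anti; rewrite GS (le_trans SI (IG x)).
  have h : is_derive (0 : R) (1 : R) G0 0 by rewrite Gc; exact: is_derive_cst.
  have E : g 0%N 0 = 0.
    by have [_ e1] := G0d 0; have [_ e2] := h; rewrite -e1 e2.
  by move: g00; rewrite E ltxx.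
pose G (n : nat) (x : R) : R := if n is m.+1 then g m x / L else (G0 x - I) / L.
have GJ : jet G.
  have sc (f : R -> R) (x l b : R) : is_derive x (1 : R) f l ->
      is_derive x (1 : R) (fun y => (f y - b) / L) (l / L).
    move=> fl.
    have -> : (fun y => (f y - b) / L) = L^-1 *: (f - cst b).
      by apply/funext => y; rewrite mulrC.
    apply: (is_derive_eq (is_deriveZ L^-1 (is_deriveB fl (is_derive_cst b x (1 : R))))).
    by rewrite subr0 /GRing.scale /= mulrC.
  move=> [|n] x; first exact: sc (G0d x).
  have := sc (g n) x (g n.+1 x) 0 (gJ n x).
  by congr (is_derive _ _ _ _); apply/funext => y; rewrite subr0.
exists G; split=> // k k0.
- have k20 : 0 < 2 * k by rewrite mulr_gt0.
  have [K HK] := gB _ k20.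
  exists (eA (2 * k) * K / L) => n t.
  have t1 : t <= t + 1 by rewrite lerDl.
  have [x /andP[tx xt1] ->] := MVT_real (fun y _ => GJ n y) t1.
  rewrite [t + 1]addrC addrK mulr1 /= normrM [`|L^-1|]gtr0_norm ?invr_gt0//.
  rewrite mulrA ler_pdivrMr// [eA _ * K / L * _]mulrAC divfK ?gt_eqF//.
  have e1 : eA (k * `|t|) <= eA (2 * k) * eA (2 * k * `|x|).
    have tx' : `|t| <= 1 + `|x|.
      rewrite -lerBlDr (le_trans (lerB_dist _ _))// ler_norml; apply/andP; split; lra.
    apply: (@le_trans _ _ (eA (k + k * `|x|))).
      by rewrite eA_mono// -[X in X + _]mulr1 -mulrDr ler_wpM2l// ltW.
    have := eA_add A (ltW k0) (mulr_ge0 (ltW k0) (normr_ge0 x)).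
    by rewrite mulrA.
  apply: (@le_trans _ _ (eA (2 * k) * ((2 * k) ^+ n * eA (2 * k * `|x|) * `|g n x|))).
    have -> : eA (2 * k) * ((2 * k) ^+ n * eA (2 * k * `|x|) * `|g n x|) =
      (2 * k) ^+ n * (eA (2 * k) * eA (2 * k * `|x|)) * `|g n x| by ring.
    rewrite ler_wpM2r// ler_pM ?exprn_ge0 ?(ltW k0) ?(ltW (eA_gt0 _ _))//.
    by rewrite lerXn2r ?nnegrE ?(ltW k0) ?(ltW k20)//; lra.
  by rewrite -[leRHS]mulrA ler_wpM2l ?(ltW (eA_gt0 _ _)).
have C1L : 0 <= C1 / L by rewrite divr_ge0// ltW.
have [K K0 HK] := gB' k k0.
(* K1 serves the order 0, K2 the positive orders, where one index of M is lost
   because G n.+1 is a multiple of g n *)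
pose K1 : R := 8 * (1 + C1 / L) / (M 0%N)%:num.
pose K2 : R := 8 * (k * K / L * ((M 0%N)%:num / (M 1%N)%:num)).
have K10 : 0 <= K1 by rewrite divr_ge0// mulr_ge0// addr_ge0.
have K20 : 0 <= K2 by rewrite !mulr_ge0// ?invr_ge0 ltW.
exists (K1 + K2) => n t N.
have N0 : 0 <= N%:R :> R by [].
have Nn0 : 1 + N%:R != 0 :> R by rewrite gt_eqF// ltr_pwDl.
have Ln0 : L != 0 by rewrite gt_eqF.
have Mn0 : (M 0%N)%:num != 0 :> R by rewrite gt_eqF.
have Mn1 : (M 1%N)%:num != 0 :> R by rewrite gt_eqF.
have r0 : 0 <= (1 + t ^+ 2) / (1 + N%:R) by rewrite divr_ge0 ?addr_ge0 ?sqr_ge0.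
case: n => [|n].
  rewrite expr0 mul1r eqxx /=.
  have b1 : 1 - G 0%N (N%:R - t) <= 4 * (1 + C1 / L) * ((1 + t ^+ 2) / (1 + N%:R)).
    apply: (@window_bound (fun y => 1 - G 0%N y)) => // y.
      by rewrite gerBl /G divr_ge0 ?(ltW L0)// subr_ge0.
    move=> y0; have := SG y y0; rewrite /G => h.
    rewrite mulrAC ler_pdivlMr//.
    have -> : (1 - (G0 y - I) / L) * L = S - G0 y by rewrite /L; field; rewrite gt_eqF.
    by lra.
  have b2 : G 0%N (- N%:R - t) <= 4 * (1 + C1 / L) * ((1 + t ^+ 2) / (1 + N%:R)).
    have -> : - N%:R - t = - (N%:R - - t) by rewrite opprK opprD.
    rewrite -[t ^+ 2]sqrrN.
    apply: (@window_bound (fun y => G 0%N (- y))) => // y.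
      by rewrite /G ler_pdivrMr// mul1r lerB.
    move=> y0; have := GI y y0; rewrite /G => h.
    rewrite mulrAC ler_pdivlMr// divfK ?gt_eqF//; lra.
  have p1 : 0 <= 1 - G 0%N (N%:R - t).
    by rewrite subr_ge0 /G ler_pdivrMr// mul1r lerB.
  have p2 : 0 <= G 0%N (- N%:R - t) by rewrite /G divr_ge0 ?(ltW L0)// subr_ge0.
  have -> : 1%:R - (G 0%N (N%:R - t) - G 0%N (- N%:R - t)) =
     (1 - G 0%N (N%:R - t)) + G 0%N (- N%:R - t) by ring.
  rewrite ger0_norm; last exact: addr_ge0 p1 p2.
  have E : K1 * ((1 + t ^+ 2) / (1 + N%:R)) * (M 0%N)%:num =
     4 * (1 + C1 / L) * ((1 + t ^+ 2) / (1 + N%:R)) + 4 * (1 + C1 / L) * ((1 + t ^+ 2) / (1 + N%:R)).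
    by rewrite /K1; field; rewrite ?Nn0 ?Ln0 ?Mn0.
  rewrite [in leRHS]mulrDl mulrDl E.
  apply: le_trans (lerD b1 b2) _; rewrite lerDl.
  by apply: mulr_ge0 => //; exact: mulr_ge0 K20 r0.
have key y : (1 + N%:R) <= 4 * ((1 + (y : R) ^+ 2) * (1 + t ^+ 2)) ->
    k ^+ n.+1 * (`|g n y| / L) <= K2 / 2 * ((1 + t ^+ 2) / (1 + N%:R)) * (M n.+1)%:num.
  move=> hy.
  have y20 : 0 < 1 + y ^+ 2 by rewrite ltr_pwDl// sqr_ge0.
  have N10 : 0 < 1 + N%:R :> R by rewrite ltr_pwDl.
  have h1 := HK n y; have h2 := M1_step M1M n.
  have M10 : 0 < (M 1%N)%:num by [].
  have h3 : (M n)%:num <= (M 0%N)%:num / (M 1%N)%:num * (M n.+1)%:num.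
    by rewrite mulrAC ler_pdivlMr// mulrC.
  have h4 : k ^+ n * `|g n y| <= 4 * K * ((M 0%N)%:num / (M 1%N)%:num * (M n.+1)%:num) * ((1 + t ^+ 2) / (1 + N%:R)).
    rewrite [leRHS]mulrA ler_pdivlMr//.
    apply: (@le_trans _ _ (k ^+ n * `|g n y| * (4 * ((1 + y ^+ 2) * (1 + t ^+ 2))))).
      by rewrite ler_wpM2l// mulr_ge0// exprn_ge0// ltW.
    have -> : k ^+ n * `|g n y| * (4 * ((1 + y ^+ 2) * (1 + t ^+ 2))) =
       (k ^+ n * ((1 + y ^+ 2) * `|g n y|)) * (4 * (1 + t ^+ 2)) by ring.
    have -> : 4 * K * ((M 0%N)%:num / (M 1%N)%:num * (M n.+1)%:num) * (1 + t ^+ 2) =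
       (K * ((M 0%N)%:num / (M 1%N)%:num * (M n.+1)%:num)) * (4 * (1 + t ^+ 2)) by ring.
    rewrite ler_wpM2r ?mulr_ge0 ?addr_ge0 ?sqr_ge0//.
    by rewrite (le_trans h1)// ler_wpM2l.
  have -> : K2 / 2 * ((1 + t ^+ 2) / (1 + N%:R)) * (M n.+1)%:num =
    (4 * K * ((M 0%N)%:num / (M 1%N)%:num * (M n.+1)%:num) * ((1 + t ^+ 2) / (1 + N%:R))) * (k / L).
    by rewrite /K2; field; rewrite ?Nn0 ?Ln0 ?Mn0 ?Mn1.
  have -> : k ^+ n.+1 * (`|g n y| / L) = k ^+ n * `|g n y| * (k / L) by rewrite exprS; ring.
  by rewrite ler_wpM2r// divr_ge0// ltW.
rewrite sub0r normrN /G -mulrBl normrM [`|L^-1|]gtr0_norm ?invr_gt0//.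
apply: (@le_trans _ _ (k ^+ n.+1 * (`|g n (N%:R - t)| / L) + k ^+ n.+1 * (`|g n (- N%:R - t)| / L))).
  by rewrite -mulrDr ler_wpM2l ?exprn_ge0 ?(ltW k0)// -mulrDl ler_wpM2r ?invr_ge0 ?(ltW L0)// ler_normB.
have NN : N%:R <= N%:R ^+ 2 :> R by rewrite -natrX ler_nat; case: (N) => // m; rewrite expnS leq_pmulr.
have aux (a b : R) : 1 + (a + b) ^+ 2 <= 4 * ((1 + a ^+ 2) * (1 + b ^+ 2)).
  have p1 : 0 <= a ^+ 2 * b ^+ 2 by rewrite mulr_ge0 ?sqr_ge0.
  have p2 := sqr_ge0 a; have p3 := sqr_ge0 b; have p4 := sqr_ge0 (1 - a * b).
  have -> : (1 + a ^+ 2) * (1 + b ^+ 2) = (a + b) ^+ 2 + (1 - a * b) ^+ 2 by ring.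
  have e : (a + b) ^+ 2 + (1 - a * b) ^+ 2 = 1 + a ^+ 2 + b ^+ 2 + a ^+ 2 * b ^+ 2 by ring.
  have p5 := sqr_ge0 (a + b).
  by lra.
have q1 : 1 + N%:R <= 4 * ((1 + (N%:R - t) ^+ 2) * (1 + t ^+ 2)).
  by rewrite (le_trans _ (aux _ _))// subrK lerD2l.
have q2 : 1 + N%:R <= 4 * ((1 + (- N%:R - t) ^+ 2) * (1 + t ^+ 2)).
  by rewrite (le_trans _ (aux _ _))// subrK sqrrN lerD2l.
rewrite (le_trans (lerD (key _ q1) (key _ q2)))//.
have -> : K2 / 2 * ((1 + t ^+ 2) / (1 + N%:R)) * (M n.+1)%:num +
   K2 / 2 * ((1 + t ^+ 2) / (1 + N%:R)) * (M n.+1)%:num =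
   K2 * ((1 + t ^+ 2) / (1 + N%:R)) * (M n.+1)%:num by field; rewrite ?Nn0.
by rewrite ler_wpM2r// ler_wpM2r// lerDr.
Qed.

End Bump.

(** * A partition of unity by lattice translates *)

Section Lifts.
Context (R : realType) (d : nat).
Local Notation Rd := 'rV[R]_d.
Local Notation fct := ('rV[R]_d -> R[i]^o).
Implicit Types (x y : Rd) (s : seq 'I_d) (i j : 'I_d).
Implicit Types (M : nat -> {posnum R}).
Local Notation e_ i := (delta_mx 0 i : Rd).

Definition lift i (q : R -> R) : fct := fun x => (q (x 0 i))%:C.

Lemma continuous_lift i (q : R -> R) : continuous q -> continuous (lift i q).
Proof.
move=> cq x.
apply/(@cvgrPdist_lt R[i] R[i]^o _ (nbhs (x : Rd)) (nbhs_filter (x : Rd))) => e.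
rewrite ltcE /= => /andP[/eqP eim e0].
have -> : e = (complex.Re e)%:C by case: (e) eim => a b /= ->.
set r := complex.Re e in e0 *.
have /(@cvgrPdist_lt R R^o _ (nbhs (x 0 i : R)) (nbhs_filter (x 0 i : R))) h := cq (x 0 i).
have [del /= del0 Hd] := iffLR (nbhs_normP (x 0 i : R) _) (h _ e0).
apply: (iffRL (nbhs_normP (x : Rd) _)); exists del => //= y xy.
rewrite /lift -rmorphB cmodE cmod_real ltcR; apply: Hd => /=.
by apply: le_lt_trans xy; have := coord_le_norm (x - y) i; rewrite !mxE.
Qed.

Lemma jet_continuous (q : nat -> R -> R) n : jet q -> continuous (q n).
Proof.
by move=> qJ x; apply/differentiable_continuous/derivable1_diffP; have [] := qJ n x.
Qed.

Lemma lift_pderivs i (q : nat -> R -> R) : jet q ->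
  smooth (lift i (q 0%N)) /\ forall s, pderivs s (lift i (q 0%N)) =
    if all (pred1 i) s then lift i (q (size s)) else (cst 0 : fct).
Proof.
move=> qJ.
pose F s : fct := if all (pred1 i) s then lift i (q (size s)) else cst 0.
have F0 : F [::] = lift i (q 0%N) by [].
rewrite -F0; apply: smooth_jet => [s|s j x]; rewrite /F.
  case: ifP => _; last exact: cst_continuous.
  by apply: continuous_lift; exact: jet_continuous.
rewrite /=; have [all_s|_] := ifP; last by rewrite andbF; exact: is_pd_cst.
rewrite andbT; have [->|ji] := eqVneq j i.
  split; last exact: is_derive_cst.
  have [d1 d2] := qJ (size s) (x 0 i).
  have E : (fun h : R => h^-1 *: (((fun y => q (size s) (y 0 i)) \o shift x) (h *: (e_ i)) - q (size s) (x 0 i))) =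
    (fun h : R => h^-1 *: ((q (size s) \o shift (x 0 i)) (h *: (1 : R)) - q (size s) (x 0 i))).
    by apply/funext => h /=; rewrite !mxE !eqxx.
  by split; [rewrite /derivable E|rewrite /derive E].
split; last exact: is_derive_cst.
have E : (fun h : R => h^-1 *: (((fun y => q (size s) (y 0 i)) \o shift x) (h *: (e_ j)) - q (size s) (x 0 i))) = cst 0.
  apply/funext => h /=; rewrite !mxE eqxx [i == j]eq_sym (negbTE ji) mulr0 add0r subrr scaler0 //.
split; first by rewrite /derivable E; exact: is_cvg_cst.
by rewrite /derive E; apply/cvg_lim => //; exact: cvg_cst.
Qed.

Lemma bnd_lift M i (q : nat -> R -> R) (k K : R) (w : R -> R) : jet q ->
  (forall t, 0 <= w t) -> 0 <= k ->
  (forall n t, k ^+ n * w t * `|q n t| <= K * (M n)%:num) ->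
  bnd M k (fun x => w (x 0 i)) K (lift i (q 0%N)).
Proof.
move=> qJ w0 k0 H; have [sl El] := lift_pderivs i qJ.
split=> // s x; rewrite El; case: ifP => _; first by rewrite /lift cmod_real; exact: H.
rewrite cmod0 mulr0; apply: le_trans (H (size s) 0).
by rewrite !mulr_ge0// exprn_ge0.
Qed.

Lemma pderivs_cst s (a : R[i]) :
  smooth (cst a : fct) /\ pderivs s (cst a : fct) = if nilp s then cst a else cst 0.
Proof.
pose F s : fct := if nilp s then cst a else cst 0.
have [|s' i x|sc Ec] := @smooth_jet R d F.
- by move=> s'; rewrite /F; case: ifP => _; exact: cst_continuous.
- by rewrite /F /=; case: ifP => _; exact: is_pd_cst.
- by split=> //; have := Ec s.
Qed.

Lemma bnd_cst M (k : R) (a : R[i]) : 0 <= k ->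
  bnd M k (fun _ : Rd => 1) (cmod a / (M 0%N)%:num) (cst a).
Proof.
move=> k0; split=> [|s x]; first by have [] := pderivs_cst [::] a.
have [_ ->] := pderivs_cst s a; case: s => [|i s] /=.
  by rewrite expr0 !mul1r divfK// gt_eqF.
by rewrite [X in _ * X <= _]cmod0 mulr0 mulr_ge0// divr_ge0// cmod_ge0.
Qed.

(** Norms with parameter 2 k control products in norms with parameter k, and the
    weights multiply. *)
Lemma bnd_mul M (k K K' : R) (v w : Rd -> R) (f g : fct) : cond_M1 M -> 0 < k ->
  (forall x, 0 < v x) -> (forall x, 0 < w x) ->
  bnd M (2 * k) v K f -> bnd M (2 * k) w K' g ->
  bnd M k (fun x => v x * w x) ((M 0%N)%:num * K * K') (fun x => f x * g x).
Proof.
move=> M1 k0 v0 w0 bf bg; have [sf Hf] := bf; have [sg Hg] := bg.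
have K0 : 0 <= K by apply: bnd_ge0 bf => x; exact: ltW.
have K'0 : 0 <= K' by apply: bnd_ge0 bg => x; exact: ltW.
have k20 : 0 < 2 * k by rewrite mulr_gt0.
have [sp _] := leibniz sf sg.
split=> // s x.
have key (u : Rd -> R) (L : R) (h : fct) : 0 < u x -> (forall s x,
     (2 * k) ^+ size s * u x * cmod (pderivs s h x) <= L * (M (size s))%:num) ->
     forall s, cmod (pderivs s h x) <= L / u x * ((2 * k)^-1 ^+ size s * (M (size s))%:num).
  move=> u0 H s'; have := H s' x.
  rewrite mulrAC -ler_pdivlMr// -ler_pdivlMl ?exprn_gt0// => /le_trans; apply.
  rewrite le_eqVlt; apply/orP; left; apply/eqP.
  have k1 : k != 0 by rewrite gt_eqF.
  have u1 : u x != 0 by rewrite gt_eqF.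
  by rewrite exprVn; field; rewrite ?expf_neq0 ?mulf_neq0 ?k1 ?u1.
have r0 : 0 <= (2 * k)^-1 by rewrite invr_ge0 ltW.
have a0 : 0 <= K / v x by rewrite divr_ge0// ltW.
have b0 : 0 <= K' / w x by rewrite divr_ge0// ltW.
have := leibniz_bound s M1 sf sg a0 b0 r0 (key v K f (v0 x) Hf) (key w K' g (w0 x) Hg).
set D := cmod _ => HD.
have vw0 : 0 < v x * w x by rewrite mulr_gt0.
rewrite mulrAC -ler_pdivlMr// -ler_pdivlMl ?exprn_gt0//.
apply: le_trans HD _; rewrite le_eqVlt; apply/orP; left; apply/eqP.
have -> : 2 * (2 * k)^-1 = k^-1 by field; rewrite gt_eqF.
have k1 : k != 0 by rewrite gt_eqF.
have v1 : v x != 0 by rewrite gt_eqF.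
have w1 : w x != 0 by rewrite gt_eqF.
by rewrite exprVn; field; rewrite ?expf_neq0 ?mulf_neq0 ?k1 ?v1 ?w1.
Qed.

End Lifts.

Section PartitionOfUnity.
Context (R : realType) (d : nat) (M A : weight_sequence R) (M1M : cond_M1 M).
Local Notation Rd := 'rV[R]_d.
Local Notation fct := ('rV[R]_d -> R[i]^o).
Implicit Types (x y : Rd) (s : seq 'I_d) (i j : 'I_d) (r : seq 'I_d).
Local Notation eA := (eA A).
Context (G : 'I_d -> nat -> R -> R).
Hypothesis GJ : forall i, jet (G i).
Hypothesis GT : forall i (k : R), 0 < k -> exists K, forall n t,
  k ^+ n * eA (k * `|t|) * `|G i n (t + 1) - G i n t| <= K * (M n)%:num.
Hypothesis GU : forall i (k : R), 0 < k -> exists K, forall n t (N : nat),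
  k ^+ n * `|(n == 0%N)%:R - (G i n (N%:R - t) - G i n (- N%:R - t))| <=
    K * ((1 + t ^+ 2) / (1 + N%:R)) * (M n)%:num.

Definition theta i n (t : R) : R := G i n (t + 1) - G i n t.
Definition window i (N n : nat) (t : R) : R :=
  (-1) ^+ n * (G i n (N%:R - t) - G i n (- N%:R - t)).
Definition unwindow i (N n : nat) (t : R) : R := (n == 0%N)%:R - window i N n t.

Lemma theta_jet i : jet (theta i).
Proof.
move=> n x; apply: is_deriveB; last exact: GJ.
have h := @is_derive1_comp R (G i n) (fun t => t + 1) x (G i n.+1 (x + 1)) 1 (GJ i n (x + 1)).
apply: (is_derive_eq (h _)); last by rewrite mulr1.
apply: (is_derive_eq (is_deriveD (is_derive_id x (1 : R)) (is_derive_cst (1 : R) x (1 : R)))).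
by rewrite addr0.
Qed.

Lemma window_jet i N : jet (window i N).
Proof.
move=> n x.
have h (a : R) : is_derive x (1 : R) (fun t : R => G i n (a - t)) (- G i n.+1 (a - x)).
  have h := @is_derive1_comp R (G i n) (fun t => a - t) x (G i n.+1 (a - x)) (- 1) (GJ i n (a - x)).
  apply: (is_derive_eq (h _)); last by rewrite mulrN1.
  apply: (is_derive_eq (is_deriveD (is_derive_cst (a : R) x (1 : R)) (is_deriveNid x (1 : R)))).
  by rewrite add0r.
apply: (is_derive_eq (is_deriveZ ((-1) ^+ n) (is_deriveB (h N%:R) (h (- N%:R))))).
by rewrite /window /GRing.scale /= exprS; ring.
Qed.

Lemma unwindow_jet i N : jet (unwindow i N).
Proof.
move=> n x; apply: (is_derive_eq (is_deriveB (is_derive_cst ((n == 0%N)%:R : R) x (1 : R)) (window_jet i N n x))).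
by [].
Qed.

Lemma unwindow_bound i (k : R) : 0 < k -> exists2 K, 0 <= K & forall n t N,
  k ^+ n * (1 + t ^+ 2)^-1 * `|unwindow i N n t| <= K / (1 + N%:R) * (M n)%:num.
Proof.
move=> k0; have [K HK] := GU i k0; exists `|K| => // n t N.
have t0 : 0 < 1 + t ^+ 2 by rewrite ltr_pwDl// sqr_ge0.
have N0 : 0 < 1 + N%:R :> R by rewrite ltr_pwDl.
rewrite mulrAC ler_pdivrMr//.
have -> : `|unwindow i N n t| = `|(n == 0%N)%:R - (G i n (N%:R - t) - G i n (- N%:R - t))|.
  case: n {HK} => [|n]; first by rewrite /unwindow /window expr0 mul1r.
  by rewrite /unwindow /window !sub0r !normrN normrM normrX normrN1 expr1n mul1r.
apply: le_trans (HK n t N) _.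
have -> : K * ((1 + t ^+ 2) / (1 + N%:R)) * (M n)%:num =
  K * ((1 + t ^+ 2) / (1 + N%:R) * (M n)%:num) by ring.
have -> : `|K| / (1 + N%:R) * (M n)%:num * (1 + t ^+ 2) =
  `|K| * ((1 + t ^+ 2) / (1 + N%:R) * (M n)%:num) by ring.
by rewrite ler_wpM2r ?ler_norm// mulr_ge0// divr_ge0// ltW.
Qed.

Definition chi_ r : fct := fun x => \prod_(i <- r) lift i (theta i 0) x.
Definition window_ r N : fct := fun x => \prod_(i <- r) lift i (window i N 0) x.

Lemma chi_bnd r (k : R) : 0 < k ->
  exists K, bnd M k (fun x => \prod_(i <- r) eA (k * `|x 0 i|)) K (chi_ r).
Proof.
elim: r k => [|i r IH] k k0.
  have -> : chi_ [::] = cst 1 by apply/funext => x; rewrite /chi_ big_nil.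
  exists (cmod (1 : R[i]) / (M 0%N)%:num); apply: bnd_mono (bnd_cst d M 1 (ltW k0)) _ _ _ _ => //.
  - by rewrite lexx ltW.
  - by move=> x; rewrite big_nil.
  - by move=> x; rewrite big_nil.
have k20 : 0 < 2 * k by rewrite mulr_gt0.
have [K HK] := IH _ k20; have [K' HK'] := GT i k20.
have -> : chi_ (i :: r) = (fun x => lift i (theta i 0) x * chi_ r x).
  by apply/funext => x; rewrite /chi_ big_cons.
have Li : bnd M (2 * k) (fun x : Rd => eA (2 * k * `|x 0 i|)) K' (lift i (theta i 0)).
  apply: (@bnd_lift R d M i (theta i) (2 * k) K' (fun t => eA (2 * k * `|t|))) => //.
  - exact: theta_jet.
  - by move=> t; exact: ltW (eA_gt0 _ _).
  - exact: ltW.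
have prod0 (c : R) x : 0 < \prod_(j <- r) eA (c * `|x 0 j|).
  by apply: prodr_gt0 => j _; exact: eA_gt0.
exists ((M 0%N)%:num * K' * K).
apply: (bnd_mono (bnd_mul M1M k0 _ (prod0 (2 * k)) Li HK)).
- by move=> x; exact: eA_gt0.
- by rewrite lexx ltW.
- by move=> x; apply: prodr_ge0 => j _; exact: ltW (eA_gt0 _ _).
- move=> x; have e2 j : eA (k * `|x 0 j|) <= eA (2 * k * `|x 0 j|).
    by rewrite eA_mono// ler_wpM2r//; lra.
  rewrite big_cons; apply: ler_pM; rewrite ?(ltW (eA_gt0 _ _)) ?(ltW (prod0 _ _))//.
  by apply: ler_prod => j _; rewrite e2 (ltW (eA_gt0 _ _)).
- exact: lexx.
Qed.

(** Some coordinate is at least enorm x / (d + 1) in absolute value, and the factors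
    of the other coordinates are at least 1. *)
Lemma prod_eA_ge x (k : R) : 0 <= k -> eA (k * enorm x) <= \prod_i eA (k * d.+1%:R * `|x 0 i|).
Proof.
move=> k0.
have e1 i : 1 <= eA (k * d.+1%:R * `|x 0 i|) by rewrite eA_ge1// !mulr_ge0.
have prod1 (P : pred 'I_d) : 1 <= \prod_(i | P i) eA (k * d.+1%:R * `|x 0 i|).
  by elim/big_rec: _ => // i y _ y1; rewrite mulr_ege1.
have en : enorm x <= \sum_i `|x 0 i|.
  have s0 : 0 <= \sum_i `|x 0 i| by exact: sumr_ge0.
  rewrite -[leRHS]ger0_norm// -sqrtr_sqr ler_wsqrtr//.
  rewrite expr2 mulr_suml; apply: ler_sum => i _.
  rewrite -[_ ^+ 2]ger0_norm ?sqr_ge0// normrX expr2 ler_wpM2l//.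
  by rewrite (bigD1 i)//= lerDl sumr_ge0.
have [[i xi]|H] := pselect (exists i, enorm x <= d.+1%:R * `|x 0 i|).
  rewrite (bigD1 i)//= -[leLHS]mulr1 ler_pM ?(ltW (eA_gt0 _ _))//.
    by rewrite eA_mono// -mulrA ler_wpM2l.
have xlt i : d.+1%:R * `|x 0 i| <= enorm x.
  by rewrite leNgt; apply/negP => lt; apply: H; exists i; exact: ltW.
have : d.+1%:R * enorm x <= d%:R * enorm x.
  apply: (@le_trans _ _ (d.+1%:R * \sum_i `|x 0 i|)); first by rewrite ler_wpM2l.
  rewrite mulr_sumr; apply: le_trans (ler_sum _ (fun i _ => xlt i)) _.
  by rewrite sumr_const card_ord -[leLHS]mulr_natl.
rewrite -natr1 mulrDl mul1r gerDl => x0.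
have -> : enorm x = 0 by apply/le_anti; rewrite x0 enorm_ge0.
by rewrite natr1 mulr0 eA0; exact: (prod1 xpredT).
Qed.

Definition chi : fct := chi_ (index_enum 'I_d).

Lemma chi_GS (k : {posnum R}) : exists K, bnd M k%:num (gsw A k) K chi.
Proof.
have k0 : 0 < k%:num * d.+1%:R :> R by rewrite mulr_gt0.
have [K HK] := chi_bnd (index_enum 'I_d) k0; exists K; apply: (bnd_mono HK) => //.
- by apply/andP; split=> //; rewrite ler_peMr// ler1n.
- by move=> x; exact: gsw_ge0.
- by move=> x; apply: prod_eA_ge.
Qed.

Lemma prod_quad_gt0 r x : 0 < \prod_(i <- r) (1 + x 0 i ^+ 2)^-1.
Proof. by apply: prodr_gt0 => i _; rewrite invr_gt0 ltr_pwDl// sqr_ge0. Qed.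

Lemma quad_le1 x i : (1 + x 0 i ^+ 2)^-1 <= 1.
Proof. by rewrite invf_le1 ?lerDl ?sqr_ge0// ltr_pwDl// sqr_ge0. Qed.

Lemma quad_ge0 x i : 0 <= (1 + x 0 i ^+ 2)^-1.
Proof. by rewrite invr_ge0 addr_ge0// sqr_ge0. Qed.

Lemma prod_quad_le1 r x : \prod_(i <- r) (1 + x 0 i ^+ 2)^-1 <= 1.
Proof.
elim: r => [|i r IH]; first by rewrite big_nil.
by rewrite big_cons mulr_ile1 ?quad_ge0 ?quad_le1// ltW// prod_quad_gt0.
Qed.

(** Induction on the coordinates with 1 - p P = (1 - p) + (1 - P) - (1 - p) (1 - P). *)
Lemma window_cvg r (k : R) : 0 < k -> exists2 K, 0 <= K & forall N : nat,
  bnd M k (fun x => \prod_(i <- r) (1 + x 0 i ^+ 2)^-1) (K / (1 + N%:R))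
    (fun x => 1 - window_ r N x).
Proof.
elim: r k => [|i r IH] k k0.
  exists 0 => // N.
  have -> : (fun x => 1 - window_ [::] N x) = cst 0 :> fct.
    by apply/funext => x; rewrite /window_ big_nil subrr.
  apply: (bnd_mono (bnd_cst d M 0 (ltW k0))).
  - by rewrite lexx ltW.
  - by move=> x; exact: ltW (prod_quad_gt0 _ _).
  - by move=> x; exact: prod_quad_le1.
  - by rewrite cmod0 !mul0r.
have k20 : 0 < 2 * k by rewrite mulr_gt0.
have [K' K'0 H1] := IH _ k20.
have [K K0 HK] := unwindow_bound i k20.
exists (K + K' + (M 0%N)%:num * K * K') => [|N]; first by rewrite !addr_ge0// !mulr_ge0.
have N10 : 0 < 1 + N%:R :> R by rewrite ltr_pwDl.
have Li : bnd M (2 * k) (fun x : Rd => (1 + x 0 i ^+ 2)^-1) (K / (1 + N%:R))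
    (lift i (unwindow i N 0)).
  apply: (@bnd_lift R d M i (unwindow i N) (2 * k) _ (fun t => (1 + t ^+ 2)^-1)).
  - exact: unwindow_jet.
  - by move=> t; rewrite invr_ge0 addr_ge0// sqr_ge0.
  - exact: ltW.
  - by move=> n t; exact: HK.
have LU := H1 N.
have g0 x : 0 < (1 + x 0 i ^+ 2)^-1 by rewrite invr_gt0 ltr_pwDl// sqr_ge0.
have Lm := bnd_mul M1M k0 g0 (prod_quad_gt0 r) Li LU.
pose w x := \prod_(j <- i :: r) (1 + x 0 j ^+ 2)^-1.
have w0 x : 0 <= w x by exact: ltW (prod_quad_gt0 _ _).
have kk : 0 <= k <= 2 * k by rewrite ltW//=; lra.
have L1 : bnd M k w (K / (1 + N%:R)) (lift i (unwindow i N 0)).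
  apply: (bnd_mono Li) => //.
  by move=> x; rewrite /w big_cons ler_piMr ?prod_quad_le1// quad_ge0.
have L2 : bnd M k w (K' / (1 + N%:R)) (fun x => 1 - window_ r N x).
  apply: (bnd_mono LU) => //.
  by move=> x; rewrite /w big_cons ler_piMl ?quad_le1// ltW// prod_quad_gt0.
have L3 : bnd M k w ((M 0%N)%:num * K * K' / (1 + N%:R))
    (fun x => lift i (unwindow i N 0) x * (1 - window_ r N x)).
  apply: (bnd_mono Lm) => //.
  - by rewrite lexx ltW.
  - by move=> x; rewrite /w big_cons.
  - have -> : (M 0%N)%:num * (K / (1 + N%:R)) * (K' / (1 + N%:R)) =
      (M 0%N)%:num * K * K' / (1 + N%:R) * (1 + N%:R)^-1 by ring.
    rewrite ler_piMr//; last by rewrite invf_le1// lerDl.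
    by rewrite divr_ge0 ?(ltW N10)// !mulr_ge0.
have := bndB w0 (ltW k0) (bnd_comb 1 w0 (ltW k0) L1 L2) L3.
have -> : cmod (1 : R[i]) * (K / (1 + N%:R)) + K' / (1 + N%:R) +
    (M 0%N)%:num * K * K' / (1 + N%:R) = (K + K' + (M 0%N)%:num * K * K') / (1 + N%:R).
  by rewrite cmod1; ring.
congr (bnd _ _ _ _ _); apply/funext => x; rewrite /window_ big_cons.
set P := \prod_(j <- r) _.
have -> : lift i (unwindow i N 0) x = 1 - lift i (window i N 0) x.
  by rewrite /lift /unwindow eqxx rmorphB.
ring.
Qed.

Definition lattice N (k : {ffun 'I_d -> 'I_(N.*2)}) : Rd :=
  \row_i ((k i : nat)%:R - N%:R).

(** In each coordinate the sum telescopes; distributing the product over the sums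
    gives a sum over the lattice. *)
Lemma window_sum N x :
  window_ (index_enum 'I_d) N x = \sum_(k : {ffun 'I_d -> 'I_(N.*2)}) chi (lattice k - x).
Proof.
have E i : lift i (window i N 0) x = \sum_(j < N.*2) (theta i 0 (j%:R - N%:R - x 0 i))%:C.
  rewrite -rmorph_sum /lift; congr (_%:C).
  rewrite (eq_bigr (fun j : 'I_(N.*2) => G i 0 (j.+1%:R - N%:R - x 0 i) - G i 0 (j%:R - N%:R - x 0 i))); last first.
    by move=> j _; rewrite /theta -natr1; congr (G _ _ _ - _); ring.
  rewrite -(big_mkord xpredT (fun m : nat => G i 0 (m.+1%:R - N%:R - x 0 i) - G i 0 (m%:R - N%:R - x 0 i))).
  rewrite (@telescope_sumr _ 0%N N.*2 (fun m : nat => G i 0 (m%:R - N%:R - x 0 i)))//.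
  by rewrite /window expr0 mul1r -addnn natrD addrK sub0r.
rewrite /window_ (eq_bigr _ (fun i _ => E i)) bigA_distr_bigA /=.
apply: eq_bigr => k _; rewrite /chi /chi_; apply: eq_bigr => i _.
by rewrite /lift !mxE.
Qed.

End PartitionOfUnity.

(** * Existence of the partition of unity *)

Section BumpFromSpace.
Context (R : realType) (d : nat) (M A : weight_sequence R) (M1M : cond_M1 M).
Local Notation Rd := 'rV[R]_d.
Local Notation fct := ('rV[R]_d -> R[i]^o).
Implicit Types (x y : Rd) (s : seq 'I_d) (i j : 'I_d).
Local Notation e_ i := (delta_mx 0 i : Rd).

Definition dbl (k : {posnum R}) : {posnum R} := (2 * k%:num)%:pos.

Lemma smooth_conj (f : fct) : smooth f ->
  smooth (fun x => (f x)^*%C : R[i]^o) /\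
  forall s, pderivs s (fun x => (f x)^*%C : R[i]^o) = (fun x => (pderivs s f x)^*%C).
Proof.
move=> sf; pose F s : fct := fun x => (pderivs s f x)^*%C.
apply: (@smooth_jet R d F) => [s|s i x]; last by apply: is_pd_conj; exact: smooth_pd.
have [_ cf] := sf s; have cs := (sf s).1 => x.
apply/(@cvgrPdist_lt R[i] R[i]^o _ (nbhs (x : Rd)) (nbhs_filter (x : Rd))) => e e0.
have /(@cvgrPdist_lt R[i] R[i]^o _ (nbhs (x : Rd)) (nbhs_filter (x : Rd))) h := cs x.
apply: filterS (h e e0) => y; rewrite /F -rmorphB.
by rewrite !normc_def /=; case: (_ - _) => a b /=; rewrite sqrrN.
Qed.

Lemma cmod_conj (z : R[i]) : cmod (z^*%C) = cmod z.
Proof. by case: z => a b; rewrite /cmod /= sqrrN. Qed.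

Lemma mul_conj (z : R[i]) : complex.Re (z * z^*%C) = cmod z ^+ 2.
Proof.
case: z => a b; rewrite /cmod /= sqr_sqrtr ?addr_ge0 ?sqr_ge0//; ring.
Qed.

(** |phi|^2 restricted to a line is a nonnegative function of one variable with
    the decay and the derivative bounds of the space. *)
Lemma bump_exists (phi : fct) i : (exists x, phi x <> 0) ->
  (forall k, exists K, Gs M A k K phi) ->
  exists G : nat -> R -> R,
  [/\ jet G,
   forall k : R, 0 < k -> exists K, forall n t,
     k ^+ n * eA A (k * `|t|) * `|G n (t + 1) - G n t| <= K * (M n)%:num &
   forall k : R, 0 < k -> exists K, forall n t (N : nat),
     k ^+ n * `|(n == 0%N)%:R - (G n (N%:R - t) - G n (- N%:R - t))| <=
       K * ((1 + t ^+ 2) / (1 + N%:R)) * (M n)%:num].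
Proof.
move=> [x0 phi0] Hphi.
have sphi : smooth phi by have [K []] := Hphi 1%:pos.
have [sc Ec] := smooth_conj sphi.
pose rho : fct := fun x => phi x * (phi x)^*%C.
have rhoB (k : {posnum R}) : exists K, bnd M k%:num (gsw A k) K rho.
  pose k2 := dbl k.
  have [K HK] := Hphi k2; rewrite GsE in HK.
  have HK' : bnd M (2 * k%:num) (gsw A k2) K (fun x => (phi x)^*%C).
    by split=> // s x; rewrite Ec cmod_conj; exact: HK.2.
  exists ((M 0%N)%:num * K * K).
  have g0 x : 0 < gsw A k2 x by exact: gsw_gt0.
  apply: (bnd_mono (bnd_mul M1M (gt0 k) g0 g0 HK HK')) => //.
  - by rewrite lexx ltW.
  - by move=> x; exact: gsw_ge0.
  - move=> x; rewrite -[leLHS]mulr1; apply: ler_pM => //; first exact: gsw_ge0.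
      by rewrite /gsw eA_mono// ler_wpM2r ?enorm_ge0//= ler_peMl// ler1n.
    by rewrite /gsw eA_ge1// mulr_ge0// enorm_ge0.
have srho : smooth rho by have [K []] := rhoB 1%:pos.
(* the n-th derivative of |phi|^2 along the line through x0, since |phi|^2 is real *)
pose g (n : nat) (t : R) : R := complex.Re (pderivs (nseq n i) rho (x0 + t *: e_ i)).
have gE t : g 0%N t = cmod (phi (x0 + t *: e_ i)) ^+ 2 by rewrite /g /= /rho mul_conj.
apply: (@bump R M A M1M g).
- move=> n t; apply: (@is_derive_line R d (fun x => complex.Re (pderivs (nseq n i) rho x))).
  exact: (smooth_pd (nseq n i) i _ srho).1.
- by move=> t; rewrite gE sqr_ge0.
- rewrite gE scale0r addr0 exprn_gt0// lt_neqAle cmod_ge0 andbT eq_sym.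
  by apply/eqP => /(ComplexField.Normc.eq0_normc); exact: phi0.
- move=> k k0; pose kp := PosNum k0; pose k2 := dbl kp.
  have [K [_ HK]] := rhoB k2.
  pose E0 := eA A (2 * (k * `|x0 0 i|)).
  exists (E0 * K) => n t; set x := x0 + t *: e_ i.
  have tx : `|t| <= `|x0 0 i| + enorm x.
    have -> : t = x 0 i - x0 0 i by rewrite /x !mxE !eqxx mulr1 addrAC subrr add0r.
    by rewrite [leRHS]addrC (le_trans (ler_normB _ _))// lerD2r coord_enorm.
  have e1 : eA A (k * `|t|) <= E0 * gsw A k2 x.
    apply: (@le_trans _ _ (eA A (k * `|x0 0 i| + k * enorm x))).
      by rewrite eA_mono// -mulrDr ler_wpM2l// ltW.
    rewrite /E0 /gsw /= -mulrA; apply: eA_add; first by rewrite mulr_ge0// ltW.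
    by rewrite mulr_ge0 ?enorm_ge0// ltW.
  have := HK (nseq n i) x; rewrite size_nseq => h.
  rewrite -[leRHS]mulrA; apply: le_trans (ler_wpM2l (ltW (eA_gt0 A _)) h).
  have -> : E0 * (k2%:num ^+ n * gsw A k2 x * cmod (pderivs (nseq n i) rho x)) =
    k2%:num ^+ n * (E0 * gsw A k2 x) * cmod (pderivs (nseq n i) rho x) by ring.
  apply: ler_pM => //; last exact: cmod_Re.
    by rewrite mulr_ge0 ?exprn_ge0 ?(ltW k0)// ltW// eA_gt0.
  apply: ler_pM => //; first by rewrite exprn_ge0// ltW.
    exact: ltW (eA_gt0 _ _).
  have kk : k <= k2%:num by rewrite -[k2%:num]/(2 * k) ler_peMl ?(ltW k0)// ler1n.
  by apply: lerXn2r => //; rewrite nnegrE ltW.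
Qed.

Lemma partition_of_unity (phi : fct) : (exists x, phi x <> 0) ->
  (forall k, exists K, Gs M A k K phi) ->
  exists (ch : fct) (P : nat -> fct),
  [/\ forall k : {posnum R}, exists K, bnd M k%:num (gsw A k) K ch,
    forall N x, P N x = \sum_(k : {ffun 'I_d -> 'I_(N.*2)}) ch (lattice R k - x) &
    forall k : R, 0 < k -> exists2 K, 0 <= K & forall N : nat,
      bnd M k (fun x => \prod_i (1 + x 0 i ^+ 2)^-1) (K / (1 + N%:R)) (fun x => 1 - P N x)].
Proof.
move=> phi0 Hphi.
have /choice[G HG] := fun i => bump_exists i phi0 Hphi.
have GJ i : jet (G i) by have [] := HG i.
have GT i := let: And3 _ h _ := HG i in h.
have GU i := let: And3 _ _ h := HG i in h.
exists (chi G), (fun N => window_ G (index_enum 'I_d) N); split.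
- exact: chi_GS.
- by move=> N x; exact: window_sum.
- by move=> k k0; exact: window_cvg.
Qed.

End BumpFromSpace.

Section LatticeSums.
Context (R : realType).

(** The summand is at most 3 / ((m + 1) (m + 2)), which telescopes. *)
Lemma quad_sum_half N : \sum_(m < N) (1 + (m%:R : R) ^+ 2)^-1 <= 3 * (1 - (N%:R + 1)^-1).
Proof.
elim: N => [|N IH]; first by rewrite big_ord0 add0r invr1 subrr mulr0.
rewrite big_ord_recr /= (le_trans (lerD IH (lexx _)))// -[N.+1%:R]natr1.
set a : R := N%:R.
have a0 : 0 <= a by [].
have a1 : 0 < a + 1 by rewrite ltr_wpDl.
have a2 : 0 < a + 1 + 1 by rewrite ltr_wpDl// ltW.
have aq : 0 < 1 + a ^+ 2 by rewrite ltr_pwDl// sqr_ge0.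
have aa : 0 <= (2 * a - 1) * (a - 1).
  rewrite /a; case: N {IH a a0 a1 a2 aq} => [|N]; first by rewrite mulr0 !sub0r mulrNN mulr1.
  have : 1 <= N.+1%:R :> R by rewrite ler1n.
  by move=> h; rewrite mulr_ge0//; lra.
rewrite -subr_ge0.
have -> : 3 * (1 - (a + 1 + 1)^-1) - (3 * (1 - (a + 1)^-1) + (1 + a ^+ 2)^-1) =
   ((2 * a - 1) * (a - 1)) / ((a + 1) * (a + 1 + 1) * (1 + a ^+ 2)).
  have n1 : a + 1 != 0 by rewrite gt_eqF.
  have n2 : a + 1 + 1 != 0 by rewrite gt_eqF.
  have n3 : 1 + a ^+ 2 != 0 by rewrite gt_eqF.
  by field; rewrite ?n1 ?n2 ?n3.
by rewrite divr_ge0// ltW// !mulr_gt0.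
Qed.

Lemma quad_sum N : \sum_(m < N) (1 + (m%:R : R) ^+ 2)^-1 <= 3.
Proof.
apply: le_trans (quad_sum_half N) _.
by rewrite -[leRHS]mulr1 ler_wpM2l// gerBl invr_ge0 addr_ge0.
Qed.

Lemma quad_sum_sym N : \sum_(j < N.*2) (1 + ((j%:R : R) - N%:R) ^+ 2)^-1 <= 6.
Proof.
rewrite -(big_mkord xpredT (fun j => (1 + ((j%:R : R) - N%:R) ^+ 2)^-1)).
rewrite (@big_cat_nat _ _ _ N) ?leq0n//=; last by rewrite -addnn leq_addr.
have -> : 6 = 3 + 3 :> R by rewrite -natrD.
apply: lerD.
  rewrite big_nat_rev /= add0n big_mkord; apply: le_trans (quad_sum N).
  apply: ler_sum => j _.
  rewrite natrB; last exact: ltn_ord.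
  rewrite addrAC subrr sub0r sqrrN lef_pV2 ?posrE ?ltr_pwDl ?sqr_ge0// lerD2l.
  by rewrite lerXn2r ?nnegrE// ler_nat.
rewrite -{1}[N]add0n big_addn -addnn addnK big_mkord; apply: le_trans (quad_sum N).
by apply: ler_sum => j _; rewrite natrD addrK.
Qed.

Lemma lattice_sum d N : \sum_(k : {ffun 'I_d -> 'I_(N.*2)})
  \prod_i (1 + (lattice R k) 0 i ^+ 2)^-1 <= 6 ^+ d.
Proof.
have -> : \sum_(k : {ffun 'I_d -> 'I_(N.*2)}) \prod_i (1 + (lattice R k) 0 i ^+ 2)^-1 =
    \prod_(i < d) \sum_(j < N.*2) (1 + ((j%:R : R) - N%:R) ^+ 2)^-1.
  rewrite bigA_distr_bigA /=; apply: eq_bigr => k _.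
  by apply: eq_bigr => i _; rewrite mxE.
rewrite prodr_const card_ord lerXn2r ?nnegrE ?quad_sum_sym//.
by apply: sumr_ge0 => j _; rewrite invr_ge0 addr_ge0// sqr_ge0.
Qed.

End LatticeSums.

(** * Reconstruction from convolutions and the last inclusion *)

Section Decay.
Context (R : realType) (d : nat) (V : decreasing_weight_system R d).
Local Notation Rd := 'rV[R]_d.

(** Two uses of the decay condition give the power - 2 (d + 1) of the Euclidean
    norm, which dominates the product of the 1 + x_i^2 outside a ball. *)
Lemma decay_quad m : weight_decay V -> exists l, exists2 C : R, 0 < C &
  forall x, (V l x)%:num <= C * ((V m x)%:num * \prod_i (1 + x 0 i ^+ 2)^-1).
Proof.
move=> dV; have [m1 mm1 [C1 [r1 [C10 r10 H1]]]] := dV m.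
have [l m1l [C2 [r2 [C20 r20 H2]]]] := dV m1.
pose r := Num.max (Num.max r1 r2) 1.
have r1r : r1 <= r by rewrite /r !le_max lexx.
have r2r : r2 <= r by rewrite /r !le_max lexx orbT.
have r11 : 1 <= r by rewrite /r !le_max lexx !orbT.
exists l; exists (C1 * C2 * 2 ^+ d + (1 + r ^+ 2) ^+ d) => [|x].
  by rewrite ltr_pwDr ?mulr_ge0 ?exprn_ge0 ?(ltW C10) ?(ltW C20)// exprn_gt0// ltr_pwDl// sqr_ge0.
have W0 : 0 < \prod_i (1 + x 0 i ^+ 2) by apply: prodr_gt0 => i _; rewrite ltr_pwDl// sqr_ge0.
rewrite prodfV mulrA ler_pdivlMr//.
have e0 := enorm_ge0 x; set e := enorm x in e0 *.
have We : \prod_i (1 + x 0 i ^+ 2) <= (1 + e ^+ 2) ^+ d.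
  rewrite -[in leRHS](card_ord d) -prodr_const; apply: ler_prod => i _.
  rewrite addr_ge0 ?sqr_ge0//= lerD2l -[x 0 i ^+ 2]real_normK ?num_real//.
  by rewrite lerXn2r ?nnegrE// coord_enorm.
have ml : (V l x)%:num <= (V m x)%:num by apply: dws_mono; rewrite ltnW// (ltn_trans mm1).
rewrite mulrDl; have [re|er] := leP r e; last first.
  apply: ler_wpDl; first by rewrite !mulr_ge0// ?exprn_ge0// ltW.
  rewrite mulrC ler_pM ?(ltW W0)// (le_trans We)// lerXn2r ?nnegrE ?addr_ge0 ?sqr_ge0//.
  by rewrite lerD2l lerXn2r ?nnegrE ?(ltW er)// (le_trans ler01).
apply: ler_wpDr; first by rewrite !mulr_ge0 ?exprn_ge0 ?addr_ge0 ?sqr_ge0.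
have h1 := H1 x (le_trans r1r re); have h2 := H2 x (le_trans r2r re).
rewrite -/e in h1 h2.
have e1 : 1 <= e by exact: le_trans re.
have e10 : 0 < e by exact: lt_le_trans e1.
have ed0 : 0 < e ^+ d.+1 by rewrite exprn_gt0.
rewrite ler_pdivrMr// in h1; rewrite ler_pdivrMr// in h2.
have h3 : (V l x)%:num <= C1 * C2 / (e ^+ d.+1 * e ^+ d.+1) * (V m x)%:num.
  rewrite (le_trans h2)//.
  have -> : C1 * C2 / (e ^+ d.+1 * e ^+ d.+1) * (V m x)%:num =
     C2 / e ^+ d.+1 * (C1 / e ^+ d.+1 * (V m x)%:num).
    by field; rewrite gt_eqF.
  by rewrite ler_wpM2l// divr_ge0// ltW.
have We2 : \prod_i (1 + x 0 i ^+ 2) <= 2 ^+ d * (e ^+ d.+1 * e ^+ d.+1).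
  apply: le_trans We _; apply: (@le_trans _ _ ((2 * e ^+ 2) ^+ d)).
    rewrite lerXn2r ?nnegrE ?addr_ge0 ?mulr_ge0 ?sqr_ge0//.
    by rewrite mulr_natl mulr2n lerD2r expr_ge1.
  rewrite exprMn ler_wpM2l ?exprn_ge0// -exprM -exprD ler_weXn2l//.
  by rewrite mul2n -addnn addnS addSn !leqW.
apply: le_trans (ler_pM _ (ltW W0) h3 We2) _ => //.
by rewrite le_eqVlt; apply/orP; left; apply/eqP; field; rewrite gt_eqF.
Qed.

End Decay.

Lemma eighths (R : realType) (r : R) : 0 < r -> r / 2 + (r / 8 + r / 8) < r.
Proof. by move=> r0; lra. Qed.

Section LastInclusion.
Context (R : realType) (d : nat).
Local Notation Rd := 'rV[R]_d.
Local Notation fct := ('rV[R]_d -> R[i]^o).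
Implicit Types (psi phi : fct) (x y : Rd) (s : seq 'I_d).
Context (c : ultra_class) (M A : weight_sequence R) (V : decreasing_weight_system R d).
Hypotheses (M1M : cond_M1 M) (M2A : cond_M2 A).
Local Notation conv := (@Defs.conv R d).
Context (C0 : R) (H : {posnum R}).
Hypotheses (C01 : 1 <= C0) (H1 : 1 <= H%:num).
Hypothesis HM : forall p q,
  (M (p + q)%N)%:num <= C0 * H%:num ^+ (p + q) * (M p)%:num * (M q)%:num.
Hypotheses (admV : admissible c A V) (decayV : weight_decay V).
Local Notation E := (BV c M V).
Local Notation S := (GS d c M A).
Local Notation W := (dual_system V).
Local Notation quad x := (\prod_i (1 + x 0 i ^+ 2)^-1).

Lemma qspace_double (P : {posnum R} -> Prop) : qspace c P -> qspace c (fun h => P (dbl h)).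
Proof.
case: (c) => /= [HP h|[h Ph]]; first exact: HP.
exists (h%:num / 2)%:pos; rewrite (_ : dbl _ = h)//.
by apply: val_inj => /=; rewrite mulrC divfK.
Qed.

Lemma bnd_weight h (v w : Rd -> R) (C K : R) phi : 0 <= C -> 0 <= h ->
  (forall x, v x <= C * w x) -> bnd M h w K phi -> bnd M h v (C * K) phi.
Proof.
move=> C_ge0 h0 vw [sphi Hphi]; split=> // s x.
apply: (@le_trans _ _ (C * (h ^+ size s * w x * cmod (pderivs s phi x)))).
  have -> : C * (h ^+ size s * w x * cmod (pderivs s phi x)) =
    h ^+ size s * (C * w x) * cmod (pderivs s phi x) by ring.
  by rewrite ler_wpM2r ?cmod_ge0// ler_wpM2l// exprn_ge0.
by rewrite -[leRHS]mulrA ler_wpM2l.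
Qed.

Context (ch : fct) (P : nat -> fct).
Hypothesis chS : forall k : {posnum R}, exists K, bnd M k%:num (gsw A k) K ch.
Hypothesis Psum : forall N x,
  P N x = \sum_(k : {ffun 'I_d -> 'I_(N.*2)}) ch (lattice R k - x).
Hypothesis Pcvg : forall k : R, 0 < k -> exists2 K, 0 <= K & forall N : nat,
  bnd M k (fun x => quad x) (K / (1 + N%:R)) (fun x => 1 - P N x).

(** phi (1 - P N) tends to 0 in a later step of B_V: the decay of the weights
    absorbs the polynomial growth in the estimate of 1 - P N. *)
Lemma pairing_remainder (f : dual E) phi n (e : R) : 0 < e ->
  qspace c (fun h => exists K, Gw M (V n) h K phi) ->
  exists N0, forall N, (N0 <= N)%N -> lcs_dom E (fun x => phi x * (1 - P N x)) /\
    cmod (pairing f (fun x => phi x * (1 - P N x))) <= e.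
Proof.
move=> e0 Hphi.
have [n' [C C_gt0 HC]] := decay_quad n decayV.
have q0 x : 0 < quad x by exact: prod_quad_gt0.
have step h K : Gw M (V n) (dbl h) K phi -> exists2 K', 0 <= K' & forall N : nat,
    Gw M (V n') h (K' / (1 + N%:R)) (fun x => phi x * (1 - P N x)).
  move=> G; have K_ge0 : 0 <= K by apply: bnd_ge0 G => x.
  have dh0 : 0 < (dbl h)%:num by [].
  have [K3 K3_ge0 H3] := Pcvg dh0.
  exists (C * ((M 0%N)%:num * K * K3)) => [|N]; first by rewrite !mulr_ge0// ltW.
  have Vn0 x : 0 < (V n x)%:num by [].
  have h0 : 0 < h%:num by [].
  have L := bnd_mul M1M h0 Vn0 q0 G (H3 N).
  have := bnd_weight (ltW C_gt0) (ltW h0) HC L.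
  by congr (bnd _ _ _ _ _); ring.
have dom N : lcs_dom E (fun x => phi x * (1 - P N x)).
  apply/BV_domP; exists n'; apply: qspace_impl (qspace_double Hphi) => h [K G].
  by have [K' _ HK'] := step h K G; exists (K' / (1 + N%:R)).
have domn N : lcs_dom (Bw c M (V n')) (fun x => phi x * (1 - P N x)).
  apply/Bw_domP; apply: qspace_impl (qspace_double Hphi) => h [K G].
  by have [K' _ HK'] := step h K G; exists (K' / (1 + N%:R)).
have [h [[K G] [C1 C10 fC]]] := qspace_qdual (qspace_double Hphi) (dual_dominated f n').
have [K' K'0 HK'] := step h K G.
exists (Num.truncn (C1 * K' / e)) => N NN; split=> //.
apply: le_trans (fC _ _ (domn N) (HK' N)) _.
rewrite mulrA ler_pdivrMr ?ltr_pwDl// [leRHS]mulrC -ler_pdivrMr// ltW// (lt_le_trans (truncnS_gt _))//.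
by rewrite -natr1 addrC lerD2l ler_nat.
Qed.

(** The piece of phi near y, reflected so that convolution evaluated at y pairs
    the functional with phi ch(y - .). *)
Definition localised (y : Rd) phi : fct := fun t => phi (y - t) * ch t.

Lemma localised_sets n (B : set fct) :
  qspace c (fun h => exists K, forall phi, B phi -> Gw M (V n) h K phi) ->
  exists m, qspace c (fun h => exists K, forall phi, B phi -> forall y,
    Gs M A h K (fun t => (V m y)%:num%:C * localised y phi t)).
Proof.
move=> HB.
have [lambda [m nm [C C_gt0 ad]]] : exists lambda, exists2 m, (n <= m)%N &
    exists2 C : R, 0 < C & adm A C lambda (fun x => (V m x)%:num) (fun x => (V n x)%:num).
  by have := admissible_adm admV n; case: (c) => /= [//|/(_ 1%:pos) ?]; exists 1%:pos.
exists m; apply: qspace_impl (qspace_double HB) => h [K HK].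
have [Ca [Ha [Ca0 Ha1 sq]]] := eA_sq M2A.
have Ha0 : 0 < Ha by exact: lt_le_trans Ha1.
(* dilating by Ha makes the weight of ch absorb the product of the weights with
   parameters lambda and h, both below mu *)
pose mu := Num.max (Num.max lambda%:num h%:num) (dbl h)%:num.
have mu0 : 0 < mu by rewrite /mu !lt_max gt0.
have lmu : lambda%:num <= mu by rewrite /mu !le_max lexx.
have hmu : h%:num <= mu by rewrite /mu !le_max lexx orbT.
have h2mu : (dbl h)%:num <= mu by rewrite /mu !le_max lexx !orbT.
pose k : {posnum R} := PosNum (mulr_gt0 Ha0 mu0).
have h2k : (dbl h)%:num <= k%:num.
  by rewrite /= (le_trans h2mu)// ler_peMl// ltW.
have prodE (t : Rd) : gsw A lambda t * gsw A h t <= Ca * gsw A k t.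
  have en := enorm_ge0 t.
  apply: (@le_trans _ _ (eA A (mu * enorm t) * eA A (mu * enorm t))).
    by rewrite ler_pM ?gsw_ge0// /gsw eA_mono// ler_wpM2r.
  by rewrite /gsw /= -mulrA; apply: sq; rewrite mulr_ge0// ltW.
have [K' HK'] := chS k.
exists ((M 0%N)%:num * C * Ca * K * K') => phi Bphi y.
have Vgt0 q z : 0 < (V q z)%:num by [].
have L := bnd_localise M1M C_gt0 Ca0 (Vgt0 n) (Vgt0 m) ad prodE (HK _ Bphi) HK' h2k y.
rewrite GsE.
have h2 : (dbl h)%:num / 2 = h%:num by rewrite /= mulrAC divff ?mul1r.
rewrite h2 in L.
have h0 : 0 <= h%:num by [].
have := bnd_scale (V m y)%:num%:C (fun t => gsw_ge0 A h t) h0 L.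
rewrite cmod_real gtr0_norm// mulrC divfK ?gt_eqF//.
Qed.

(** f on phi is recovered from the values (f * psi_k)(k) at lattice points k of
    its convolutions with the localised pieces psi_k of phi. *)
Lemma pairing_close (f g : dual E) n m l phi (C del e : R) : 0 <= C -> 0 <= del -> 0 < e ->
  (forall x, (V l x)%:num <= C * ((V m x)%:num * quad x)) ->
  qspace c (fun h => exists K, Gw M (V n) h K phi) ->
  (forall y, lcs_dom S (fun t => (V m y)%:num%:C * localised y phi t)) ->
  (forall y, cmod (conv f (fun t => (V m y)%:num%:C * localised y phi t) y -
                   conv g (fun t => (V m y)%:num%:C * localised y phi t) y) <= del * (V l y)%:num) ->
  cmod (pairing f phi - pairing g phi) <= del * C * 6 ^+ d + (e + e).
Proof.
move=> C_ge0 del0 e0 HC Hphi domS Hdel.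
have Ephi : lcs_dom E phi by apply/BV_domP; exists n.
pose u y : fct := fun t => phi t * ch (y - t).
have uE y : (fun t => (V m y)%:num%:C * localised y phi (y - t)) = (V m y)%:num%:C *: u y.
  by apply/funext => t; rewrite /localised /u subKr.
have Eu' y : lcs_dom E ((V m y)%:num%:C *: u y).
  rewrite -uE; exact: (conv_translate C01 H1 HM admV f y (domS y)).
have Eu y : lcs_dom E (u y).
  have := subspaceZ (lcs_domP E) (V m y)%:num^-1%:C (Eu' y).
  by rewrite scalerA -rmorphM mulVf ?gt_eqF// scale1r.
have Hu y : cmod (pairing f (u y) - pairing g (u y)) <= del * C * quad y.
  have := Hdel y; rewrite /Defs.conv uE !pairingZ// -mulrBr cmodM cmod_real gtr0_norm//.
  rewrite mulrC -ler_pdivlMr// => /le_trans; apply.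
  rewrite ler_pdivrMr// -!mulrA ler_wpM2l//.
  by rewrite [quad y * _]mulrC.
have [N1 HN1] := pairing_remainder f e0 Hphi.
have [N2 HN2] := pairing_remainder g e0 Hphi.
pose N := maxn N1 N2.
have [D1 r1] := HN1 N (leq_maxl _ _); have [_ r2] := HN2 N (leq_maxr _ _).
(* the lattice sum over |k| < N represents phi P_N; what is left is small *)
have split_phi : phi = (fun x => phi x * (1 - P N x)) +
    \sum_(k : {ffun 'I_d -> 'I_(N.*2)}) u (lattice R k).
  apply/funext => x.
  rewrite -[RHS]/(phi x * (1 - P N x) +
    (\sum_(k : {ffun 'I_d -> 'I_(N.*2)}) u (lattice R k)) x).
  have -> : (\sum_(k : {ffun 'I_d -> 'I_(N.*2)}) u (lattice R k)) x = phi x * P N x.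
    by rewrite fct_sumE Psum mulr_sumr.
  by rewrite mulrBr mulr1 subrK.
have pf (f' : dual E) : pairing f' phi = pairing f' (fun x => phi x * (1 - P N x)) +
    \sum_(k : {ffun 'I_d -> 'I_(N.*2)}) pairing f' (u (lattice R k)).
  have [Ds <-] := pairing_sum f' (index_enum {ffun 'I_d -> 'I_(N.*2)}) (fun k => Eu (lattice R k)).
  have := pairing_lin f' 1 D1 Ds; rewrite scale1r mul1r => <-.
  by rewrite -split_phi.
rewrite !pf opprD addrACA addrC (le_trans (cmodD _ _))// lerD//; last first.
  by rewrite (le_trans (cmodB _ _))// lerD.
rewrite -sumrB (le_trans (cmod_sum _ _ _))//.
apply: (@le_trans _ _ (\sum_(k : {ffun 'I_d -> 'I_(N.*2)}) del * C * quad (lattice R k))).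
  by apply: ler_sum => k _; exact: Hu.
by rewrite -mulr_sumr ler_wpM2l ?mulr_ge0// lattice_sum.
Qed.

Lemma open_iii_sub_ii :
  @open (top_iii c M V) `<=` @open (conv_topology E S (WC W)).
Proof.
move=> O OO; rewrite openE => f Of.
apply: (@clin_unif_nbhs_sub R (lcs_type E) R[i]^o (dual E) (BV_sets (c := c) (M := M) (V := V))
  (f : dual E) (nbhs (f : conv_topology E S (WC W))) (fun g : dual E => g)); last first.
  by apply: open_nbhs_nbhs; split.
move=> B U /BV_setsP[n HB] entU.
have [r r0 rU] : exists2 r : R, 0 < r & forall a b : R[i], cmod (a - b) < r -> U (a, b).
  move: entU; rewrite -entourage_from_ballE => -[e /= e0 eU].
  have eE : e = (complex.Re e)%:C by move: e0; rewrite ltcE /=; case: (e) => a b /= /andP[/eqP ->].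
  exists (complex.Re e) => [|a b ab]; first by rewrite -ltcR -eE.
  by apply: eU => /=; rewrite -ball_normE /= cmodE eE ltcR.
pose B' := [set lcs_val b | b in B].
have HB' : qspace c (fun h => exists K, forall phi, B' phi -> Gw M (V n) h K phi).
  by apply: qspace_impl HB => h [K HK]; exists K => _ [b Bb <-]; exact: HK.
have [m HS] := localised_sets HB'.
have [l [C C_gt0 HC]] := decay_quad m decayV.
have D0 : 0 < C * 6 ^+ d + 1 by rewrite ltr_wpDl// mulr_ge0 ?exprn_ge0// ltW.
pose del := r / 2 / (C * 6 ^+ d + 1).
have del0 : 0 < del by rewrite !divr_gt0.
have domS phi y : B' phi -> lcs_dom S (fun t => (V m y)%:num%:C * localised y phi t).
  move=> Bphi; apply/GS_domP; apply: qspace_impl HS => h [K HK].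
  by exists K; exact: HK.
pose Cs := [set u : lcs_type S | exists phi y, B' phi /\
  lcs_val u = (fun t => (V m y)%:num%:C * localised y phi t)].
have bCs : tvs_bounded Cs.
  apply: (@clim_bounded R fct c _ (directed_GS d M A) (Gs M A)).
  - move=> h p Ep; have [C' C'0 HC'] := Bh_dominated Ep.
    by exists C' => // f' K Df Gf; exact: HC' Df Gf.
  - by move=> h K f' Gf; exact: Gw_dom Gf.
  - apply: qspace_impl HS => h [K HK]; exists K => u [phi [y [Bphi ->]]].
    exact: HK.
have entq : entourage [set ab : lcs_type (WC W) * lcs_type (WC W) |
    WC_norm W l (lcs_val ab.1 - lcs_val ab.2) < del].
  have Eq : lcs_seminorms (WC W) (WC_norm W l) by apply/WC_seminorm; exists l.
  exists [:: WC_norm W l], del; split=> // [p|ab]; first by rewrite inE => /eqP ->.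
  by move=> /(_ _ (mem_head _ _)).
have near := @initial_continuous (dual E) (clin_unif (lcs_type (WC W)) _)
  (@conv_map R d E S (WC W)) f _ (clin_unif_nbhs (conv_map S (WC W) f) entq bCs).
apply: (@filterS (dual E) (nbhs (f : conv_topology E S (WC W)))
  (nbhs_filter (f : conv_topology E S (WC W))) _ _ _ near) => g Hg b Bb.
apply: rU.
have B'b : B' (lcs_val b) by exists b.
have Hb : qspace c (fun h => exists K, Gw M (V n) h K (lcs_val b)).
  by apply: qspace_impl HB' => h [K HK]; exists K; exact: HK.
have r8 : 0 < r / 8 by rewrite divr_gt0.
have bval (f' : dual E) : val f' b = pairing f' (lcs_val b).
  rewrite (pairingE f' (lcs_dom_val b)); congr (val f' _); exact: val_inj.
rewrite !bval.
have := @pairing_close f g n m l (lcs_val b) C del (r / 8) (ltW C_gt0) (ltW del0) r8 HC Hb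
  (fun y => domS _ y B'b).
move=> pc; apply: le_lt_trans (pc _) _ => {pc}; last first.
  have : del * C * 6 ^+ d <= r / 2.
    rewrite /del -mulrA mulrAC ler_pdivrMr// ler_wpM2l ?(ltW (divr_gt0 r0 _))//.
    by rewrite lerDl.
  move=> h; apply: le_lt_trans (lerD h (lexx _)) _; exact: eighths.
move=> y; pose u := lcs_elt (domS _ y B'b).
have Cu : Cs u by exists (lcs_val b), y.
have := Hg u Cu; rewrite /= !(conv_map_WC C01 H1 HM admV) => lt.
have Du (f' : dual E) := conv_WC C01 H1 HM admV f' (lcs_dom_val u).
have ge := WC_seminorm_ge l y (subspaceB (lcs_domP _) (Du f) (Du g)).
have := le_lt_trans ge lt; rewrite /= mulrC -ltr_pdivlMr ?invr_gt0// invrK => /ltW.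
exact.
Qed.

End LastInclusion.

Theorem theorem4p25 (R : realType) (d : nat) (c : ultra_class)
    (M A : weight_sequence R) (V : decreasing_weight_system R d)
    (M1M : cond_M1 M) (M1A : cond_M1 A) (M2M : cond_M2 M) (M2A : cond_M2 A)
    (factMA : prec (fun p => p`!%:R) (fun p => (M p)%:num * (A p)%:num))
    (GS_neq0 : exists2 phi : 'rV[R]_d -> R[i]^o,
       lcs_dom (GS d Beurling M A) phi & phi <> (fun=> 0))
    (decayV : weight_decay V) (admV : admissible c A V) :
  let B_V := BV c M V in
  let S := GS d c M A in
  let B_V' := BW c M (dual_system V) in
  let V'C := WC (dual_system V) in
  let top_i := conv_topology B_V S B_V' in
  let top_ii := conv_topology B_V S V'C in
  let top_iii := dual_topology (BV_sets (c := c) (M := M) (V := V)) in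
  (@open top_i = @open top_ii :> set (set (dual B_V))) /\
  (@open top_ii = @open top_iii :> set (set (dual B_V))).
Proof.
move=> B_V S B_V' V'C tp_i tp_ii tp_iii.
have [C0 [H [C01 H1 HM]]] := M2M.
have H0 : 0 < H by exact: lt_le_trans H1.
have [phi Dphi phi_neq0] := GS_neq0.
have [x phix] : exists x, phi x <> 0.
  by apply: contrapT => N; apply: phi_neq0; apply/funext => x; apply: contrapT => h; apply: N; exists x.
have Hphi := iffLR (GS_domP Beurling M A phi) Dphi.
have [ch [P [chS Psum Pcvg]]] := partition_of_unity M1M (ex_intro _ x phix) Hphi.
have i_iii := @open_i_sub_iii R d c M A V C0 (PosNum H0) C01 H1 HM admV.
have ii_i := @open_ii_sub_i R d c M A V C0 (PosNum H0) C01 H1 HM admV.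
have iii_ii := @open_iii_sub_ii R d c M A V M1M M2A C0 (PosNum H0) C01 H1 HM admV decayV
  ch P chS Psum Pcvg.
split; apply/seteqP; split.
- by move=> O /i_iii /iii_ii.
- exact: ii_i.
- by move=> O /ii_i /i_iii.
- exact: iii_ii.
Qed.
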